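(* Let $1\le k\le d$, let $M\subset\mathbb P^d_{\mathbb R}$ be a submanifold of dimension $k$, and fix $D\in\mathbb N$. Let $\Psi:U\to M$ be a local parameterization of $M$ ($U\subset\mathbb R^k$ open), let $\mu$ be an absolutely friendly measure on $U$, and let $\nu=\Psi_*\mu$. If $\nu$-almost every point of $M$ is $D$-nondegenerate, then $\nu(\mathrm{VWA}_M)=0$. In particular, if $\lambda_M$-almost every point of $M$ is $D$-nondegenerate, then $\lambda_M(\mathrm{VWA}_M)=0$.
   Context: $\mathbb P^d_{\mathbb R}$ is real projective space, $\pi(\mathbf x)=[\mathbf x]$, $\mathbb P^d_{\mathbb Q}=\{[\mathbf p]:\mathbf p\in\mathbb Q^{d+1}\setminus\{0\}\}$, $\mathrm{dist}$ a fixed Riemannian metric on $\mathbb P^d_{\mathbb R}$, $\|\cdot\|$ the max norm, $H_{\mathrm{std}}([\mathbf p])=\|\mathbf p\|$ for $\mathbf p$ a primitive integer representative, $\psi_c(q)=q^{-c}$. Submanifolds are $C^\infty$ and embedded. For $\psi:(0,\infty)\to(0,\infty)$, $\mathrm A_M(\psi)$ is the set of $[\mathbf x]\in M$ such that infinitely many $[\mathbf r]\in\mathbb P^d_{\mathbb Q}\cap M$ satisfy $\mathrm{dist}([\mathbf r],[\mathbf x])\le\psi(H_{\mathrm{std}}([\mathbf r]))$. $\mathrm{VWA}_M=\bigcup_{c>c(k,d)}\mathrm A_M(\psi_c)$. $\lambda_M$ is the $k$-dimensional Hausdorff measure restricted to $M$. $c(k,d)$: with $[n,m]=\binom{n+m}{m}$,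 let $n_{k,d}$ be the largest positive integer $n$ with $d=k+\sum_{j=2}^n[k-1,j]+m$ for some integer $m\ge0$, $m_{k,d}$ that $m$, $N_{k,d}=k+\sum_{j=2}^{n_{k,d}}j[k-1,j]+(n_{k,d}+1)m_{k,d}$, $c(k,d)=(d+1)/N_{k,d}$. $D$-nondegenerate: if $\Phi:V\to\mathbb R^{d+1}\setminus\{0\}$ ($V\subset\mathbb R^k$ open) is smooth, $\pi\circ\Phi$ is a local parameterization of $M$ and $\pi\circ\Phi(\mathbf v)=[\mathbf x]$, then $[\mathbf x]$ is $D$-nondegenerate if $\{\partial^\alpha\Phi(\mathbf v):|\alpha|\le D\}$ spans $\mathbb R^{d+1}$. A measure $\mu$ on $\mathbb R^k$ is absolutely decaying if there are $C,\alpha>0$ such that for all $\mathbf x\in\mathrm{Supp}(\mu)$, $0<\rho\le1$, $\epsilon>0$ and every affine hyperplane $L$, $\mu(L^{(\epsilon\rho)}\cap B(\mathbf x,\rho))\le C\epsilon^\alpha\mu(B(\mathbf x,\rho))$ ($L^{(r)}$ the $r$-neighbourhood); doubling if there is $C$ with $\mu(B(\mathbf x,2\rho))\le C\mu(B(\mathbf x,\rho))$ for $\mathbf x\in\mathrm{Supp}(\mu)$, $0<\rho\le1$; absolutely friendly if both. *)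

(* Defs.v *)
From HB Require Import structures.
From mathcomp Require Import all_boot all_order all_algebra.
From mathcomp Require Import all_classical all_reals all_analysis.

Set Implicit Arguments.
Unset Strict Implicit.
Unset Printing Implicit Defensive.

Import Order.TTheory GRing.Theory Num.Theory.
Import numFieldNormedType.Exports.

Local Open Scope classical_set_scope.
Local Open Scope ring_scope.

(** * Smooth maps on open subsets of R^n

    'rV[R]_n carries the max norm; [ball] is the corresponding open ball. *)

Definition dpartial (R : realType) (n : nat) (W : normedModType R) (i : 'I_n)
  (f : 'rV[R]_n -> W) : 'rV[R]_n -> W := fun x => 'D_(delta_mx 0 i) f x.

Definition dpartials (R : realType) (n : nat) (W : normedModType R)
  (s : seq 'I_n) (f : 'rV[R]_n -> W) : 'rV[R]_n -> W :=
  foldr (fun i h => dpartial i h) f s.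

(* C^oo on V (meant for V open): all iterated partial derivatives exist and are
   continuous at the points of V. *)
Definition smooth_on (R : realType) (n : nat) (W : normedModType R)
  (V : set 'rV[R]_n) (f : 'rV[R]_n -> W) : Prop :=
  forall (s : seq 'I_n) (x : 'rV[R]_n), V x ->
    {for x, continuous (dpartials s f)} /\
    forall i : 'I_n, derivable (dpartials s f) x (delta_mx 0 i).

(* partial^alpha for a multi-index alpha; the order of differentiation is
   fixed, and immaterial for smooth maps. *)
Definition multi_partial (R : realType) (n D : nat) (W : normedModType R)
  (alpha : {ffun 'I_n -> 'I_D.+1}) (f : 'rV[R]_n -> W) : 'rV[R]_n -> W :=
  dpartials (flatten [seq nseq (alpha i) i | i <- enum 'I_n]) f.

(** * Real projective space: lines of R^(d+1) *)

Definition proj_space (R : realType) (d : nat) :=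
  {L : {vspace 'rV[R]_d.+1} | \dim L == 1%N}.

Lemma dim_line (R : realType) (d : nat) :
  \dim <[const_mx 1 : 'rV[R]_d.+1]>%VS == 1%N.
Proof.
rewrite dim_vline; suff -> : (const_mx 1 : 'rV[R]_d.+1) != 0 by [].
by apply/eqP => /rowP /(_ 0); rewrite !mxE; apply/eqP/oner_neq0.
Qed.

Definition line0 (R : realType) (d : nat) : proj_space R d :=
  @exist _ (fun L => \dim L == 1%N) _ (dim_line R d).

HB.instance Definition _ (R : realType) (d : nat) :=
  Choice.on (proj_space R d).
HB.instance Definition _ (R : realType) (d : nat) :=
  isPointed.Build (proj_space R d) (line0 R d).

(* x |-> [x], with a junk value at x = 0 *)
Definition proj_pt (R : realType) (d : nat) (x : 'rV[R]_d.+1) : proj_space R d :=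
  insubd (line0 R d) <[x]>%VS.

(* the quotient topology *)
Definition proj_open (R : realType) (d : nat) (O : set (proj_space R d)) :=
  open [set x : 'rV[R]_d.+1 | x != 0 /\ O (proj_pt x)].

(** * Rational points and the standard height *)

Definition rational_point (R : realType) (d : nat) (P : proj_space R d) : Prop :=
  exists p : 'rV[rat]_d.+1, p != 0 /\ proj_pt (map_mx ratr p) = P.

Definition primitive_rep (R : realType) (d : nat) (P : proj_space R d)
  (p : 'rV[int]_d.+1) : Prop :=
  \big[gcdn/0%N]_(i < d.+1) `|p 0%R i|%N = 1%N /\ proj_pt (map_mx intr p) = P.

(* A rational point has exactly two primitive representatives, p and - p. *)
Definition Hstd (R : realType) (d : nat) (P : proj_space R d) : R :=
  `| map_mx intr (xget 0 [set p | primitive_rep P p]) : 'rV[R]_d.+1 |.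

(** * Riemannian metrics on projective space

    A Riemannian metric on P^d is given by its pullback to R^(d+1) \ {0}: a
    smooth family of symmetric bilinear forms (v, w) |-> v G(x) w^T.  As the
    kernel of d(proj_pt) at x is R x and proj_pt (t x) = proj_pt x, the families
    arising as pullbacks of Riemannian metrics are those which at each x are positive
    modulo R x, vanish on R x, and satisfy G(t x)(t v, t w) = G(x)(v, w). *)
Record riemannian_metric (R : realType) (d : nat) := RiemannianMetric {
  gram :> 'rV[R]_d.+1 -> 'M[R]_d.+1 ;
  gram_smooth : smooth_on [set x | x != 0] gram ;
  gram_sym : forall x, x != 0 -> (gram x)^T = gram x ;
  gram_ker : forall x, x != 0 -> x *m gram x = 0 ;
  gram_pos : forall x v, x != 0 -> v \notin <[x]>%VS ->
    0 < (v *m gram x *m v^T) 0 0 ;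
  gram_homog : forall (t : R) x, t != 0 -> x != 0 ->
    t ^+ 2 *: gram (t *: x) = gram x }.

Local Open Scope ereal_scope.

Definition curve_length (R : realType) (d : nat) (g : riemannian_metric R d)
  (gamma : R -> 'rV[R]_d.+1) : \bar R :=
  \int[lebesgue_measure]_(t in `[0%R, 1%R])
    (Num.sqrt ((derive1 gamma t *m g (gamma t) *m (derive1 gamma t)^T)
                 0%R 0%R))%:E.

(* Every C^1 curve [0,1] -> P^d lifts to a C^1 curve in R^(d+1) \ {0}, which
   extends, as a C^1 curve in R^(d+1), to the whole of R; the length does not
   depend on the lift.  The infimum over piecewise C^1 curves is the same. *)
Definition connecting_curve (R : realType) (d : nat) (P Q : proj_space R d)
  (gamma : R -> 'rV[R]_d.+1) : Prop :=
  [/\ forall t : R, derivable gamma t 1%R,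
      continuous (derive1 gamma),
      forall t : R, (0 <= t <= 1)%R -> gamma t != 0%R,
      proj_pt (gamma 0%R) = P & proj_pt (gamma 1%R) = Q].

Definition riem_dist (R : realType) (d : nat) (g : riemannian_metric R d)
  (P Q : proj_space R d) : \bar R :=
  ereal_inf [set curve_length g gamma | gamma in connecting_curve P Q].

(** * Hausdorff (outer) measure *)

(* The maximum with 0 makes the diameter of the empty set 0. *)
Definition diameter (R : realType) (T : Type) (rho : T -> T -> \bar R)
  (A : set T) : \bar R :=
  maxe 0 (ereal_sup [set rho x y | x in A & y in A]).

Definition hausdorff_pre (R : realType) (T : Type) (rho : T -> T -> \bar R)
  (s : nat) (delta : R) (A : set T) : \bar R :=
  ereal_inf [set \sum_(0 <= i <oo) (diameter rho (E i)) ^+ s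
    | E in [set E : nat -> set T | A `<=` \bigcup_i E i /\
              forall i, diameter rho (E i) <= delta%:E]].

Definition hausdorff (R : realType) (T : Type) (rho : T -> T -> \bar R)
  (s : nat) (A : set T) : \bar R :=
  ereal_sup [set hausdorff_pre rho s delta A
    | delta in [set delta : R | (0 < delta)%R]].

Definition lambda_meas (R : realType) (d : nat) (g : riemannian_metric R d)
  (k : nat) (M A : set (proj_space R d)) : \bar R :=
  hausdorff (riem_dist g) k (A `&` M).

Local Close Scope ereal_scope.

(** * Embedded submanifolds, local parameterizations, nondegeneracy *)

(* Psi is a diffeomorphism of the open set U onto a relatively open subset of M:
   a smooth immersion (first clause), injective, and open onto its image with
   the topology induced from M.  In terms of a lift Phi of Psi, the differential
   of Psi at u is injective iff Phi(u) and the first order partial derivatives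
   of Phi at u are linearly independent. *)
Definition local_param (R : realType) (k d : nat) (M : set (proj_space R d))
  (U : set 'rV[R]_k) (Psi : 'rV[R]_k -> proj_space R d) : Prop :=
  [/\ open U,
      forall u, U u -> exists (V : set 'rV[R]_k) (Phi : 'rV[R]_k -> 'rV[R]_d.+1),
        [/\ open V, V u, V `<=` U & smooth_on V Phi] /\
        [/\ forall v, V v -> Phi v != 0,
            forall v, V v -> Psi v = proj_pt (Phi v) &
            free (Phi u :: [seq dpartial i Phi u | i <- enum 'I_k])],
      Psi @` U `<=` M,
      set_inj U Psi &
      forall W : set 'rV[R]_k, open W -> W `<=` U ->
        exists2 O : set (proj_space R d), proj_open O & Psi @` W = O `&` M].

Definition submanifold (R : realType) (k d : nat) (M : set (proj_space R d)) :=
  forall P, M P -> exists (U : set 'rV[R]_k) (Psi : 'rV[R]_k -> proj_space R d),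
    local_param M U Psi /\ (Psi @` U) P.

(* For P in M this does not depend on the choice of V, Phi and v. *)
Definition D_nondegenerate (R : realType) (k d : nat) (D : nat)
  (M : set (proj_space R d)) : set (proj_space R d) := [set P |
  exists (V : set 'rV[R]_k) (Phi : 'rV[R]_k -> 'rV[R]_d.+1) (v : 'rV[R]_k),
    [/\ open V, smooth_on V Phi, forall w, V w -> Phi w != 0 &
        local_param M V (fun w => proj_pt (Phi w))] /\
    [/\ V v, proj_pt (Phi v) = P &
        <<[seq multi_partial alpha Phi v
             | alpha : {ffun 'I_k -> 'I_D.+1} <- enum {ffun 'I_k -> 'I_D.+1}
             & (\sum_(i < k) alpha i <= D)%N]>>%VS = fullv]].

(** * Measures on open subsets of R^k and their push-forwards *)

Definition borelRn (R : realType) (k : nat) :=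
  g_sigma_algebraType (@open 'rV[R]_k).

Definition borelP (R : realType) (d : nat) :=
  g_sigma_algebraType (@proj_open R d).

(* A locally finite Borel measure on the open set U, extended by 0 to R^k *)
Definition measure_on (R : realType) (k : nat) (U : set 'rV[R]_k)
  (mu : {measure set (borelRn R k) -> \bar R}) : Prop :=
  mu (~` U) = 0%E /\
  forall x, U x -> exists2 r : R, 0 < r & (mu (ball x r) < +oo)%E.

(* The support of a measure on U is a (relatively closed) subset of U; for
   U = setT it is the usual support of a measure on R^k. *)
Definition msupp (R : realType) (k : nat) (U : set 'rV[R]_k)
  (mu : {measure set (borelRn R k) -> \bar R}) : set 'rV[R]_k :=
  [set x | U x /\ forall r : R, 0 < r -> (0 < mu (ball x r))%E].

Definition affine_hyperplane (R : realType) (k : nat) (L : set 'rV[R]_k) : Prop :=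
  exists (a : 'cV[R]_k) (b : R), a != 0 /\ L = [set x | (x *m a) 0 0 = b].

Definition neighbourhood (R : realType) (k : nat) (L : set 'rV[R]_k) (r : R) :
  set 'rV[R]_k := \bigcup_(y in L) ball y r.

Definition absolutely_decaying (R : realType) (k : nat) (U : set 'rV[R]_k)
  (mu : {measure set (borelRn R k) -> \bar R}) : Prop :=
  exists (C alpha : R), [/\ 0 < C, 0 < alpha &
    forall (x : 'rV[R]_k) (rho eps : R) (L : set 'rV[R]_k),
      msupp U mu x -> 0 < rho <= 1 -> 0 < eps -> affine_hyperplane L ->
      (mu (neighbourhood L (eps * rho) `&` ball x rho)
        <= (C * eps `^ alpha)%:E * mu (ball x rho))%E].

Definition doubling (R : realType) (k : nat) (U : set 'rV[R]_k)
  (mu : {measure set (borelRn R k) -> \bar R}) : Prop :=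
  exists C : R, forall (x : 'rV[R]_k) (rho : R),
    msupp U mu x -> 0 < rho <= 1 ->
    (mu (ball x (2 * rho)) <= C%:E * mu (ball x rho))%E.

Definition absolutely_friendly (R : realType) (k : nat) (U : set 'rV[R]_k)
  (mu : {measure set (borelRn R k) -> \bar R}) : Prop :=
  absolutely_decaying U mu /\ doubling U mu.

(* Psi_* mu for Psi defined on U, as a Borel measure on projective space *)
Definition pushforward_on (R : realType) (k d : nat) (U : set 'rV[R]_k)
  (Psi : 'rV[R]_k -> proj_space R d)
  (mu : {measure set (borelRn R k) -> \bar R}) : set (borelP R d) -> \bar R :=
  fun A => mu (U `&` Psi @^-1` A).

(** * The exponent c(k, d) *)

(* k + sum_(2 <= j <= n) [k-1, j], where [n, m] = 'C(n + m, m) *)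
Definition dimsum (k n : nat) : nat :=
  (k + \sum_(2 <= j < n.+1) 'C(k.-1 + j, j))%N.

(* For 1 <= k, dimsum k n <= d forces n <= d, so the bound on n is harmless. *)
Definition n_kd (k d : nat) : nat :=
  \max_(n < d.+1 | (0 < n)%N && (dimsum k n <= d)%N) n.

Definition m_kd (k d : nat) : nat := (d - dimsum k (n_kd k d))%N.

Definition N_kd (k d : nat) : nat :=
  (k + \sum_(2 <= j < (n_kd k d).+1) j * 'C(k.-1 + j, j)
     + (n_kd k d).+1 * m_kd k d)%N.

Definition c_kd (R : realType) (k d : nat) : R := d.+1%:R / (N_kd k d)%:R.

(** * Intrinsic approximation on M *)

Definition psi_ (R : realType) (c : R) : R -> R := fun q => q `^ (- c).

Definition approximable (R : realType) (d : nat) (g : riemannian_metric R d)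
  (M : set (proj_space R d)) (f : R -> R) : set (proj_space R d) :=
  [set P | M P /\
    infinite_set [set r | [/\ rational_point r, M r &
                             (riem_dist g r P <= (f (Hstd r))%:E)%E]]].

Definition VWA (R : realType) (k d : nat) (g : riemannian_metric R d)
  (M : set (proj_space R d)) : set (proj_space R d) :=
  \bigcup_(c in [set c : R | c_kd R k d < c]) approximable g M (psi_ c).

(* Main.v *)
(* Write c0 = c(k, d).  A very well approximable point lies, for some c > c0 and
   infinitely many j, within about 2^(- c j) of a rational point of M of height in
   [2^j, 2^(j+1)).  By Borel-Cantelli it suffices that, near a nondegenerate point,
   the set E_j of such points has measure decaying geometrically in j.

   Cover E_j by balls of radius rho about 2^(- c0 j).  Expanding a lift Phi of the
   parameterization in a Taylor series bounds the determinant of d + 1 lifts of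
   points of such a ball by rho^(N_(k,d)); for rational points of height at most
   2^(j+1) this determinant, suitably normalized, is an integer of absolute value
   less than 1, so these points lie in a hyperplane ker P.  Hence E_j is contained,
   on each ball, in a sublevel set of the function P . Phi at a level which is
   small compared with its size, since by nondegeneracy one of its derivatives of
   order at most D is bounded below.  Such sublevel sets have small measure, as the
   measure decays near affine hyperplanes.

   Besides monotonicity and subadditivity this uses only the decay and a packing
   bound for balls.  These hold for absolutely friendly measures and, more simply,
   for a Hausdorff content in the chart, which settles the second assertion without
   comparing Hausdorff and Lebesgue measures.  The Riemannian metric enters through
   its comparison with the distance between the entries of the orthogonal
   projections onto lines. *)

Require Import Defs.
From HB Require Import structures.
From mathcomp Require Import all_boot all_order all_algebra.
From mathcomp Require Import all_classical all_reals all_analysis.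
From mathcomp Require Import perm.
From mathcomp Require Import zify ring lra.

Set Implicit Arguments.
Unset Strict Implicit.
Unset Printing Implicit Defensive.

Import Order.TTheory GRing.Theory Num.Theory.
Import numFieldNormedType.Exports.

Local Open Scope classical_set_scope.
Local Open Scope ring_scope.

(** * Mean value estimates and vanishing orders *)

(** The hyperplane that contains the rational points of a ball is not under control, so every
    estimate has to be uniform in the linear form [P]; the function [P . Phi] is normalized by its
    largest scaled derivative at the centre. On a ball of radius [rho] nondegeneracy only makes this
    derivative at least of the order of [rho ^ D], and the Taylor remainder has to be smaller than
    that by the relative level [2 ^ (- (c - c0) j)], which for large [c] is a high power of [rho].
    Hence jets of order [D + p] are used, with [p] depending on [c - c0]. Nondegeneracy is given for
    some lift and some parameterization; it is carried to the chart at hand through the size of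
    values alone, without differentiating a change of charts. A quantitative form of injectivity,
    together with the relative openness of chart images, replaces the inverse function theorem. The
    estimates are for outer measures, so that the covering arguments apply to arbitrary sets. *)

Section MeanValue.
Context {R : realType}.

Lemma ball_rVE n (x y : 'rV[R]_n) (e : R) : ball x e y = (`|x - y| < e) :> Prop.
Proof. by rewrite mx_norm_ball. Qed.

Lemma rV_norm_leP n (x : 'rV[R]_n) (c : R) :
  0 <= c -> (forall i, `|x 0 i| <= c) -> `|x| <= c.
Proof.
move=> c0 xc; rewrite [leLHS]/Num.Def.normr/= mx_normrE.
by apply: bigmax_le => // -[i j] _ /=; rewrite ord1.
Qed.

Lemma rV_norm_ltP n (x : 'rV[R]_n) (c : R) :
  0 < c -> (forall i, `|x 0 i| < c) -> `|x| < c.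
Proof.
move=> c0 xc; rewrite [ltLHS]/Num.Def.normr/= mx_normrE.
by apply: bigmax_lt => // -[i j] _ /=; rewrite ord1.
Qed.

Lemma coord_le_norm n (x : 'rV[R]_n) i : `|x 0 i| <= `|x|.
Proof.
rewrite [leRHS]/Num.Def.normr/= mx_normrE.
by apply: (@le_bigmax _ _ _ _ (fun p : 'I_1 * 'I_n => `|x p.1 p.2|) (0, i)).
Qed.

Lemma norm_delta_le n (i : 'I_n) (t : R) :
  `|t *: (delta_mx 0 i : 'rV[R]_n)| <= `|t|.
Proof.
apply: rV_norm_leP => // j; rewrite !mxE eqxx /=; case: eqP => _.
  by rewrite mulr1.
by rewrite mulr0 normr0.
Qed.

Lemma is_derive_line n (W : normedModType R) (f : 'rV[R]_n -> W)
    (x e : 'rV[R]_n) (u : R) :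
  derivable f (x + u *: e) e ->
  is_derive u 1 (fun t : R => f (x + t *: e)) ('D_e f (x + u *: e)).
Proof.
have E : (fun h : R => h^-1 *: (f (x + (h *: (1 : R) + u) *: e) - f (x + u *: e)))
       = (fun h : R => h^-1 *: (f (h *: e + (x + u *: e)) - f (x + u *: e))).
  apply/funext => h; congr (_ *: (f _ - _)).
  by rewrite scalerDl addrCA /GRing.scale/= mulr1.
move=> fd; apply: DeriveDef; rewrite ?/derivable ?/derive /=.
  by move: fd; rewrite /derivable -E.
by rewrite -E.
Qed.

Lemma mvt_abs (g dg : R -> R) (a b K : R) :
  (forall t, Num.min a b <= t <= Num.max a b -> is_derive t 1 g (dg t)) ->
  (forall t, Num.min a b <= t <= Num.max a b -> `|dg t| <= K) ->
  `|g b - g a| <= K * `|b - a|.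
Proof.
wlog ab : a b / a <= b => [hw|].
  case/orP: (le_total a b) => [|ba]; first exact: hw.
  by rewrite minC maxC distrC [`|b - a|]distrC; exact: hw.
rewrite (min_idPl ab) (max_idPr ab) => gd dgK.
have cg : {within `[a, b], continuous g}.
  apply: derivable_within_continuous => t.
  by rewrite in_itv /= => /gd [].
have gd' t : t \in `]a, b[ -> is_derive t 1 g (dg t).
  by rewrite in_itv /= => /andP[/ltW at_ /ltW tb]; apply: gd; rewrite at_ tb.
have [c] := MVT_segment ab gd' cg.
rewrite in_itv /= => cab ->; rewrite normrM ler_wpM2r //.
exact: dgK.
Qed.

Lemma ball_segment n (v x e : 'rV[R]_n) (rho t u : R) :
  ball v rho x -> ball v rho (x + t *: e) -> Num.min 0 t <= u <= Num.max 0 t ->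
  ball v rho (x + u *: e).
Proof.
rewrite !ball_rVE => hx hxt hu.
have [s /andP[s0 s1] ->] : exists2 s, 0 <= s <= 1 & u = s * t.
  have [t0|t0|t0] := ltgtP 0 t.
  - exists (u / t); last by rewrite divfK // gt_eqF.
    move: hu; rewrite (min_idPl (ltW t0)) (max_idPr (ltW t0)) => /andP[u0 ut].
    by rewrite divr_ge0 ?(ltW t0) // ler_pdivrMr // mul1r.
  - exists (u / t); last by rewrite divfK // lt_eqF.
    move: hu; rewrite (min_idPr (ltW t0)) (max_idPl (ltW t0)) => /andP[ut u0].
    by rewrite mulr_le0 ?invr_le0 ?(ltW t0) //= ler_ndivrMr // mul1r.
  - exists 0; rewrite ?lexx ?ler01 // mul0r; apply/eqP.
    by move: hu; rewrite -t0 minxx maxxx -eq_le eq_sym.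
have -> : v - (x + (s * t) *: e) = (1 - s) *: (v - x) + s *: (v - (x + t *: e)).
  by apply/rowP => i; rewrite !mxE; ring.
apply: (le_lt_trans (ler_normD _ _)); rewrite !normrZ.
rewrite (ger0_norm s0) ger0_norm ?subr_ge0 //.
have [->|sn0] := eqVneq s 0; first by rewrite mul0r addr0 subr0 mul1r.
have sp : 0 < s by rewrite lt0r sn0.
have -> : rho = (1 - s) * rho + s * rho by ring.
by rewrite ler_ltD ?ltr_pM2l // ler_wpM2l ?subr_ge0 // ltW.
Qed.

Lemma mvt_leg n (f : 'rV[R]_n -> R^o) (v x : 'rV[R]_n) (rho t K : R) (i : 'I_n) :
  ball v rho x -> ball v rho (x + t *: delta_mx 0 i) ->
  (forall u, ball v rho (x + u *: delta_mx 0 i) ->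
     derivable f (x + u *: delta_mx 0 i) (delta_mx 0 i)) ->
  (forall u, ball v rho (x + u *: delta_mx 0 i) ->
     `|dpartial i f (x + u *: delta_mx 0 i)| <= K) ->
  `|f (x + t *: delta_mx 0 i) - f x| <= K * `|t|.
Proof.
move=> hx hxt fd fK; rewrite -[in f x](addr0 x) -(scale0r (delta_mx 0 i)).
rewrite -[in leRHS](subr0 t).
apply: (@mvt_abs (fun t => f (x + t *: delta_mx 0 i))
  (fun t => dpartial i f (x + t *: delta_mx 0 i))) => u hu.
  by apply: is_derive_line; apply: fd; exact: ball_segment hx hxt hu.
by apply: fK; exact: ball_segment hx hxt hu.
Qed.

(** Only partial derivatives are available, so the path from [y] to [x] changes one coordinate at a
    time. In the max norm its corners stay in the ball and each of the [n] legs has length at most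
    [|x - y|]; hence the factor [n]. *)
Lemma mvt_ball n (f : 'rV[R]_n -> R^o) (v x y : 'rV[R]_n) (rho K : R) :
  ball v rho x -> ball v rho y ->
  (forall z i, ball v rho z -> derivable f z (delta_mx 0 i)) ->
  (forall z i, ball v rho z -> `|dpartial i f z| <= K) ->
  `|f x - f y| <= n%:R * K * `|x - y|.
Proof.
move=> hx hy fd fK.
pose z (m : nat) : 'rV[R]_n := \row_j if (j < m)%N then x 0 j else y 0 j.
have z0 : z 0%N = y by apply/rowP => j; rewrite mxE ltn0.
have zn : z n = x by apply/rowP => j; rewrite mxE ltn_ord.
have hz m : ball v rho (z m).
  have rho0 : 0 < rho by move: hx; rewrite ball_rVE; exact: le_lt_trans.
  move: hx hy; rewrite !ball_rVE => hx hy.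
  apply: (@le_lt_trans _ _ (Num.max `|v - x| `|v - y|)); last by rewrite gt_max hx hy.
  apply: rV_norm_leP; first by rewrite le_max normr_ge0.
  move=> j; rewrite !mxE le_max; case: ifP => _; apply/orP; [left|right].
    by have := coord_le_norm (v - x) j; rewrite !mxE.
  by have := coord_le_norm (v - y) j; rewrite !mxE.
have zS (m : 'I_n) : z m.+1 = z m + (x 0 m - y 0 m) *: delta_mx 0 m.
  apply/rowP => j; rewrite !mxE eqxx /= ltnS leq_eqVlt.
  have [<-|jm] := eqVneq j m; first by rewrite eqxx ltnn /= mulr1; ring.
  by rewrite (inj_eq val_inj) (negbTE jm) /= mulr0 addr0.
have := telescope_sumr (fun m => f (z m)) (leq0n n).
rewrite zn z0 big_mkord => <-.
apply: (le_trans (ler_norm_sum _ _ _)).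
rewrite -mulrA mulr_natl -[leRHS](_ : \sum_(i < n) K * `|x - y| = _); last first.
  by rewrite sumr_const card_ord.
apply: ler_sum => m _; rewrite zS.
have K0 : 0 <= K by exact: le_trans (fK x m hx).
apply: (@le_trans _ _ (K * `|x 0 m - y 0 m|)).
  apply: mvt_leg (hz m) _ _ _; first by rewrite -zS.
  - by move=> u hu; exact: fd.
  - by move=> u hu; exact: fK.
apply: ler_wpM2l => //.
by have := coord_le_norm (x - y) m; rewrite !mxE.
Qed.

End MeanValue.

(** * Iterated partial derivatives and estimates of jets on a ball *)

Section SmoothFunctions.
Context {R : realType}.

Lemma dpartials_rcons n (W : normedModType R) (s : seq 'I_n) i
    (f : 'rV[R]_n -> W) :
  dpartials (rcons s i) f = dpartials s (dpartial i f).
Proof. by rewrite /dpartials foldr_rcons. Qed.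

Lemma smooth_dpartial n (W : normedModType R) V i (f : 'rV[R]_n -> W) :
  smooth_on V f -> smooth_on V (dpartial i f).
Proof.
by move=> fs s x Vx; have := fs (rcons s i) x Vx; rewrite dpartials_rcons.
Qed.

Lemma smooth_onS n (W : normedModType R) V V' (f : 'rV[R]_n -> W) :
  V' `<=` V -> smooth_on V f -> smooth_on V' f.
Proof. by move=> VV fs s x /VV; exact: fs. Qed.

Lemma smooth_derivable n (W : normedModType R) V (f : 'rV[R]_n -> W) s x i :
  smooth_on V f -> V x -> derivable (dpartials s f) x (delta_mx 0 i).
Proof. by move=> fs Vx; have [] := fs s x Vx. Qed.

Arguments smooth_derivable {n W V f} s {x} i _ _.

Lemma cvg_sumr (T : Type) (F : set_system T) (I : finType) (f : I -> T -> R)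
    (a : I -> R) : Filter F ->
  (forall i, f i x @[x --> F] --> a i) ->
  \sum_i f i x @[x --> F] --> \sum_i a i.
Proof.
by move=> FF fa; apply: cvg_big => // -[x y]; exact: (cvgD cvg_fst cvg_snd).
Qed.

Lemma cvg_coord (T : Type) (F : set_system T) m n (f : T -> 'M[R]_(m, n))
    (a : 'M[R]_(m, n)) i j :
  Filter F -> f x @[x --> F] --> a -> f x i j @[x --> F] --> a i j.
Proof.
move=> FF fa.
exact: (@cvg_comp _ _ _ f (fun M : 'M[R]_(m, n) => M i j) _ _ _ fa
  (@coord_continuous _ _ _ _ _ a)).
Qed.

(** The function [g] followed by the linear form with coefficients [P]. With [P] a basis vector it
    is a coordinate of [g], which reduces vector-valued estimates to scalar ones. *)
Definition pairing n m (g : 'rV[R]_n -> 'rV[R]_m) (P : 'cV[R]_m) :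
  'rV[R]_n -> R^o := fun x => (g x *m P) 0 0.

Lemma is_derive_pairing n m (g : 'rV[R]_n -> 'rV[R]_m) P x e :
  derivable g x e -> is_derive x e (pairing g P) (('D_e g x *m P) 0 0).
Proof.
move=> gd; have gdj j : is_derive x e (fun y => g y 0 j : R^o)
    ('D_e (fun y => g y 0 j : R^o) x).
  by apply: derivableP; move/derivable_mxP : gd; exact.
have -> : pairing g P = \sum_(j < m) ((P j 0 : R) \*: (fun y => g y 0 j : R^o)).
  apply/funext => y; rewrite fct_sumE /pairing mxE; apply: eq_bigr => j _.
  by rewrite mulrC.
have -> : ('D_e g x *m P) 0 0 =
    \sum_(j < m) (P j 0 *: 'D_e (fun y => g y 0 j : R^o) x : R^o).
  by rewrite mxE; apply: eq_bigr => j _; rewrite derive_mx // mxE mulrC.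
by apply: is_derive_sum => j; exact: is_deriveZ.
Qed.

Lemma cvg_pairing n m (g : 'rV[R]_n -> 'rV[R]_m) P x :
  {for x, continuous g} -> {for x, continuous (pairing g P)}.
Proof.
move=> gc; have -> : pairing g P = (fun y => \sum_j g y 0 j * P j 0 : R^o).
  by apply/funext => y; rewrite /pairing mxE.
apply: (@cvg_sumr _ (nbhs x)) => j; apply: cvgMr_tmp.
exact: (@cvg_coord _ (nbhs x) _ _ g (g x) 0 j _ gc).
Qed.

Lemma dpartials_pairing n m (g : 'rV[R]_n -> 'rV[R]_m) P V s x :
  open V -> smooth_on V g -> V x ->
  dpartials s (pairing g P) x = pairing (dpartials s g) P x.
Proof.
move=> oV gs; elim: s x => [//|i s IH] x Vx /=.
rewrite [LHS](near_eq_derive (g := pairing (dpartials s g) P)); last first.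
  by near=> y; apply: IH; near: y; exact: open_nbhs_nbhs.
by have [_ ->] := is_derive_pairing P (smooth_derivable s i gs Vx).
Unshelve. all: by end_near. Qed.

Lemma smooth_pairing n m (g : 'rV[R]_n -> 'rV[R]_m) P V :
  open V -> smooth_on V g -> smooth_on V (pairing g P).
Proof.
move=> oV gs s x Vx.
have E : {near x, pairing (dpartials s g) P =1 dpartials s (pairing g P)}.
  near=> y; rewrite (dpartials_pairing _ _ oV gs) //.
  by near: y; exact: open_nbhs_nbhs.
split.
  have := @cvg_pairing _ _ _ P _ (gs s x Vx).1.
  rewrite /prop_for /continuous_at (nbhs_singleton E) => c.
  by apply: cvg_trans c; exact: (@near_eq_cvg _ _ (nbhs x) _ _ _ E).
move=> i; apply: near_eq_derivable E _.
by have [] := is_derive_pairing P (smooth_derivable s i gs Vx).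
Unshelve. all: by end_near. Qed.

Lemma smooth_near_bounded n (W : normedModType R) (V : set 'rV[R]_n)
    (f : 'rV[R]_n -> W) v L :
  smooth_on V f -> V v ->
  exists2 K : R, 0 < K & \forall x \near v,
    forall s, (size s <= L)%N -> `|dpartials s f x| <= K.
Proof.
move=> fs Vv.
pose K := \sum_(j < L.+1) \sum_(t : j.-tuple 'I_n) (`|dpartials t f v| + 1) + 1.
have pos (j : nat) (t : j.-tuple 'I_n) : 0 <= `|dpartials t f v| + 1.
  by rewrite addr_ge0.
exists K.
  by rewrite ltr_wpDl // sumr_ge0 // => j _; rewrite sumr_ge0.
have H : \forall x \near v, forall (j : 'I_L.+1) (t : j.-tuple 'I_n),
    `|dpartials t f x| <= K.
  apply: (@filter_forall _ 'I_L.+1 _ (nbhs v)) => j.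
  apply: (@filter_forall _ (j.-tuple 'I_n) _ (nbhs v)) => t.
  have /cvgr_dist_lt /(_ 1 ltr01) fc := (fs t v Vv).1.
  near=> x; apply: (@le_trans _ _ (`|dpartials t f v| + 1)); last first.
    rewrite /K (bigD1 j) //= (bigD1 t) //= -2!addrA lerDl.
    by rewrite !addr_ge0 // sumr_ge0 // => i _; rewrite sumr_ge0.
  have : `|dpartials t f v - dpartials t f x| < 1 by near: x.
  move=> /ltW h; rewrite -lerBlDl; apply: le_trans h.
  by rewrite distrC lerB_dist.
apply: filterS H => x H s sL.
by have := H (Ordinal (sL : (size s < L.+1)%N)) (in_tuple s).
Unshelve. all: by end_near. Qed.

(** The quantities [w * rho ^+ size s * |dpartials s f|] are the derivatives of [w * f] rescaled to
    the unit ball. Descending from order [j + 1], each order is recovered from its values at the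
    centre and from the next order by the mean value theorem, at the cost of a factor [1 + n]. The
    lower limit [l] allows [f] itself to be large. *)
Lemma jet_bound n (f : 'rV[R]_n -> R^o) (v : 'rV[R]_n) (rho w a : R) (l j : nat) :
  0 < rho -> 0 < w -> 0 <= a -> smooth_on (ball v rho) f ->
  (forall s, (l <= size s <= j)%N ->
     w * rho ^+ size s * `|dpartials s f v| <= a) ->
  (forall s x, size s = j.+1 -> ball v rho x ->
     w * rho ^+ size s * `|dpartials s f x| <= a) ->
  forall s x, (l <= size s <= j.+1)%N -> ball v rho x ->
     w * rho ^+ size s * `|dpartials s f x| <= a * (1 + n%:R) ^+ (j.+1 - size s).
Proof.
move=> r0 w0 a0 fs fv ftop s x.
move hb : (j.+1 - size s)%N => b; elim: b s x hb => [|b IH] s x hb hs hx.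
  by rewrite mulr1; apply: ftop => //; lia.
have wr0 m : 0 < w * rho ^+ m by rewrite mulr_gt0 // exprn_gt0.
have n1 : (1 : R) <= 1 + n%:R by rewrite lerDl.
pose K := a * (1 + n%:R) ^+ b / (w * rho ^+ (size s).+1).
have vv : ball v rho v by exact: ballxx.
have := @mvt_ball R n (dpartials s f) v x v rho K hx vv.
move=> /(_ (fun z i hz => smooth_derivable s i fs hz)) H.
have {H}: `|dpartials s f x - dpartials s f v| <= n%:R * K * `|x - v|.
  apply: H => z i hz; rewrite ler_pdivlMr // mulrC.
  by apply: (IH (i :: s)) => //=; lia.
move=> H.
have {}H : `|dpartials s f x| <= `|dpartials s f v| + n%:R * K * rho.
  rewrite -lerBlDl; apply: (le_trans (lerB_dist _ _)); apply: (le_trans H).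
  have K0 : 0 <= K.
    by apply: divr_ge0; [rewrite mulr_ge0 // exprn_ge0 // addr_ge0|exact: ltW].
  apply: ler_wpM2l; first exact: mulr_ge0.
  by move: hx; rewrite ball_rVE distrC => /ltW.
apply: (@le_trans _ _ (w * rho ^+ size s * (`|dpartials s f v| + n%:R * K * rho))).
  by rewrite ler_wpM2l // ltW.
rewrite mulrDr.
have -> : w * rho ^+ size s * (n%:R * K * rho) = n%:R * (a * (1 + n%:R) ^+ b).
  rewrite /K exprS; field; rewrite !gt_eqF //= ?exprn_gt0 //.
have : w * rho ^+ size s * `|dpartials s f v| <= a.
  by apply: fv; lia.
have : a <= a * (1 + n%:R) ^+ b by rewrite ler_peMr // exprn_ege1.
by rewrite exprS; lra.
Qed.

Definition sorted_word n (s : seq 'I_n) :=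
  sorted (fun i j : 'I_n => (i <= j)%N) s.

Lemma sorted_word_cons n (i : 'I_n) s :
  sorted_word s -> all (fun j : 'I_n => (i <= j)%N) s -> sorted_word (i :: s).
Proof. by case: s => //= j s hs /andP[ij _]; rewrite ij. Qed.

(* Moving from the centre to [x] one coordinate at a time, each application of
   the mean value theorem along the i-th axis puts a letter [i] in front of a
   sorted word with letters [>= i]; so only sorted words occur, and the symmetry
   of second derivatives is not needed. *)
Lemma sorted_vanishing n (f : 'rV[R]_n -> R^o) (v : 'rV[R]_n) (rho K : R) (o : nat) :
  0 < rho -> 0 <= K -> smooth_on (ball v rho) f ->
  (forall s, sorted_word s -> (size s < o)%N -> dpartials s f v = 0) ->
  (forall s x, size s = o -> ball v rho x -> `|dpartials s f x| <= K) ->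
  forall x, ball v rho x -> `|f x| <= K * o.+1%:R ^+ n * rho ^+ o.
Proof.
move=> r0 K0 fs fv ftop.
have c1 i : (1 : R) <= o.+1%:R ^+ i by rewrite exprn_ege1 // ler1n.
(* The point may differ from the centre only in coordinates below [i], and the word has only letters
   [>= i]: for [i = 0] the point is the centre, for [i = n] the word is empty. *)
suff H i : (i <= n)%N -> forall s x, sorted_word s ->
    all (fun j : 'I_n => (i <= j)%N) s ->
    (size s <= o)%N -> ball v rho x ->
    (forall l : 'I_n, (i <= l)%N -> x 0 l = v 0 l) ->
    `|dpartials s f x| <= K * o.+1%:R ^+ i * rho ^+ (o - size s).
  move=> x hx; have := @H n (leqnn n) [::] x; rewrite subn0; apply => // l.
  by rewrite leqNgt ltn_ord.
elim: i => [_ s x ss _ so hx xv|i IH ilt].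
  have -> : x = v by apply/rowP => l; exact: xv.
  move: so; rewrite leq_eqVlt => /orP[/eqP so|so].
    by rewrite so subnn !mulr1; apply: ftop => //; exact: ballxx.
  by rewrite fv // normr0 !mulr_ge0 // exprn_ge0 // ltW.
have {}IH := IH (ltnW ilt).
pose i' := Ordinal ilt.
have H b s x : (size s + b = o)%N -> sorted_word s ->
    all (fun j : 'I_n => (i <= j)%N) s -> ball v rho x ->
    (forall l : 'I_n, (i < l)%N -> x 0 l = v 0 l) ->
    `|dpartials s f x| <= K * o.+1%:R ^+ i * b.+1%:R * rho ^+ b.
  elim: b s x => [|b IHb] s x hb ss si hx xv.
    rewrite !mulr1; apply: (@le_trans _ _ K); first by apply: ftop => //; lia.
    by rewrite ler_peMr.
  pose x' := x + (v 0 i' - x 0 i') *: delta_mx 0 i'.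
  have xE : x = x' + (x 0 i' - v 0 i') *: delta_mx 0 i'.
    by rewrite /x' -addrA -scalerDl addrA subrK subrr scale0r addr0.
  have x'E l : x' 0 l = if l == i' then v 0 l else x 0 l.
    rewrite !mxE eqxx /=; case: eqVneq => [->|_]; rewrite ?mulr1 ?mulr0 ?addr0 //.
    by rewrite addrC subrK.
  have hx' : ball v rho x'.
    move: hx; rewrite !ball_rVE; apply: le_lt_trans.
    apply: rV_norm_leP => // l; rewrite mxE [(- x') 0 l]mxE x'E.
    case: ifP => _; first by rewrite subrr normr0.
    by have := coord_le_norm (v - x) l; rewrite !mxE.
  have b1 : `|dpartials s f x'| <= K * o.+1%:R ^+ i * rho ^+ b.+1.
    have -> : b.+1 = (o - size s)%N by lia.
    apply: IH => //; first by lia.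
    move=> l il; rewrite x'E; case: eqVneq => // li; apply: xv.
    by rewrite ltn_neqAle il andbT; apply: contra li => /eqP li; exact/eqP/val_inj.
  have b2 : `|dpartials s f x - dpartials s f x'| <=
      K * o.+1%:R ^+ i * b.+1%:R * rho ^+ b * `|x 0 i' - v 0 i'|.
    rewrite {1}xE; apply: (@mvt_leg _ _ _ v _ rho) => //; first by rewrite -xE.
      by move=> u hu; exact: smooth_derivable _ _ fs hu.
    move=> u hu; apply: (IHb (i' :: s)) => //=.
    - by lia.
    - exact: sorted_word_cons.
    - by rewrite leqnn.
    - move=> l il; rewrite mxE [X in _ + X]mxE [X in _ + _ * X]mxE eqxx /= x'E.
      have /negbTE -> : l != i' by apply: contraTneq il => ->; rewrite ltnn.
      by rewrite mulr0 addr0 xv.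
  have b3 : `|x 0 i' - v 0 i'| <= rho.
    move: hx; rewrite ball_rVE distrC => /ltW; apply: le_trans.
    by have := coord_le_norm (x - v) i'; rewrite !mxE.
  rewrite -(subrK (dpartials s f x') (dpartials s f x)).
  apply: (le_trans (ler_normD _ _)).
  have K1 : 0 <= K * o.+1%:R ^+ i by rewrite mulr_ge0 // (le_trans ler01).
  have : K * o.+1%:R ^+ i * b.+1%:R * rho ^+ b * `|x 0 i' - v 0 i'| <=
         K * o.+1%:R ^+ i * b.+1%:R * rho ^+ b * rho.
    by rewrite ler_wpM2l // !mulr_ge0 // exprn_ge0 // ltW.
  have -> : K * o.+1%:R ^+ i * b.+2%:R * rho ^+ b.+1 = 
    K * o.+1%:R ^+ i * b.+1%:R * rho ^+ b * rho + K * o.+1%:R ^+ i * rho ^+ b.+1.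
    by rewrite -[b.+2]addn1 natrD exprSr; ring.
  by move=> b4; apply: lerD => //; exact: le_trans b4.
move=> s x ss si so hx xv.
apply: (@le_trans _ _ (K * o.+1%:R ^+ i * (o - size s).+1%:R * rho ^+ (o - size s))).
  apply: H => //; first by rewrite subnKC.
  by apply: sub_all si => j /ltnW.
rewrite exprSr mulrA ler_wpM2r ?exprn_ge0 ?(ltW r0) // ler_wpM2l //.
  by rewrite mulr_ge0 // (le_trans ler01).
by rewrite ler_nat ltnS leq_subr.
Qed.

End SmoothFunctions.

Arguments smooth_derivable {R n W V f} s {x} i _ _.

(** * Decay of sublevel sets *)

Section SeparatedSets.
Context {R : realType}.

Definition separated_seq n (r : R) (ys : seq 'rV[R]_n) :=
  pairwise (fun y z => r <= `|y - z|) ys.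

(** Pigeonhole on a grid of mesh [r]: two points in one cell are closer than [r] in the max norm. *)
Lemma separated_size n (v : 'rV[R]_n) (rho r : R) ys :
  0 < r -> (forall y, y \in ys -> ball v rho y) -> separated_seq r ys ->
  (size ys <= (Num.truncn (2 * rho / r)).+1 ^ n)%N.
Proof.
move=> r0 yv sep; set N := Num.truncn _.
pose c (y : 'rV[R]_n) i := (y 0 i - v 0 i + rho) / r.
have c0 y i : y \in ys -> 0 <= c y i <= 2 * rho / r.
  move=> /yv; rewrite ball_rVE => /ltW h.
  have := le_trans (coord_le_norm (v - y) i) h; rewrite !mxE ler_norml => /andP[h1 h2].
  by rewrite /c divr_ge0 ?(ltW r0) ?ler_pM2r ?invr_gt0 //; lra.
pose cell y : {ffun 'I_n -> 'I_N.+1} := [ffun i => inord (Num.truncn (c y i))].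
have -> : ((Num.truncn (2 * rho / r)).+1 ^ n = #|{ffun 'I_n -> 'I_N.+1}|)%N.
  by rewrite card_ffun !card_ord.
rewrite -(size_map cell); have /card_uniqP <- : uniq (map cell ys); last exact: max_card.
rewrite uniq_pairwise pairwise_map.
apply: (sub_in_pairwise (P := mem ys) _ _ sep); last exact/allP.
move=> y z yys zys /=; apply: contraTneq => /ffunP E; rewrite -ltNge.
have cE i : Num.truncn (c y i) = Num.truncn (c z i).
  have [/andP[y0 yN] /andP[z0 zN]] := (c0 y i yys, c0 z i zys).
  have := E i; rewrite !ffunE => /(congr1 val) /=; rewrite !inordK //.
    by rewrite ltnS; exact: le_truncn.
  by rewrite ltnS; exact: le_truncn.
apply: rV_norm_ltP => // i.
have [/andP[y0 _] /andP[z0 _]] := (c0 y i yys, c0 z i zys).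
have := truncn_itv y0; have := truncn_itv z0; rewrite cE.
set t : R := (Num.truncn _)%:R; rewrite -[X in X%:R]addn1 natrD -/t.
rewrite /c !ler_pdivlMr // !ltr_pdivrMr // => /andP[h1 h2] /andP[h3 h4].
by rewrite !mxE ltr_norml; apply/andP; split; lra.
Qed.

(** The size of separated families is bounded, so there is one of maximal size, and it is an
    [r]-net. *)
Lemma max_separated n (v : 'rV[R]_n) (rho r : R) (X : set 'rV[R]_n) :
  0 < r -> X `<=` ball v rho ->
  exists ys, [/\ forall y, y \in ys -> X y, separated_seq r ys &
    forall x, X x -> exists2 y, y \in ys & ball y r x].
Proof.
move=> r0 Xv.
pose P m := `[< exists ys, [/\ size ys = m, forall y, y \in ys -> X y & separated_seq r ys] >].
have P0 : exists m, P m by exists 0%N; apply/asboolP; exists [::].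
have Pub m : P m -> (m <= (Num.truncn (2 * rho / r)).+1 ^ n)%N.
  move=> /asboolP[ys [<- yX sep]]; apply: (separated_size r0 _ sep (v := v)).
  by move=> y /yX /Xv.
case: (ex_maxnP P0 Pub) => m /asboolP[ys [ysm yX sep]] mmax.
exists ys; split=> // x Xx; apply: contrapT => H.
suff /mmax : P m.+1 by rewrite ltnn.
apply/asboolP; exists (x :: ys); split.
- by rewrite /= ysm.
- by move=> y; rewrite inE => /orP[/eqP ->|/yX].
- rewrite /separated_seq /= -/(separated_seq r ys) sep andbT; apply/allP => y yys.
  rewrite leNgt; apply/negP => xy; apply: H; exists y => //.
  by rewrite ball_rVE distrC.
Qed.

Lemma neighbourhood_hyperplane n (a : 'cV[R]_n) (b e : R) (i : 'I_n) x :
  a i 0 != 0 -> `|(x *m a) 0 0 - b| < e * `|a i 0| ->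
  neighbourhood [set z : 'rV[R]_n | (z *m a) 0 0 = b] e x.
Proof.
move=> ai0 h.
pose t : R := ((x *m a) 0 0 - b) / a i 0.
exists (x - t *: delta_mx 0 i).
  rewrite /= mulmxBl mxE [X in _ + X]mxE -scalemxAl [X in _ - X]mxE.
  have -> : ((delta_mx 0 i : 'rV[R]_n) *m a) 0 0 = a i 0.
    rewrite mxE (bigD1 i) //= mxE !eqxx mul1r big1 ?addr0 // => j ji.
    by rewrite mxE (negbTE ji) andbF mul0r.
  by rewrite /t divfK // opprB addrC subrK.
rewrite ball_rVE addrAC subrr add0r normrN.
apply: (le_lt_trans (norm_delta_le _ _)).
by rewrite /t normrM normfV ltr_pdivrMr // normr_gt0.
Qed.

Lemma affine_hyperplane_cV n (a : 'cV[R]_n) (b : R) i : a i 0 != 0 ->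
  affine_hyperplane [set z : 'rV[R]_n | (z *m a) 0 0 = b].
Proof.
by move=> ai0; exists a, b; split=> //; apply: contraNneq ai0 => ->; rewrite mxE.
Qed.

End SeparatedSets.

(** * Set functions with decay near hyperplanes and a packing bound *)

Section Gauges.
Context {R : realType}.
Local Open Scope ereal_scope.

(* Common abstraction of an absolutely friendly measure [mu], for which
   [tau x r = mu (ball x r)] and [S] is the support, and of the k-dimensional
   Hausdorff content, for which [tau x r = r ^+ k]. *)
Record gauge n (m : {outer_measure set 'rV[R]_n -> \bar R}) (S : set 'rV[R]_n)
    (tau : 'rV[R]_n -> R -> \bar R) : Prop := Gauge {
  gauge_ge0 : forall x r, 0 <= tau x r ;
  gauge_decay : exists C alpha : R, [/\ (0 < C)%R, (0 < alpha)%R &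
    forall x (rho eps : R) L, S x -> (0 < rho <= 1)%R -> (0 < eps)%R ->
      affine_hyperplane L ->
      m (neighbourhood L (eps * rho) `&` ball x rho) <=
        (C * eps `^ alpha)%:E * tau x rho] ;
  gauge_packing : exists2 C : R, (0 < C)%R & forall x (r rho : R) ys,
    S x -> (0 < r)%R -> (r <= rho)%R -> (rho <= 1 / 2)%R ->
    (forall y, y \in ys -> S y /\ ball x rho y) -> separated_seq r ys ->
    \sum_(y <- ys) tau y (2 * r)%R <= C%:E * tau x rho ;
  gauge_fin : forall x, S x -> exists2 r0 : R, (0 < r0)%R &
    forall r : R, (0 < r <= r0)%R -> tau x r < +oo }.

Lemma outer_measure_seq (T : Type) (m : {outer_measure set T -> \bar R})
    (I : eqType) (ys : seq I) (A : set T) (B : I -> set T) :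
  (forall x, A x -> exists2 y, y \in ys & B y x) ->
  m A <= \sum_(y <- ys) m (B y).
Proof.
elim: ys A => [|y ys IH] A AB.
  rewrite big_nil (_ : A = set0) ?outer_measure0 //.
  by apply/seteqP; split => // x /AB[].
rewrite big_cons; apply: le_trans (leeD2l _ (IH (A `\` B y) _)).
  apply: le_trans (outer_measureU2 _ _ _); apply: le_outer_measure => x Ax.
  by have [|] := pselect (B y x); [left|right].
by move=> x [/AB[z]]; rewrite inE => /orP[/eqP ->//|zys Bz] _; exists z.
Qed.

(** Decay with [eps = 2] at a hyperplane through the centre, whose slab contains the ball. *)
Lemma gauge_ball n m S tau : (0 < n)%N -> @gauge n m S tau ->
  exists2 C : R, (0 < C)%R & forall x (rho : R), S x -> (0 < rho <= 1)%R ->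
    m (ball x rho) <= C%:E * tau x rho.
Proof.
move=> n0 G; have [C [al [C0 al0 H]]] := gauge_decay G.
exists (C * 2 `^ al)%R; first by rewrite mulr_gt0 // powR_gt0.
move=> x rho Sx hrho; pose i := Ordinal n0.
have ai0 : ((delta_mx i 0 : 'cV[R]_n) i 0 != 0)%R by rewrite mxE !eqxx oner_eq0.
pose b : R := ((x *m (delta_mx i 0 : 'cV[R]_n)) 0 0)%R.
have LH := affine_hyperplane_cV b ai0.
have H2 := H x rho 2%R _ Sx hrho (ltr0n _ 2) LH.
apply: le_trans H2.
apply: le_outer_measure => y hy; split => //; exists x; first by [].
move: hy; apply: le_ball; case/andP : hrho => r0 _.
by rewrite ler_peMl ?(ltW r0) // ler1n.
Qed.

End Gauges.

Section Taylor.
Context {R : realType}.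

Lemma delta_mulmx n (i : 'I_n) (a : 'cV[R]_n) :
  ((delta_mx 0 i : 'rV[R]_n) *m a) 0 0 = a i 0.
Proof.
rewrite mxE (bigD1 i) //= mxE !eqxx mul1r big1 ?addr0 // => j ji.
by rewrite mxE (negbTE ji) andbF mul0r.
Qed.

Lemma mxsubE p q (A B : 'M[R]_(p, q)) i j : (A - B) i j = A i j - B i j.
Proof. by rewrite !mxE. Qed.

Lemma is_derive_linear n (P : 'cV[R]_n) x e :
  is_derive x e (fun z : 'rV[R]_n => (z *m P) 0 0 : R^o) ((e *m P) 0 0).
Proof.
have := @is_derive_pairing R n n id P x e (@derivable_id _ _ x e).
by rewrite derive_id.
Qed.

Definition gradient n (f : 'rV[R]_n -> R^o) y : 'cV[R]_n :=
  \col_i (dpartial i f y : R).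

Lemma mvt_affine n (f : 'rV[R]_n -> R^o) (y : 'rV[R]_n) (r K : R)
    (x x' : 'rV[R]_n) (P : 'cV[R]_n) :
  (forall z i, ball y r z -> derivable f z (delta_mx 0 i)) ->
  (forall z i, ball y r z -> `|dpartial i f z - P i 0| <= K) ->
  ball y r x -> ball y r x' ->
  `|f x - f x' - ((x - x') *m P) 0 0| <= n%:R * K * `|x - x'|.
Proof.
move=> fd fK hx hx'.
pose l : 'rV[R]_n -> R^o := fun z => (z *m P) 0 0.
have gd z i : ball y r z ->
    is_derive z (delta_mx 0 i) (f - l) (dpartial i f z - P i 0).
  move=> hz; rewrite -(delta_mulmx i P).
  by apply: is_deriveB; [apply: derivableP; exact: fd|exact: is_derive_linear].
have -> : f x - f x' - ((x - x') *m P) 0 0 = (f - l) x - (f - l) x'.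
  by rewrite mulmxBl mxsubE !fctE /l; ring.
apply: (mvt_ball hx hx') => z i hz; have [h h'] := gd z i hz; first exact: h.
by rewrite /dpartial h'; exact: fK.
Qed.

Lemma taylor2 n (f : 'rV[R]_n -> R^o) (v y : 'rV[R]_n) (rho r K : R) x :
  0 < r -> 0 <= K -> smooth_on (ball v rho) f -> ball y r `<=` ball v rho ->
  (forall i j z, ball v rho z -> `|dpartials [:: i; j] f z| <= K) ->
  ball y r x ->
  `|f x - f y - ((x - y) *m gradient f y) 0 0| <= n%:R ^+ 2 * K * r ^+ 2.
Proof.
move=> r0 K0 fs yv fK hx.
have fd z s i : ball y r z -> derivable (dpartials s f) z (delta_mx 0 i).
  by move=> /yv; exact: smooth_derivable.
have yy : ball y r y by exact: ballxx.
have nr (z : 'rV[R]_n) : ball y r z -> `|z - y| <= r.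
  by rewrite ball_rVE distrC => /ltW.
have K1 : 0 <= n%:R * K by rewrite mulr_ge0.
have df z i : ball y r z -> `|dpartial i f z - gradient f y i 0| <= n%:R * K * r.
  move=> hz; rewrite mxE.
  apply: le_trans (ler_wpM2l K1 (nr z hz)).
  apply: (@mvt_ball _ _ (dpartial i f) y z y r) => //.
    by move=> u j hu; exact: (fd u [:: i]).
  by move=> u j /yv hu; exact: fK.
apply: (le_trans (mvt_affine (fun z i => fd z [::] i) df hx yy)).
apply: (le_trans (ler_wpM2l _ (nr x hx))); first by rewrite !mulr_ge0 // ltW.
by rewrite le_eqVlt; apply/orP; left; apply/eqP; ring.
Qed.

End Taylor.

(** * Sublevel sets of functions with a large jet *)

Section Decay.
Context {R : realType}.

Lemma mule_fin_ler (a b : R) (x : \bar R) :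
  (0 <= x)%E -> a <= b -> (a%:E * x <= b%:E * x)%E.
Proof. by move=> x0 ab; apply: lee_wpmul2r => //; rewrite lee_fin. Qed.

(** By [jet_bound] with [l = 1], the function [w * f] differs from its value at the centre by at
    most [ka / 4] on the ball of half the radius, so its absolute value stays above
    [ka / 2 >= ep]. *)
Lemma decay_dominant_constant n (f : 'rV[R]_n -> R^o) v (rho w ka ep : R) j x :
  0 < rho -> 0 < w -> 0 < ka ->
  smooth_on (ball v (2 * rho)) f ->
  (forall s, (1 <= size s <= j)%N -> w * (2 * rho) ^+ size s * `|dpartials s f v|
      <= ka / (2 * (1 + n%:R) ^+ j.+1)) ->
  (forall s z, size s = j.+1 -> ball v (2 * rho) z ->
    w * (2 * rho) ^+ size s * `|dpartials s f z| <= ep) ->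
  ep <= ka / (2 * (1 + n%:R) ^+ j.+1) ->
  ka <= w * `|f v| -> ball v rho x -> ep < w * `|f x|.
Proof.
move=> r0 w0 ka0 fs fv ftop epk kaf hx.
have n1 : 1 <= 1 + n%:R :> R by rewrite lerDl.
have n1j m : 1 <= (1 + n%:R) ^+ m :> R by rewrite exprn_ege1.
have n1p m : 0 < (1 + n%:R) ^+ m :> R by rewrite (lt_le_trans ltr01).
set a := ka / _ in epk fv.
have ap : 0 < a by rewrite divr_gt0 // mulr_gt0.
have r20 : 0 < 2 * rho by rewrite mulr_gt0.
have := @jet_bound _ n f v (2 * rho) w a 1 j r20 w0 (ltW ap) fs fv.
move=> /(_ (fun s z hs hz => le_trans (ftop s z hs hz) epk)) jb.
have hv : ball v (2 * rho) v by exact: ballxx.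
have {}hx2 : ball v (2 * rho) x by apply: le_ball hx; lra.
pose K := a * (1 + n%:R) ^+ j / (w * (2 * rho)).
have K0 : 0 <= K by rewrite divr_ge0 // mulr_ge0 // ltW.
have wr0 : 0 < w * (2 * rho) by rewrite mulr_gt0.
have H : `|f x - f v| <= n%:R * K * `|x - v|.
  apply: (mvt_ball hx2 hv) => z i hz; first exact: (smooth_derivable [::] i fs hz).
  rewrite ler_pdivlMr // mulrC.
  by have := jb [:: i] z isT hz; rewrite expr1 subSS subn0.
have {}H : `|f x - f v| <= n%:R * K * rho.
  apply: le_trans H _; apply: ler_wpM2l; first by rewrite mulr_ge0.
  by move: hx; rewrite ball_rVE distrC => /ltW.
have {}H : w * `|f x - f v| <= ka / 4.
  apply: (@le_trans _ _ (w * (n%:R * K * rho))); first by rewrite ler_wpM2l // ltW.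
  have -> : w * (n%:R * K * rho) = (n%:R / (1 + n%:R)) * (ka / 4).
    by rewrite /K /a exprS; field; rewrite !gt_eqF // (lt_le_trans ltr01).
  rewrite ler_piMl ?divr_ge0 ?(ltW ka0) // ler_pdivrMr ?(lt_le_trans ltr01) //.
  by rewrite mul1r lerDr.
have e2 : ep <= ka / 2.
  apply: le_trans epk _; rewrite /a invfM mulrA ler_piMr ?divr_ge0 ?(ltW ka0) //.
  by rewrite invf_le1.
have : `|f v| <= `|f x| + `|f x - f v|.
  by rewrite distrC -[X in _ <= X + _]normrN -lerBlDl; have := lerB_dist (f v) (f x); rewrite normrN; lra.
rewrite -(ler_pM2l w0) mulrDr; lra.
Qed.

(** The normalization under which the induction runs: on the ball of radius [2 * rho] the scaled jet
    of [w * f] is at most 1, and up to an error of the order of the level [ep] the function is a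
    polynomial of degree [j]. *)
Definition jet_bounded n (f : 'rV[R]_n -> R^o) v (rho w ep : R) j :=
  [/\ smooth_on (ball v (2 * rho)) f,
  forall s z, (size s <= j.+1)%N -> ball v (2 * rho) z ->
    w * (2 * rho) ^+ size s * `|dpartials s f z| <= 1 &
  forall s z, size s = j.+1 -> ball v (2 * rho) z ->
    w * (2 * rho) ^+ size s * `|dpartials s f z| <= ep].

Definition large_jet n (ka : R) j (f : 'rV[R]_n -> R^o) v (rho w : R) :=
  exists2 s, (size s <= j)%N & ka <= w * (2 * rho) ^+ size s * `|dpartials s f v|.

(** The last letter of [rcons s i] is the derivative taken first, so this says that some
    [dpartial i f] has a large jet of lower order, which is the form that the induction uses. *)
Definition large_pos_jet n (ka : R) j (f : 'rV[R]_n -> R^o) v (rho w : R) :=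
  exists s i, (size s < j)%N /\
    ka <= w * (2 * rho) ^+ (size s).+1 * `|dpartials (rcons s i) f v|.

Definition sublevel_decay n (m : {outer_measure set 'rV[R]_n -> \bar R}) S tau
    j (Q : ('rV[R]_n -> R^o) -> 'rV[R]_n -> R -> R -> Prop) :=
  exists C gam : R, [/\ 0 < C, 0 < gam &
  forall (f : 'rV[R]_n -> R^o) v (rho w ep : R),
  S v -> 0 < rho <= 1 / 2 -> 0 < w -> 0 < ep <= 1 ->
  jet_bounded f v rho w ep j -> Q f v rho w ->
  (m (S `&` ball v rho `&` [set x | (w * `|f x| <= ep)%R])
     <= (C * ep `^ gam)%:E * tau v rho)%E].

(** Three cases. A level above [kp] is covered by the trivial bound for the ball, whence the second
    term of the constant. If a derivative of positive order is at least [kp], the hypothesis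
    applies. Otherwise the value dominates the jet and the sublevel set is empty. *)
Lemma sublevel_decay_split n m S tau j ka : (0 < n)%N -> @gauge R n m S tau -> 0 < ka ->
  sublevel_decay m S tau j (large_pos_jet (ka / (2 * (1 + n%:R) ^+ j.+1)) j) ->
  sublevel_decay m S tau j (large_jet ka j).
Proof.
move=> n0 G ka0 [C [gam [C_gt0 gam0 H]]]; set kp := ka / _ in H.
have n1j : 1 <= (1 + n%:R) ^+ j.+1 :> R by rewrite exprn_ege1 // lerDl.
have kp0 : 0 < kp by rewrite divr_gt0 // mulr_gt0 // (lt_le_trans ltr01).
have kpka : kp <= ka.
  by rewrite ler_piMr ?(ltW ka0) // invf_le1; lra.
have [C0 C00 HC0] := gauge_ball n0 G.
have kpg : 0 < kp `^ gam by rewrite powR_gt0.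
exists (C + C0 / kp `^ gam), gam; split => //.
  by rewrite addr_gt0 // divr_gt0.
move=> f v rho w ep Sv hrho w0 hep fj [s sj hs].
have [ep0 ep1] := andP hep; have [rho0 rho1] := andP hrho.
have t0 := gauge_ge0 G v rho.
have [kpep|epkp] := ltP kp ep.
  apply: (@le_trans _ _ (C0%:E * tau v rho)%E).
    apply: (@le_trans _ _ (m (ball v rho))).
      by apply: le_outer_measure => z [[]].
    by apply: HC0 => //; rewrite rho0 /=; lra.
  apply: mule_fin_ler => //.
  apply: (@le_trans _ _ (C0 / kp `^ gam * ep `^ gam)); last first.
    by rewrite ler_wpM2r ?powR_ge0 // lerDr ltW.
  rewrite -mulrA ler_peMr ?(ltW C00) // mulrC ler_pdivlMr // mul1r.
  by apply: ge0_ler_powR; rewrite ?nnegrE ltW.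
have [Q|nQ] := pselect (large_pos_jet kp j f v rho w).
  apply: (le_trans (H f v rho w ep Sv hrho w0 hep fj Q)).
  apply: mule_fin_ler => //.
  by rewrite ler_wpM2r ?powR_ge0 // lerDl divr_ge0 // ltW.
have small s' : (1 <= size s' <= j)%N ->
    w * (2 * rho) ^+ size s' * `|dpartials s' f v| < kp.
  case/lastP: s' => // s' i; rewrite size_rcons => sz.
  by rewrite ltNge; apply/negP => hk; apply: nQ; exists s', i.
have kaf : ka <= w * `|f v|.
  have [s0|s0] := posnP (size s).
    by move: hs; rewrite (size0nil s0) mulr1.
  have : ka < kp by apply: (le_lt_trans hs); apply: small; rewrite s0.
  by rewrite ltNge kpka.
rewrite (_ : _ `&` _ = set0) ?outer_measure0 ?mule_ge0 ?lee_fin //.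
  by rewrite mulr_ge0 ?powR_ge0 // addr_ge0 ?divr_ge0 // ltW.
have [fs _ ftop] := fj.
apply/seteqP; split => // z [[_ hz]] /=; apply/negP; rewrite -ltNge.
apply: (@decay_dominant_constant n f v rho w ka ep j z) => //.
by move=> s' hs'; rewrite ltW // small.
Qed.

Lemma sublevel_decay_deriv n m S tau j ka : @gauge R n m S tau -> 0 < ka ->
  sublevel_decay m S tau j (large_jet ka j) ->
  sublevel_decay m S tau j.+1 (large_pos_jet ka j.+1).
Proof.
move=> G ka0 [Cg [gg [Cg0 gg0 Hg]]].
have [Cd [al [Cd0 al0 Hd]]] := gauge_decay G.
have [Cp Cp0 Hp] := gauge_packing G.
pose B : R := 1 + n%:R ^+ 2.
have B0 : 0 < B by rewrite ltr_pwDl // exprn_ge0.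
pose gam := Num.min gg al / 4.
have gam0 : 0 < gam by rewrite divr_gt0 // lt_min gg0.
have BC0 : 0 < Cd * B `^ al * Cp by rewrite !mulr_gt0 // powR_gt0.
exists (Cg + Cd * B `^ al * Cp), gam; split => //; first by rewrite addr_gt0.
move=> f v rho w ep Sv hrho w0 hep [fs fb ftop] [s [i [sj hs]]].
have [ep0 ep1] := andP hep; have [rho0 rho1] := andP hrho.
have t0 := gauge_ge0 G.
(* [t = ep ^ (1 / 4)] is the level below which the first derivative [g] counts as small. With
   [r = t ^ 2 * rho] the quadratic Taylor error is [O(ep)], and where [w * (2 * rho) * |g| > t] the
   sublevel set lies within [O(ep / t) * rho = O(t) * r] of a hyperplane. Both parts are bounded by
   powers of [t], so the exponents are divided by 4. *)
have [t tp t4] : exists2 t : R, 0 < t & t ^+ 4 = ep.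
  exists (ep `^ (4^-1)); first by rewrite powR_gt0.
  by rewrite -powR_mulrn ?powR_ge0 // -powRrM mulVf // powRr1 // ltW.
have t1 : t <= 1 by rewrite -(@expr_le1 _ 4) ?(ltW tp) // t4.
have tgam g : 4 * gam <= g -> t `^ g <= ep `^ gam.
  move=> gle; have -> : ep `^ gam = t `^ (4 * gam).
    by rewrite [RHS]powRrM powR_mulrn ?(ltW tp) // t4.
  by apply: ger_powR => //; rewrite tp.
have r20 : 0 < 2 * rho by rewrite mulr_gt0.
set E := _ `&` _.
pose g := dpartial i f.
pose E1 := S `&` ball v rho `&` [set x | w * (2 * rho) * `|g x| <= t].
pose E2 := E `\` E1.
have mE1 : (m E1 <= (Cg * t `^ gg)%:E * tau v rho)%E.
  have wr0 : 0 < w * (2 * rho) by rewrite mulr_gt0.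
  have ht : 0 < t <= 1 by rewrite tp t1.
  refine (Hg g v rho _ _ Sv hrho wr0 ht _ _).
    split; first exact: smooth_dpartial.
    - move=> s' z sz hz; have := fb (rcons s' i) z; rewrite size_rcons => /(_ sz hz).
      by rewrite dpartials_rcons exprS !mulrA.
    - move=> s' z sz hz; have := ftop (rcons s' i) z; rewrite size_rcons sz.
      move=> /(_ erefl hz); rewrite dpartials_rcons exprS !mulrA => /le_trans; apply.
      by rewrite -t4 -[leRHS]expr1 ler_wiXn2l // ltW.
  exists s => //; apply: le_trans hs _.
  by rewrite dpartials_rcons exprS !mulrA.
pose r := t ^+ 2 * rho.
have r0 : 0 < r by rewrite mulr_gt0 // exprn_gt0.
have rrho : r <= rho by rewrite ler_piMl ?(ltW rho0) // exprn_ile1 // ltW.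
have E2v : E2 `<=` ball v rho by move=> x [[[]]].
have [ys [ysE sep ysc]] := max_separated r0 E2v.
have mE2 : (m E2 <= (Cd * (B * t) `^ al * Cp)%:E * tau v rho)%E.
  apply: (@le_trans _ _ (\sum_(y <- ys) (Cd * (B * t) `^ al)%:E * tau y (2 * r)%R)%E).
    apply: (@le_trans _ _ (\sum_(y <- ys) m (E2 `&` ball y r))%E).
      by apply: outer_measure_seq => x E2x; have [y yys hy] := ysc x E2x; exists y.
    rewrite big_seq [leRHS]big_seq; apply: lee_sum => y /ysE E2y.
    have [[[Sy hy] /= fy] gy] := E2y.
    have {}gy : t < w * (2 * rho) * `|g y|.
      by rewrite ltNge; apply/negP => hgy; apply: gy.
    (* The data of the hyperplane where the affine Taylor polynomial of [f] at [y] vanishes. *)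
    pose a := gradient f y; pose b := (y *m a) 0 0 - f y.
    have ai : a i 0 = g y by rewrite mxE.
    have gy0 : 0 < `|g y|.
      by rewrite -(pmulr_rgt0 _ (mulr_gt0 w0 r20)); exact: lt_trans gy.
    have ai0 : a i 0 != 0 by rewrite ai -normr_gt0.
    pose L := [set z : 'rV[R]_n | (z *m a) 0 0 = b].
    apply: le_trans (Hd y (2 * r) (B * t) L Sy _ _ (affine_hyperplane_cV _ ai0)).
    - apply: le_outer_measure => x [[[[_ hx] /= fx] _] hxy]; split; last first.
        by apply: le_ball hxy; lra.
      apply: (neighbourhood_hyperplane ai0).
      have yv : ball y r `<=` ball v (2 * rho).
        move=> z hz; have -> : 2 * rho = rho + rho by ring.
        by apply: ball_triangle hy _; apply: le_ball hz.
      pose K := (w * (2 * rho) ^+ 2)^-1.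
      have wp : 0 < w * (2 * rho) ^+ 2 by rewrite mulr_gt0 // exprn_gt0.
      have K0 : 0 <= K by rewrite invr_ge0 ltW.
      have := taylor2 r0 K0 fs yv.
      have fK i1 i2 z : ball v (2 * rho) z -> `|dpartials [:: i1; i2] f z| <= K.
        move=> hz; have := fb [:: i1; i2] z isT hz; rewrite -ler_pdivlMl // mulr1 /K.
        by [].
      move=> /(_ x fK hxy) T.
      have -> : (x *m a) 0 0 - b = ((x - y) *m a) 0 0 + f y.
        by rewrite mulmxBl mxsubE /b; ring.
      have wT : w * (n%:R ^+ 2 * K * r ^+ 2) <= n%:R ^+ 2 * ep.
        have -> : w * (n%:R ^+ 2 * K * r ^+ 2) = n%:R ^+ 2 * ep / 4.
          by rewrite -t4 /K /r; field; rewrite !gt_eqF.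
        by have : 0 <= n%:R ^+ 2 * ep; [rewrite mulr_ge0 ?exprn_ge0 // ltW|lra].
      have : w * `|((x - y) *m a) 0 0 + f y| <= B * ep.
        have -> : ((x - y) *m a) 0 0 + f y = f x - (f x - f y - ((x - y) *m a) 0 0) by ring.
        have := ler_normB (f x) (f x - f y - ((x - y) *m a) 0 0).
        rewrite -(ler_pM2l w0) => /le_trans; apply; rewrite mulrDr.
        rewrite -(ler_pM2l w0) in T.
        have -> : B * ep = ep + n%:R ^+ 2 * ep by rewrite /B; ring.
        by apply: lerD => //; exact: le_trans T wT.
      rewrite -(ltr_pM2l w0) => /le_lt_trans; apply.
      rewrite ai.
      have -> : w * (B * t * (2 * r) * `|g y|) = B * t ^+ 3 * (w * (2 * rho) * `|g y|).
        by rewrite /r; ring.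
      have Bt : 0 < B * t ^+ 3 by rewrite mulr_gt0 // exprn_gt0.
      have -> : B * ep = B * t ^+ 3 * t by rewrite -t4; ring.
      by rewrite (ltr_pM2l Bt).
    - by rewrite mulr_gt0 //= ; lra.
    - by rewrite mulr_gt0.
  rewrite -ge0_sume_distrr; last by move=> y _; exact: t0.
  rewrite [(_ * Cp)%:E]EFinM -muleA; apply: lee_wpmul2l.
    by rewrite lee_fin mulr_ge0 ?powR_ge0 // ltW.
  apply: Hp => // y /ysE [[[Sy hy] _] _]; by split.
apply: (@le_trans _ _ (m E1 + m E2)%E).
  apply: le_trans (outer_measureU2 _ _ _); apply: le_outer_measure => x Ex.
  by have [|] := pselect (E1 x); [left|right].
apply: (le_trans (leeD mE1 mE2)).
rewrite -ge0_muleDl ?lee_fin ?mulr_ge0 ?powR_ge0 ?(ltW Cg0) ?(ltW Cd0) ?(ltW Cp0) //.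
rewrite -EFinD; apply: mule_fin_ler => //.
rewrite [leRHS]mulrDl; apply: lerD.
  rewrite ler_wpM2l ?(ltW Cg0) //; apply: tgam.
  by rewrite /gam mulrC divfK // ge_min lexx.
rewrite powRM ?(ltW B0) ?(ltW tp) //.
have -> : Cd * (B `^ al * t `^ al) * Cp = Cd * B `^ al * Cp * t `^ al by ring.
rewrite ler_wpM2l ?(ltW BC0) //; apply: tgam.
by rewrite /gam mulrC divfK // ge_min lexx orbT.
Qed.

(* Every sublevel set of a function with a large jet decays, by induction on the
   order of the jet: where the first derivative is not small the function is
   close to affine on balls of radius [sqrt ep * rho], and elsewhere the
   induction hypothesis applies to a first derivative. *)
Theorem decay_smooth n m S tau (j : nat) ka :
  (0 < n)%N -> @gauge R n m S tau -> 0 < ka ->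
  sublevel_decay m S tau j (large_jet ka j).
Proof.
move=> n0 G; elim: j ka => [|j IH] ka ka0; apply: sublevel_decay_split => //.
  (* At order 0 no word is short enough, so [large_pos_jet] never holds. *)
  by exists 1, 1; split => // f v rho w ep _ _ _ _ _ [s [i []]].
have n1j : 0 < (1 + n%:R) ^+ j.+2 :> R by rewrite exprn_gt0 // ltr_pwDl.
have ka'0 : 0 < ka / (2 * (1 + n%:R) ^+ j.+2) by rewrite divr_gt0 // mulr_gt0.
by apply: sublevel_decay_deriv => //; exact: IH.
Qed.

End Decay.

(** * Null sets *)

Section NullSets.
Context {R : realType}.

(** Countably many balls with rational centre and radius [1 / (j + 1)] suffice. The family [N] of
    null sets is abstract because it stands both for the null sets of an outer measure and for sets
    of lifts whose image is Hausdorff null. *)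
Lemma null_of_local n (N : set 'rV[R]_n -> Prop) (X : set 'rV[R]_n) :
  (forall A B, A `<=` B -> N B -> N A) ->
  (forall F : nat -> set 'rV[R]_n, (forall i, N (F i)) -> N (\bigcup_i F i)) ->
  N set0 ->
  (forall x, X x -> exists2 r : R, 0 < r & N (X `&` ball x r)) -> N X.
Proof.
move=> Nsub Nbig N0 H.
pose B (p : 'rV[rat]_n * nat) : set 'rV[R]_n :=
  X `&` ball (map_mx ratr p.1 : 'rV[R]_n) (p.2.+1%:R^-1).
pose F i : set 'rV[R]_n := if unpickle i is Some p then
  (if `[< N (B p) >] then B p else set0) else set0.
apply: (Nsub _ (\bigcup_i F i)); last first.
  by apply: Nbig => i; rewrite /F; case: unpickle => // p; case: asboolP.
move=> x Xx; have [r r0 Nr] := H x Xx.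
have [j jr] : exists j : nat, j.+1%:R^-1 < r / 2.
  exists (Num.truncn (2 / r)); rewrite -[ltRHS]invrK ltf_pV2 ?posrE ?invr_gt0 ?divr_gt0 //.
  by rewrite invf_div truncnS_gt.
have j0 : 0 < j.+1%:R^-1 :> R by rewrite invr_gt0.
have /choice[q qx] i : exists q : rat, `|ratr q - x 0 i| < j.+1%:R^-1.
  move: (j.+1%:R^-1) j0 => e e0.
  have xx : x 0 i - e < x 0 i + e by lra.
  have [q] := rat_in_itvoo xx; rewrite in_itv /= => /andP[q1 q2].
  by exists q; rewrite ltr_norml; apply/andP; split; lra.
pose p := (\row_i q i, j).
have px : ball (map_mx ratr p.1 : 'rV[R]_n) (p.2.+1%:R^-1) x.
  by rewrite ball_rVE; apply: rV_norm_ltP => // i; rewrite !mxE.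
exists (pickle p) => //; rewrite /F pickleK.
suff -> : `[< N (B p) >] by split.
apply/asboolP; apply: Nsub Nr => y [Xy hy]; split => //.
rewrite (_ : r = r / 2 + r / 2); last by field.
by apply: ball_triangle; [apply/ball_sym; apply: le_ball px|apply: le_ball hy];
  exact: ltW.
Qed.

End NullSets.

(** * Outer measures generated by a cost of covers *)

Section CoverMeasure.
Context {R : realType} {T : pointedType}.
Local Open Scope ereal_scope.

(** All sets count as measurable here, so that [mu_ext] takes the infimum over covers by arbitrary
    sets. *)
Definition all_measurable := g_sigma_algebraType [set: set T].

Definition cover_measure (w : set T -> \bar R) : set T -> \bar R :=
  @mu_ext _ all_measurable R w.

Variable w : set T -> \bar R.
Hypotheses (w0 : w set0 = 0) (wge0 : forall A, 0 <= w A).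

Definition cover_outer : {outer_measure set T -> \bar R} :=
  HB.pack (cover_measure w) (isOuterMeasure.Build R T (cover_measure w)
    (@mu_ext0 _ all_measurable R w w0 wge0)
    (@mu_ext_ge0 _ all_measurable R w wge0)
    (@le_mu_ext _ all_measurable R w)
    (@mu_ext_sigma_subadditive _ all_measurable R w wge0)).

Lemma cover_outer_bigcup A E : A `<=` \bigcup_i E i ->
  cover_outer A <= \sum_(0 <= i <oo) w (E i).
Proof.
move=> AE; apply: ereal_inf_lbound; exists E => //; split => // i.
exact: sub_sigma_algebra.
Qed.

Lemma cover_outer_le A : cover_outer A <= w A.
Proof.
pose E k := if k is 0%N then A else set0.
have -> : w A = \sum_(0 <= i <oo) w (E i).
  rewrite nneseries_recl//.
  by rewrite eseries_cond/= eseries0 ?adde0// => -[|]//= k _ _; rewrite w0.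
by apply: cover_outer_bigcup => x Ax; exists 0%N.
Qed.

Lemma cover_outer_lt A c : cover_outer A < c ->
  exists2 E : nat -> set T, A `<=` \bigcup_i E i & \sum_(0 <= i <oo) w (E i) < c.
Proof. by case/ereal_inf_lt => _ [E [_ AE] <-] h; exists E. Qed.

End CoverMeasure.

(** * Decay of contents near hyperplanes *)

Section ContentGauge.
Context {R : realType}.

Lemma ex_maximum (I : finType) (i0 : I) (F : I -> R) :
  exists i, forall j, F j <= F i.
Proof. by case: (@arg_maxP _ _ I i0 xpredT F erefl) => i _ H; exists i => j; exact: H. Qed.

Lemma normr_mulmx_le n (y : 'rV[R]_n) (a : 'cV[R]_n) (s A : R) :
  `|y| <= s -> (forall j, `|a j 0| <= A) -> `|(y *m a) 0 0| <= n%:R * (s * A).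
Proof.
move=> ys aA; rewrite mxE (le_trans (ler_norm_sum _ _ _)) // mulr_natl.
have -> : s * A *+ n = \sum_(j < n) s * A by rewrite sumr_const card_ord.
apply: ler_sum => j _; rewrite normrM ler_pM //.
exact: le_trans (coord_le_norm _ _) ys.
Qed.

(* In the slab around [L], the coordinate in which the normal vector of [L] is
   largest is determined up to [O(eps * rho)] by the other coordinates. *)
Lemma slab_near n (a : 'cV[R]_n.+1) (b s : R) i0 (y y' : 'rV[R]_n.+1) :
  0 < s -> a i0 0 != 0 -> (forall j, `|a j 0| <= `|a i0 0|) ->
  neighbourhood [set z | (z *m a) 0 0 = b] s y ->
  neighbourhood [set z | (z *m a) 0 0 = b] s y' ->
  `|col' i0 y - col' i0 y'| <= s -> ball y' ((3 * n.+1%:R + 1) * s) y.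
Proof.
move=> s0 ai0 aA hy hy' pyy.
have ai0p : 0 < `|a i0 0| by rewrite normr_gt0.
have slab z : neighbourhood [set z | (z *m a) 0 0 = b] s z ->
    `|(z *m a) 0 0 - b| <= n.+1%:R * (s * `|a i0 0|).
  move=> [q /= qb]; rewrite ball_rVE distrC => /ltW zq.
  by rewrite -qb -mxsubE -mulmxBl; exact: normr_mulmx_le.
have cj j : j != i0 -> `|(y - y') 0 j| <= s.
  move=> ji; have [j' -> | j0] := unliftP i0 j; last by rewrite j0 eqxx in ji.
  apply: le_trans pyy; apply: le_trans (coord_le_norm _ j').
  by rewrite !mxE.
have ci : `|(y - y') 0 i0| <= 3 * n.+1%:R * s.
  rewrite -(ler_pM2r ai0p) -normrM.
  have -> : (y - y') 0 i0 * a i0 0 = (y *m a) 0 0 - (y' *m a) 0 0 -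
      \sum_(j < n.+1 | j != i0) (y - y') 0 j * a j 0.
    by rewrite -mxsubE -mulmxBl [X in _ = X - _]mxE (bigD1 i0) //= addrK.
  have := slab _ hy; have := slab _ hy'.
  have : `|\sum_(j < n.+1 | j != i0) (y - y') 0 j * a j 0| <= n.+1%:R * (s * `|a i0 0|).
    rewrite (le_trans (ler_norm_sum _ _ _)) //.
    apply: (@le_trans _ _ (\sum_(j < n.+1 | j != i0) s * `|a i0 0|)).
      by apply: ler_sum => j ji; rewrite normrM ler_pM // cj.
    rewrite mulr_natl -[leRHS](_ : \sum_(j < n.+1) s * `|a i0 0| = _); last first.
      by rewrite sumr_const card_ord.
    by rewrite [leRHS](bigD1 i0) //= lerDr mulr_ge0 // ltW.
  rewrite !ler_norml => /andP[h1 h2] /andP[h3 h4] /andP[h5 h6].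
  by apply/andP; split; lra.
rewrite ball_rVE distrC; apply: rV_norm_ltP => [|j].
  by rewrite mulr_gt0 // ltr_wpDl // mulr_ge0.
have n0 : 0 <= n.+1%:R * s by rewrite mulr_ge0 // ltW.
have [->|ji] := eqVneq j i0; first by lra.
have := cj j ji; rewrite mulrDl mul1r -mulrA => h.
have : s <= n.+1%:R * s by rewrite ler_peMl ?(ltW s0) // ler1n.
lra.
Qed.

Local Open Scope ereal_scope.

Lemma truncnS_le (t : R) : (1 <= t)%R -> ((Num.truncn (2 * t)).+1%:R <= 3 * t)%R.
Proof.
move=> t1; have t0 : (0 <= 2 * t)%R by lra.
by have /andP[h _] := truncn_itv t0; rewrite -addn1 natrD; lra.
Qed.

(** Project the slab along the coordinate of [slab_near] and take an [s]-net of the projection,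
    where [s = eps * rho]. The projection lies in an [n]-dimensional ball of radius [rho], so for
    [eps < 1] the net has [O(eps ^ (- n))] points, and the part of the slab over each of them is in
    a ball of radius [O(s)]. The content is [O(eps ^ (- n) * s ^ (n + 1)) = O(eps * rho ^ (n + 1))]:
    decay with exponent 1. The absolute value in the gauge function makes it nonnegative for every
    [r]. *)
Lemma content_gauge n (w : set 'rV[R]_n.+1 -> \bar R) (w0 : w set0 = 0)
    (wge0 : forall A, 0 <= w A) (C0 : R) :
  (0 < C0)%R ->
  (forall E z (r : R), (0 < r)%R -> E `<=` ball z r -> w E <= (C0 * r ^+ n.+1)%:E) ->
  gauge (cover_outer w0 wge0) setT (fun _ r => (`|r| ^+ n.+1)%:E).
Proof.
move=> C00 wC; set m := cover_outer _ _.
have mC E z (r : R) : (0 < r)%R -> E `<=` ball z r -> m E <= (C0 * r ^+ n.+1)%:E.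
  by move=> r0 Er; apply: le_trans (cover_outer_le _ _ _) _; exact: wC Er.
split.
- by move=> x r; rewrite lee_fin exprn_ge0.
- pose B : R := ((3 * n.+1%:R + 1) ^+ n.+1 * 3 ^+ n)%R.
  have B1 : (1 <= B)%R.
    rewrite mulr_ege1 // exprn_ege1 // ?lerDr ?mulr_ge0 //.
    by rewrite ler1n.
  have B0 : (0 < B)%R by rewrite (lt_le_trans ltr01).
  exists (C0 * B)%R, 1%R; split => //; first by rewrite mulr_gt0.
  move=> x rho eps L _ hrho e0 [a [b [a0 ->]]].
  have [r0 r1] := andP hrho; rewrite powRr1 ?(ltW e0) // -EFinM (ger0_norm (ltW r0)).
  have rn0 : (0 < rho ^+ n.+1)%R by rewrite exprn_gt0.
  have [e1|e1] := leP 1%R eps.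
    apply: le_trans (mC _ x rho r0 (@subIsetr _ _ _)) _; rewrite lee_fin.
    rewrite ler_pM2r // -mulrA ler_peMr ?(ltW C00) //.
    by rewrite mulr_ege1.
  have [i0 imax] := ex_maximum ord0 (fun i => `|a i 0|)%R.
  have ai0 : (a i0 0 != 0)%R.
    apply: contra a0 => /eqP ai; apply/eqP/colP => j; rewrite mxE.
    by apply/eqP; rewrite -normr_le0 -(normr0 R) -ai; exact: imax.
  pose s := (eps * rho)%R; have s0 : (0 < s)%R by rewrite mulr_gt0.
  set X := _ `&` _.
  have Xp : [set col' i0 y | y in X] `<=` ball (col' i0 x) rho.
    move=> _ [y [_ hy] <-]; move: hy; rewrite !ball_rVE => h.
    apply: rV_norm_ltP => // j; apply: le_lt_trans h.
    by apply: le_trans (coord_le_norm _ (lift i0 j)); rewrite !mxE.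
  have [zs [zsX sep zsc]] := max_separated s0 Xp.
  have /choice[f hf] z : exists y, z \in zs -> X y /\ col' i0 y = z.
    by have [/zsX[y Xy <-]|_] := boolP (z \in zs); [exists y|exists 0%R].
  pose c := (C0 * ((3 * n.+1%:R + 1) * s) ^+ n.+1)%R.
  have c0 : (0 <= c)%R.
    by rewrite mulr_ge0 ?(ltW C00) // exprn_ge0 // mulr_ge0 ?(ltW s0) // addr_ge0.
  apply: (@le_trans _ _ (\sum_(z <- zs) c%:E)).
    apply: (@le_trans _ _ (\sum_(z <- zs) m (X `&` (@col' _ 1 n.+1 i0 @^-1` ball z s)))).
      apply: outer_measure_seq => y Xy.
      by have [|z zzs hz] := zsc (col' i0 y); [exists y|exists z].
    rewrite big_seq [leRHS]big_seq; apply: lee_sum => z zzs.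
    have [[fX _] fz] := hf z zzs.
    apply: (mC _ (f z)) => [|y [[hy _]] /=].
      by rewrite mulr_gt0 // ltr_wpDl // mulr_ge0.
    rewrite ball_rVE distrC => /ltW hyz.
    by apply: (slab_near s0 ai0 imax hy fX); rewrite fz.
  rewrite sumEFin big_const_seq count_predT iter_addr addr0 lee_fin -mulr_natr.
  have zsN : ((size zs)%:R <= (3 * eps^-1) ^+ n)%R.
    have zsp z : z \in zs -> ball (col' i0 x) rho z by move=> /zsX/Xp.
    have := separated_size s0 zsp sep; rewrite -(ler_nat R) => /le_trans; apply.
    rewrite natrX lerXn2r ?nnegrE ?mulr_ge0 ?invr_ge0 ?(ltW e0) //.
    have -> : (2 * rho / s = 2 * eps^-1)%R.
      by rewrite /s; field; rewrite !gt_eqF.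
    by apply: truncnS_le; rewrite invf_ge1 ?(ltW e1).
  apply: le_trans (ler_wpM2l c0 zsN) _.
  rewrite /c /B /s le_eqVlt; apply/orP; left; apply/eqP.
  rewrite !exprMn !exprS exprVn.
  by field; rewrite expf_neq0 // gt_eqF.
- exists (6 ^+ n.+1)%R; first by rewrite exprn_gt0.
  move=> x r rho ys _ r0 rrho _ yv sep.
  have rho0 : (0 < rho)%R by exact: lt_le_trans rrho.
  rewrite sumEFin big_const_seq count_predT iter_addr addr0 -EFinM lee_fin -[(_ *+ size ys)%R]mulr_natr.
  have := separated_size r0 (fun y h => (yv y h).2) sep; rewrite -(ler_nat R) natrX => h.
  have r20 : (0 <= 2 * r)%R by rewrite mulr_ge0 // ltW.
  rewrite (ger0_norm r20) (ger0_norm (ltW rho0)).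
  have {}h : ((size ys)%:R <= (3 * (rho / r)) ^+ n.+1)%R.
    apply: le_trans h _; rewrite lerXn2r ?nnegrE ?mulr_ge0 ?invr_ge0 ?(ltW r0) ?(ltW rho0) //.
    by rewrite -mulrA; apply: truncnS_le; rewrite ler_pdivlMr // mul1r.
  apply: le_trans (ler_wpM2l _ h) _; first by rewrite exprn_ge0.
  rewrite -!exprMn.
  have -> : (2 * r * (3 * (rho / r)) = 6 * rho)%R by field; rewrite gt_eqF.
  by [].
- by move=> x _; exists 1%R => // r _; rewrite ltry.
Qed.

End ContentGauge.

Section NullOuter.
Context {R : realType}.
Local Open Scope ereal_scope.

Lemma outer_null_bigcup (T : Type) (m : {outer_measure set T -> \bar R})
    (F : nat -> set T) : (forall i, m (F i) = 0) -> m (\bigcup_i F i) = 0.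
Proof.
move=> F0; apply/eqP; rewrite eq_le outer_measure_ge0 andbT.
apply: (le_trans (outer_measure_sigma_subadditive m F)).
by rewrite eseries0 // => i _ _; exact: F0.
Qed.

Lemma outer_nullS (T : Type) (m : {outer_measure set T -> \bar R}) A B :
  A `<=` B -> m B = 0 -> m A = 0.
Proof.
move=> AB B0; apply/eqP; rewrite eq_le outer_measure_ge0 andbT -B0.
exact: le_outer_measure.
Qed.

Lemma outer_nullU (T : Type) (m : {outer_measure set T -> \bar R}) A B :
  m A = 0 -> m B = 0 -> m (A `|` B) = 0.
Proof.
move=> A0 B0; apply/eqP; rewrite eq_le outer_measure_ge0 andbT.
by apply: le_trans (outer_measureU2 _ _ _) _; rewrite A0 B0 adde0.
Qed.

Lemma outer_null_of_local k (m : {outer_measure set 'rV[R]_k -> \bar R}) X :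
  (forall x, X x -> exists2 r : R, (0 < r)%R & m (X `&` ball x r) = 0) -> m X = 0.
Proof.
move=> H; apply: (@null_of_local R k (fun A => m A = 0)) => //.
- by move=> A B; exact: outer_nullS.
- by move=> F; exact: outer_null_bigcup.
Qed.

End NullOuter.

(** * Absolutely friendly measures as gauges *)

Section MeasureGauge.
Context {R : realType} {k : nat}.
Local Open Scope ereal_scope.
Variables (U : set 'rV[R]_k) (mu : {measure set (borelRn R k) -> \bar R}).

Definition outer_of : {outer_measure set 'rV[R]_k -> \bar R} :=
  [the {outer_measure set (borelRn R k) -> \bar R} of (mu^*)%mu].

Lemma open_borelRn (A : set 'rV[R]_k) : open A -> measurable (A : set (borelRn R k)).
Proof. by move=> oA; exact: sub_sigma_algebra. Qed.

Lemma outer_ofE (A : set 'rV[R]_k) :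
  measurable (A : set (borelRn R k)) -> outer_of A = mu A.
Proof. exact: measurable_mu_extE. Qed.

Lemma ball_borelRn (x : 'rV[R]_k) (r : R) :
  measurable (ball x r : set (borelRn R k)).
Proof. by apply: open_borelRn; exact: ball_open. Qed.

Hypotheses (oU : open U) (muU : measure_on U mu).

(** Every point of [U] off the support has a null ball, and countably many of these suffice. *)
Lemma outer_msuppC : outer_of (~` msupp U mu) = 0.
Proof.
have [U0 _] := muU.
pose X := U `\` msupp U mu.
have X0 : outer_of X = 0.
  apply: outer_null_of_local => x [Ux nS].
  have [r r0 hr] : exists2 r : R, (0 < r)%R & mu (ball x r) = 0.
    apply: contrapT => H; apply: nS; split => // r r0.
    rewrite lt_def measure_ge0 andbT; apply/negP => /eqP h0.
    by apply: H; exists r.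
  exists r => //; apply: (outer_nullS (B := ball x r)); first exact: subIsetr.
  by rewrite outer_ofE //; exact: ball_borelRn.
have UC0 : outer_of (~` U) = 0.
  by rewrite outer_ofE //; apply: measurableC; exact: open_borelRn.
apply: outer_nullS (outer_nullU X0 UC0) => x nx.
by have [|] := pselect (U x); [left|right].
Qed.

Lemma measure_separated (r : R) ys : separated_seq (2 * r)%R ys ->
  \sum_(y <- ys) mu (ball y r) = mu (\big[setU/set0]_(y <- ys) (ball y r : set (borelRn R k))).
Proof.
elim: ys => [|y ys IH]; first by rewrite !big_nil measure0.
move=> /andP[/allP hy sep]; rewrite !big_cons IH // measureU //.
- exact: ball_borelRn.
- by apply: bigsetU_measurable => z _; exact: ball_borelRn.
- apply/seteqP; split => // z [hz]; rewrite -bigcup_seq => -[u /= uys hu].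
  have := hy u uys; rewrite leNgt => /negP; apply.
  have : ball y (r + r)%R u by apply: ball_triangle hz _; exact/ball_sym.
  by rewrite ball_rVE mulr_natl mulr2n.
Qed.

(** For the packing bound, doubling twice replaces the balls of radius [2 * r] by balls of radius
    [r / 2], which are disjoint for [r]-separated centres and lie in [ball x (2 * rho)]; a third
    doubling returns to [ball x rho]. *)
Lemma measure_gauge : absolutely_friendly U mu ->
  gauge outer_of (msupp U mu) (fun x r => mu (ball x r)).
Proof.
move=> [[C [al [C0 al0 decay]]] [C' dbl']].
(* The doubling constant is only known to be a real number; the maximum makes it positive. *)
pose D := Num.max C' 1%R.
have D1 : (1 <= D)%R by rewrite le_max lexx orbT.
have D0 : (0 < D)%R by rewrite (lt_le_trans ltr01).
have dbl (x : 'rV[R]_k) (rho : R) : msupp U mu x -> (0 < rho <= 1)%R ->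
    mu (ball x (2 * rho)) <= D%:E * mu (ball x rho).
  move=> Sx hr; apply: le_trans (dbl' x rho Sx hr) _.
  by apply: mule_fin_ler; rewrite ?measure_ge0 // le_max lexx.
split.
- by move=> x r; exact: measure_ge0.
- exists C, al; split => // x rho eps L Sx hrho e0 hL.
  rewrite outer_ofE; first exact: decay.
  apply: measurableI; last exact: ball_borelRn.
  by apply: open_borelRn; apply: bigcup_open => y _; exact: ball_open.
- exists (D * D * D)%R; first by rewrite !mulr_gt0.
  move=> x r rho ys Sx r0 rrho rho1 yv sep.
  pose h := (r / 2)%R.
  have rE : (r = 2 * h)%R by rewrite /h mulrC divfK.
  have h0 : (0 < h)%R by rewrite divr_gt0.
  rewrite 2!EFinM -!muleA.
  apply: (@le_trans _ _ (\sum_(y <- ys) D%:E * (D%:E * mu (ball y h)))).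
    rewrite big_seq [leRHS]big_seq; apply: lee_sum => y /yv [Sy _].
    apply: le_trans (dbl y r Sy _) _; first by apply/andP; split => //; lra.
    apply: lee_wpmul2l; first by rewrite lee_fin ltW.
    by rewrite rE; apply: dbl => //; apply/andP; split => //; lra.
  rewrite -ge0_sume_distrr; last first.
    by move=> y _; rewrite mule_ge0 ?measure_ge0 // lee_fin ltW.
  rewrite -ge0_sume_distrr; last by move=> y _; exact: measure_ge0.
  apply: lee_wpmul2l; first by rewrite lee_fin ltW.
  apply: lee_wpmul2l; first by rewrite lee_fin ltW.
  rewrite measure_separated; last by rewrite -rE.
  apply: le_trans (dbl x rho Sx _); last by apply/andP; split; lra.
  apply: le_measure; rewrite ?inE.
  - by apply: bigsetU_measurable => z _; exact: ball_borelRn.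
  - exact: ball_borelRn.
  - rewrite -bigcup_seq => z [y /= yys hz]; have [_ hy] := yv y yys.
    rewrite mulr_natl mulr2n; apply: ball_triangle hy _.
    by apply: le_ball hz; lra.
- move=> x [Ux _]; have [_ /(_ x Ux)[r0 r00 hr]] := muU.
  exists r0 => // r /andP[_ rr0]; apply: le_lt_trans hr.
  apply: le_measure; rewrite ?inE; [exact: ball_borelRn|exact: ball_borelRn|].
  exact: le_ball.
Qed.

End MeasureGauge.

(** * The simplex lemma *)

Section LinearAlgebra.
Context {R : realType}.

Lemma mulmx_entry_le m n p (A : 'M[R]_(m, n)) (B : 'M[R]_(n, p)) (a b : R) :
  (forall i j, `|A i j| <= a) -> (forall i j, `|B i j| <= b) ->
  forall i j, `|(A *m B) i j| <= n%:R * (a * b).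
Proof.
move=> Aa Bb i j; rewrite mxE (le_trans (ler_norm_sum _ _ _)) // mulr_natl.
have -> : a * b *+ n = \sum_(l < n) a * b by rewrite sumr_const card_ord.
by apply: ler_sum => l _; rewrite normrM ler_pM.
Qed.

(* Column elimination; choosing a largest pivot keeps all multipliers in
   [-1, 1], whence the uniform bound on the entries of [T]. *)
Lemma bounded_elimination n : exists2 C : R, 0 <= C &
  forall A : 'M[R]_n, exists T : 'M[R]_n,
  [/\ forall i j, `|T i j| <= C, (\det T) ^+ 2 = 1 &
      forall i j : 'I_n, (i < j)%N -> (A *m T) i j = 0].
Proof.
elim: n => [|n [C C0 IH]].
  exists 0 => // A; exists 1%:M; split; [by case|by rewrite det1 expr1n|by case].
pose D := 1 + C.
exists (n.+1%:R * (1 * (n.+1%:R * (1 * D)))).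
  by rewrite !mulr_ge0 // addr_ge0.
move=> A; pose A' := A : 'M[R]_(1 + n).
have [j0 jmax] := ex_maximum (0 : 'I_(1 + n)) (fun j => `|A' 0 j|).
pose P : 'M[R]_(1 + n) := tperm_mx 0 j0.
pose A1 := A' *m P.
have A1E i j : A1 i j = A' i (tperm 0 j0 j).
  by rewrite /A1 /P /tperm_mx -{1}(tpermV 0 j0) -col_permE mxE.
have A1def : A1 = A' *m P by [].
clearbody A1.
have A1max j : `|A1 0 j| <= `|A1 0 0|.
  by rewrite !A1E tpermL; exact: jmax.
(* If the pivot is 0, the whole row vanishes by its maximality, and the multipliers are 0 since
   [0^-1 = 0]. *)
pose u : 'rV[R]_n := \row_j (A1 0 (rshift 1 j) / A1 0 0).
have u1 j : `|u 0 j| <= 1.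
  rewrite mxE normrM normfV; have [->|a0] := eqVneq (A1 0 0) 0.
    by rewrite normr0 invr0 mulr0.
  by rewrite ler_pdivrMr ?normr_gt0 // mul1r.
pose E : 'M[R]_(1 + n) := block_mx 1%:M (- u) 0 1%:M.
have [T' [T'C T'1 T'0]] := IH (drsubmx (A1 *m E)).
pose F : 'M[R]_(1 + n) := block_mx 1%:M 0 0 T'.
have l0 : lshift n (0 : 'I_1) = 0 by exact: val_inj.
have ur0 : ursubmx (A1 *m E) = 0.
  rewrite -{1}[A1]submxK /E mulmx_block block_mxKur mulmxN mulmx1.
  apply/eqP; rewrite addrC subr_eq0; apply/eqP/rowP => j.
  rewrite !mxE big_ord1 !mxE !ord1 l0; have [a0|a0] := eqVneq (A1 0 0) 0.
    rewrite a0 mul0r; apply/eqP; rewrite -normr_le0 -(normr0 R) -a0.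
    exact: A1max.
  by rewrite mulrC divfK.
have Pb (i j : 'I_(1 + n)) : `|P i j| <= 1.
  rewrite /P /tperm_mx /perm_mx !mxE.
  by case: (_ == _); rewrite ?normr1 ?normr0.
have Eb (i j : 'I_(1 + n)) : `|E i j| <= 1.
  rewrite /E; have [i' ->|i' ->] := split_ordP i; have [j' ->|j' ->] := split_ordP j.
  + by rewrite block_mxEul mxE; case: (_ == _); rewrite ?normr1 ?normr0.
  + by rewrite block_mxEur mxE normrN ord1.
  + by rewrite block_mxEdl mxE normr0.
  + by rewrite block_mxEdr mxE; case: (_ == _); rewrite ?normr1 ?normr0.
have Fb (i j : 'I_(1 + n)) : `|F i j| <= D.
  have D1 : 1 <= D by rewrite lerDl.
  have D0 : 0 <= D by rewrite addr_ge0.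
  rewrite /F; have [i' ->|i' ->] := split_ordP i; have [j' ->|j' ->] := split_ordP j.
  + by rewrite block_mxEul mxE; case: (_ == _); rewrite ?normr1 ?normr0.
  + by rewrite block_mxEur mxE normr0.
  + by rewrite block_mxEdl mxE normr0.
  + by rewrite block_mxEdr (le_trans (T'C _ _)) // lerDr.
have dE : \det E = 1 by rewrite /E det_ublock !det1 mulr1.
have dF : \det F = \det T' by rewrite /F det_ublock det1 mul1r.
exists (P *m (E *m F)); split.
- apply: mulmx_entry_le Pb _; exact: mulmx_entry_le Eb Fb.
- rewrite !det_mulmx !exprMn det_perm -exprM mulnC exprM sqrrN expr1n expr1n mul1r.
  by rewrite dE dF expr1n mul1r T'1.
- move=> i j ij; have -> : (A *m (P *m (E *m F))) i j = (A1 *m E *m F) i j.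
    by rewrite A1def !mulmxA.
  rewrite -[A1 *m E]submxK /F mulmx_block !mulmx0 !mulmx1 !add0r !addr0.
  rewrite ur0 mul0mx.
  move: ij; have [i' ->|i' ->] := @split_ordP 1 n i; have [j' ->|j' ->] := @split_ordP 1 n j => /=.
  + by rewrite !ord1 ltnn.
  + by rewrite block_mxEur mxE.
  + by rewrite ord1.
  + by rewrite block_mxEdr !add1n ltnS; exact: T'0.
Qed.

Lemma det_le n (X : 'M[R]_n) (b : 'I_n -> R) :
  (forall i j, `|X i j| <= b j) -> `|\det X| <= n`!%:R * \prod_j b j.
Proof.
move=> Xb; apply: (le_trans (ler_norm_sum _ _ _)).
rewrite mulr_natl -card_Sn -sumr_const; apply: ler_sum => s _.
rewrite normrM normrX normrN1 expr1n mul1r normr_prod.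
rewrite [leRHS](reindex_inj (perm_inj (s := s))) /=.
by apply: ler_prod => i _; rewrite normr_ge0 Xb.
Qed.

(** Take rows in [X] of maximal rank. Every vector of [X] is in their span, and full rank would give
    [n] of them with nonzero determinant; so a nonzero linear form vanishes on the span. *)
Lemma hyperplane_of_singular n (X : set 'rV[R]_n) : (0 < n)%N ->
  (forall p : 'I_n -> 'rV[R]_n, (forall i, X (p i)) -> \det (\matrix_i p i) = 0) ->
  exists2 P : 'cV[R]_n, P != 0 & forall x, X x -> (x *m P) 0 0 = 0.
Proof.
move=> n0 Xdet.
pose Q r := `[< exists m (B : 'M[R]_(m, n)), (forall i, X (row i B)) /\ \rank B = r >].
have Q0 : exists r, Q r.
  by exists 0%N; apply/asboolP; exists 0%N, 0; split; [case|rewrite mxrank0].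
have Qn r : Q r -> (r <= n)%N by move=> /asboolP[m [B [_ <-]]]; exact: rank_leq_col.
case: (ex_maxnP Q0 Qn) => r /asboolP[m [B [XB rB]]] rmax.
have Xsub x : X x -> (x <= B)%MS.
  move=> Xx; have /rmax : Q (\rank (col_mx B x)).
    apply/asboolP; exists (m + 1)%N, (col_mx B x); split => // i.
    have [i' ->|i' ->] := split_ordP i.
      suff -> : row (lshift 1 i') (col_mx B x) = row i' B by [].
      by apply/rowP => j; rewrite [LHS]mxE col_mxEu mxE.
    suff -> : row (rshift m i') (col_mx B x) = x by [].
    by apply/rowP => j; rewrite mxE col_mxEd ord1.
  rewrite -rB -addsmxE => rle.
  have := mxrank_leqif_sup (addsmxSl B x) => -[h1 h2].
  have : (B + x <= B)%MS by rewrite -h2 eqn_leq h1.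
  by rewrite addsmx_sub => /andP[].
have nfull : ~~ row_full B.
  apply/negP => fB; have := fullrowsub_unit fB; rewrite unitmxE unitfE => /eqP; apply.
  rewrite -[RHS](Xdet (fun i => row (fullrankfun fB i) B)) //; congr (\det _).
  by apply/matrixP => i j; rewrite !mxE.
have : kermx B^T != 0.
  by rewrite kermx_eq0 /row_free mxrank_tr; move: nfull; rewrite /row_full.
rewrite -nz_row_eq0 => K0; exists (nz_row (kermx B^T))^T.
  by rewrite -(inj_eq (can_inj (@trmxK _ _ _))) trmxK trmx0.
move=> x /Xsub /submxP[D ->].
suff BP : B *m (nz_row (kermx B^T))^T = 0 by rewrite -mulmxA BP mulmx0 mxE.
apply: (can_inj (@trmxK _ _ _)); rewrite trmx_mul trmxK trmx0.
by apply/sub_kermxP; exact: nz_row_sub.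
Qed.

End LinearAlgebra.

(** * Counting sorted words; the exponent [N_kd] *)

Section SortedWords.
Variable n : nat.

Definition sorted_words_of_size j : seq (seq 'I_n.+1) :=
  [seq val t | t <- enum [set t : j.-tuple 'I_n.+1 |
     sorted leq [seq val i | i <- t]]%SET].

(** Listing by increasing length puts a word of length at most [j] at a position below the number of
    such words; this position is its row in the matrix of the jet. *)
Fixpoint sorted_words j : seq (seq 'I_n.+1) :=
  if j is j'.+1 then sorted_words j' ++ sorted_words_of_size j else sorted_words_of_size 0.

Lemma size_sorted_words j :
  size (sorted_words j) = (\sum_(i < j.+1) 'C(n + i, i))%N.
Proof.
have sz i : size (sorted_words_of_size i) = 'C(n + i, i).
  by rewrite size_map -cardE card_sorted_tuples addnC.
elim: j => [|j IH]; first by rewrite big_ord1 [LHS]sz.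
by rewrite big_ord_recr [LHS]size_cat IH sz.
Qed.

Lemma mem_sorted_words s j :
  sorted_word s -> (size s <= j)%N -> s \in sorted_words j.
Proof.
move=> ss; have sS : s \in sorted_words_of_size (size s).
  apply/mapP; exists (in_tuple s) => //.
  by rewrite mem_enum inE sorted_map.
elim: j => [|j IH] sj /=.
  by move: sS; move: sj; rewrite leqn0 => /eqP ->.
rewrite mem_cat; move: sj; rewrite leq_eqVlt => /orP[/eqP sj|/IH -> //].
by rewrite -sj sS orbT.
Qed.

Lemma sorted_words_prefix j J : (j <= J)%N ->
  exists r, sorted_words J = sorted_words j ++ r.
Proof.
elim: J => [|J IH]; first by rewrite leqn0 => /eqP ->; exists [::]; rewrite cats0.
rewrite leq_eqVlt => /orP[/eqP ->|/IH[r rE]]; first by exists [::]; rewrite cats0.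
by exists (r ++ sorted_words_of_size J.+1); rewrite /= rE catA.
Qed.

Lemma index_sorted_words s j J : sorted_word s -> (size s <= j)%N -> (j <= J)%N ->
  (index s (sorted_words J) < size (sorted_words j))%N.
Proof.
move=> ss sj /sorted_words_prefix[r ->].
by rewrite index_cat mem_sorted_words // index_mem mem_sorted_words.
Qed.

(** The additional 1 is the empty word, and the leading summand of [dimsum] counts the words of
    length 1. *)
Lemma size_sorted_words_dimsum j : (0 < j)%N ->
  size (sorted_words j) = (dimsum n.+1 j).+1.
Proof.
rewrite size_sorted_words /dimsum /=.
case: j => // j _; rewrite -(big_mkord xpredT (fun i => 'C(n + i, i))).
by rewrite big_nat_recl // big_nat_recl // bin0 bin1 addn1 2!big_add1 /= addnA add1n.
Qed.

(* The order of vanishing, at the scale of a ball, that elimination gives to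
   the [l]-th column. *)
Definition vanishing_order q l := (\sum_(j < q.+1) (size (sorted_words j) <= l))%N.

(** The sizes increase with [j], so the indices counted by [vanishing_order] form an initial
    segment. *)
Lemma vanishing_orderP q l s : (s < vanishing_order q l)%N ->
  (s <= q)%N /\ (size (sorted_words s) <= l)%N.
Proof.
have mono i j : (i <= j)%N -> (size (sorted_words i) <= size (sorted_words j))%N.
  by move=> /sorted_words_prefix[r ->]; rewrite size_cat leq_addr.
move=> so; have sq : (s <= q)%N.
  rewrite -ltnS; apply: leq_trans so _.
  rewrite /vanishing_order -[leqRHS]card_ord -sum1_card; apply: leq_sum => j _.
  exact: leq_b1.
split => //; rewrite leqNgt; apply: contraTN so => ls; rewrite -leqNgt.
apply: (@leq_trans (\sum_(j < q.+1) (j < s)%N)).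
  apply: leq_sum => j _; have [js|js] := leqP s j; last exact: leq_b1.
  by rewrite [(size _ <= l)%N]leqNgt (leq_trans ls (mono _ _ js)).
have -> : (\sum_(j < q.+1) (j < s))%N = minn q.+1 s.
  elim: (q.+1) => [|Q IH]; first by rewrite big_ord0 min0n.
  by rewrite big_ord_recr /= IH; case: ltnP => h; lia.
exact: geq_minr.
Qed.

Lemma sum_vanishing_order q d :
  (size (sorted_words q) <= d.+1)%N ->
  (\sum_(l < d.+1) vanishing_order q l = \sum_(j < q.+1) (d.+1 - size (sorted_words j)))%N.
Proof.
move=> hq; rewrite /vanishing_order exchange_big /=; apply: eq_bigr => j _.
move: (size _) => a; elim: d.+1 => [|D IH]; first by rewrite big_ord0 sub0n.
by rewrite big_ord_recr /= IH; have [h|h] := leqP a D => /=; lia.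
Qed.

(** Summation by parts: for [j <= q] there are as many columns of order [j] as words of length [j],
    and the [d - dimsum n.+1 q] columns left over have order [q + 1]. With [q = n_kd n.+1 d] this is
    the formula for [N_kd]. *)
Lemma sum_sorted_words_gap q d : (0 < q)%N -> (size (sorted_words q) <= d.+1)%N ->
  (\sum_(j < q.+1) (d.+1 - size (sorted_words j)) =
   n.+1 + \sum_(2 <= j < q.+1) j * 'C(n + j, j) + q.+1 * (d - dimsum n.+1 q))%N.
Proof.
elim: q => // -[|q] IH _ hq.
  rewrite 2!big_ord_recr big_ord0 size_sorted_words_dimsum // in hq *.
  rewrite size_sorted_words big_ord1 bin0 big_geq // /dimsum big_geq //.
  by move: hq; rewrite /dimsum big_geq //=; lia.
have dS : dimsum n.+1 q.+2 = (dimsum n.+1 q.+1 + 'C(n + q.+2, q.+2))%N.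
  by rewrite /dimsum big_nat_recr //= addnA.
rewrite big_ord_recr /= -[sorted_words q.+1 ++ _]/(sorted_words q.+2) in hq *.
move: hq; rewrite size_sorted_words_dimsum // dS => hq.
rewrite IH // ?size_sorted_words_dimsum //; last by lia.
rewrite [in RHS]big_nat_recr //= subSS; nia.
Qed.

Lemma N_kdE d : (n.+1 <= d)%N ->
  exists q, (\sum_(l < d.+1) vanishing_order q l = N_kd n.+1 d)%N.
Proof.
move=> nd; exists (n_kd n.+1 d).
have [q0 qd] : (0 < n_kd n.+1 d)%N /\ (dimsum n.+1 (n_kd n.+1 d) <= d)%N.
  rewrite /n_kd.
  have [|i /andP[i0 id] ->] := @eq_bigmax_cond 'I_d.+1
    [pred i : 'I_d.+1 | (0 < i)%N && (dimsum n.+1 i <= d)%N] val.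
    apply/card_gt0P; have d1 : (1 < d.+1)%N by lia.
    by exists (Ordinal d1); rewrite inE /= /dimsum big_geq // addn0.
  by [].
have sz : (size (sorted_words (n_kd n.+1 d)) <= d.+1)%N.
  by rewrite size_sorted_words_dimsum.
by rewrite sum_vanishing_order // sum_sorted_words_gap.
Qed.

End SortedWords.

Section DeterminantBound.
Context {R : realType}.

(* A bounded column operation makes the [l]-th column a function that vanishes at the
   centre together with its derivatives of order less than [vanishing_order q l],
   and [N_kd] is the sum of these orders. *)
Theorem det_param_le n d : (n.+1 <= d)%N -> exists L, forall K : R, 0 <= K ->
  exists2 C : R, 0 <= C & forall (Phi : 'rV[R]_n.+1 -> 'rV[R]_d.+1) v (rho : R),
  0 < rho <= 1 -> smooth_on (ball v rho) Phi ->
  (forall s z, (size s <= L)%N -> ball v rho z -> `|dpartials s Phi z| <= K) ->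
  forall u : 'I_d.+1 -> 'rV[R]_n.+1, (forall i, ball v rho (u i)) ->
  `|\det (\matrix_i Phi (u i))| <= C * rho ^+ N_kd n.+1 d.
Proof.
move=> nd; have [q qN] := N_kdE nd.
exists q.+1 => K K0; have [CT CT0 elim] := @bounded_elimination R d.+1.
pose K1 := d.+1%:R * (K * CT) * q.+2%:R ^+ n.+1.
have K10 : 0 <= K1 by rewrite !mulr_ge0 // exprn_ge0.
exists (d.+1`!%:R * K1 ^+ d.+1); first by rewrite mulr_ge0 // exprn_ge0.
move=> Phi v rho /andP[r0 r1] Ps PK u uv.
(* Row [i] is the derivative of [Phi] at the centre along the [i]-th word. Past the end of the list
   [nth] returns the empty word; the argument below refers to positions of listed words. *)
pose A : 'M[R]_d.+1 :=
  \matrix_(i, j) dpartials (nth [::] (sorted_words n q) i) Phi v 0 j.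
have [T [TC T1 T0]] := elim A.
pose X : 'M[R]_d.+1 := \matrix_i Phi (u i).
have -> : `|\det X| = `|\det (X *m T)|.
  have /eqP : `|\det T| ^+ 2 = 1 by rewrite -normrX T1 normr1.
  rewrite sqrp_eq1 // => /eqP T1'.
  by rewrite det_mulmx normrM T1' mulr1.
have oB : open (ball v rho) by exact: ball_open.
have XT (i l : 'I_d.+1) : `|(X *m T) i l| <= K1 * rho ^+ vanishing_order n q l.
  set o := vanishing_order n q l.
  have oq : (o <= q.+1)%N.
    rewrite /o /vanishing_order -[leqRHS]card_ord -sum1_card; apply: leq_sum => j _.
    exact: leq_b1.
  have -> : (X *m T) i l = pairing Phi (col l T) (u i).
    rewrite /pairing !mxE; apply: eq_bigr => j _; by rewrite !mxE.
  have Kb : 0 <= d.+1%:R * (K * CT) by rewrite !mulr_ge0.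
  have := @sorted_vanishing R _ (pairing Phi (col l T)) v rho _ o r0 Kb
    (smooth_pairing _ oB Ps).
  move=> /(_ _ _ (u i) (uv i)) H.
  apply: (@le_trans _ _ (d.+1%:R * (K * CT) * o.+1%:R ^+ n.+1 * rho ^+ o)); last first.
    rewrite ler_wpM2r ?exprn_ge0 ?(ltW r0) // /K1 ler_wpM2l //.
    by rewrite lerXn2r ?nnegrE // ler_nat ltnS.
  apply: H => [s ss so|s z so hz]; rewrite (dpartials_pairing _ _ oB Ps) //; last first.
  - apply: mulmx_entry_le => [i' j|j j']; last by rewrite mxE.
    by rewrite ord1 (le_trans (coord_le_norm _ _)) // PK // so.
  - exact: ballxx.
  have [sq sl] := vanishing_orderP so.
  have il := leq_trans (index_sorted_words ss (leqnn _) sq) sl.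
  have id := ltn_trans il (ltn_ord l).
  rewrite -[RHS](T0 (Ordinal id) l) // /pairing !mxE; apply: eq_bigr => j _.
  by rewrite !mxE nth_index // mem_sorted_words.
apply: (le_trans (det_le XT)).
rewrite -mulrA ler_wpM2l // big_split /= prodr_const card_ord.
by rewrite -expr_sum qN.
Qed.

End DeterminantBound.

(** * Representatives and heights of rational points *)

Section ProjectiveSpace.
Context {R : realType} {d : nat}.
Implicit Types (x y : 'rV[R]_d.+1) (P : proj_space R d).

Lemma val_proj_pt x : x != 0 -> val (proj_pt x) = <[x]>%VS.
Proof. by move=> x0; rewrite /proj_pt insubdK // unfold_in dim_vline x0. Qed.

Definition rep P : 'rV[R]_d.+1 := vpick (val P).

Lemma rep_neq0 P : rep P != 0.
Proof.
rewrite /rep vpick0 -dimv_eq0; have /eqP -> := valP P.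
by rewrite oner_eq0.
Qed.

Lemma proj_ptK P : proj_pt (rep P) = P.
Proof.
apply/val_inj; rewrite val_proj_pt ?rep_neq0 //; apply/eqP.
rewrite eqEdim dim_vline rep_neq0 (eqP (valP P)) leqnn andbT.
exact: memv_pick.
Qed.

Lemma proj_pt_eqP x y : x != 0 -> y != 0 ->
  proj_pt x = proj_pt y <-> exists2 t : R, t != 0 & x = t *: y.
Proof.
move=> x0 y0; split=> [/(congr1 val)|[t t0 xy]].
  rewrite !val_proj_pt // => E; have /vlineP[t xy] : x \in <[y]>%VS.
    by rewrite -E memv_line.
  by exists t => //; apply: contraNneq x0 => t0; rewrite xy t0 scale0r.
apply/val_inj; rewrite !val_proj_pt //; apply/eqP.
rewrite eqEdim !dim_vline x0 y0 leqnn andbT; apply/vlineP; by exists t.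
Qed.

Lemma rational_int P : rational_point P -> exists p, primitive_rep P p.
Proof.
move=> [q [q0 qP]].
pose z : 'rV[int]_d.+1 := \row_i (numq (q 0 i) * \prod_(j < d.+1 | j != i) denq (q 0 j)).
pose D : int := \prod_(j < d.+1) denq (q 0 j).
have zE i : (z 0 i)%:~R = D%:~R * q 0 i :> rat.
  have -> : D = denq (q 0 i) * \prod_(j < d.+1 | j != i) denq (q 0 j) by rewrite /D (bigD1 i).
  by rewrite mxE !rmorphM /= numqE; ring.
have D0 : D != 0 by apply/prodf_neq0 => j _; exact: denq_neq0.
pose g := \big[gcdn/0%N]_(i < d.+1) `|z 0%R i|%N.
have gz i : (g %| `|z 0%R i|)%N by apply: (biggcdn_inf i).
pose p : 'rV[int]_d.+1 := \row_i divz (z 0 i) g%:Z.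
have pz i : z 0 i = p 0 i * g%:Z by rewrite [p 0 i]mxE divzK // dvdzE; exact: gz.
have z0 : exists i, z 0 i != 0.
  have [i qi] : exists i, q 0 i != 0.
    apply/existsP; rewrite -negb_forall; apply: contra q0 => /forallP h.
    by apply/eqP/rowP => i; rewrite mxE; exact/eqP/h.
  by exists i; rewrite -(intr_eq0 rat) zE mulf_neq0 // intr_eq0.
have g0 : (0 < g)%N.
  have [i zi] := z0; rewrite lt0n; apply: contraNneq zi => g0.
  by have := gz i; rewrite g0 dvd0n absz_eq0.
exists p; split.
  apply/eqP; rewrite -(eqn_pmul2l g0) muln1 {2}/g.
  rewrite (big_morph (muln g) (muln_gcdr g) (muln0 g)); apply/eqP.
  by apply: eq_bigr => i _; rewrite pz abszM mulnC.
have pE : map_mx intr p = (D%:~R / g%:R) *: map_mx ratr q :> 'rV[R]_d.+1.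
  apply/rowP => i; rewrite mxE [RHS]mxE [X in _ * X]mxE.
  have gn : g%:R != 0 :> R by rewrite pnatr_eq0 -lt0n.
  have : (z 0 i)%:~R = D%:~R * ratr (q 0 i) :> R.
    by have := congr1 (@ratr R) (zE i); rewrite rmorphM /= !ratr_int.
  rewrite pz rmorphM /= => key; apply: (mulIf gn); rewrite [g%:R]pmulrn key.
  by rewrite -pmulrn; field.
have q0' : map_mx ratr q != 0 :> 'rV[R]_d.+1.
  apply: contra q0 => /eqP h; apply/eqP/rowP => i; move/rowP: h => /(_ i).
  by rewrite !mxE => /eqP; rewrite fmorph_eq0 => /eqP.
have t0 : D%:~R / g%:R != 0 :> R.
  by rewrite mulf_neq0 ?invr_eq0 ?intr_eq0 // pnatr_eq0 -lt0n.
rewrite pE -qP; apply/proj_pt_eqP => //; first by rewrite scaler_eq0 negb_or t0.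
by exists (D%:~R / g%:R).
Qed.

Lemma HstdP P : rational_point P -> exists p : 'rV[int]_d.+1,
  [/\ p != 0, proj_pt (map_mx intr p) = P & Hstd P = `|map_mx intr p : 'rV[R]_d.+1| ].
Proof.
move=> /rational_int[p0 hp0]; have [hg hP] := xgetPex 0 (ex_intro _ p0 hp0).
exists (xget 0 [set p | primitive_rep P p]); split => //.
apply: contra_eq_neq hg => ->.
by rewrite big1 // => i _; rewrite mxE absz0.
Qed.

Lemma map_intr_neq0 n (p : 'rV[int]_n) : p != 0 -> map_mx intr p != 0 :> 'rV[R]_n.
Proof.
apply: contra => /eqP/rowP h; apply/eqP/rowP => i; have := h i.
by rewrite !mxE => /eqP; rewrite intr_eq0 => /eqP.
Qed.

Lemma Hstd_ge1 P : rational_point P -> 1 <= Hstd P.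
Proof.
move=> /HstdP[p [p0 _ ->]].
have [i pi] : exists i, p 0 i != 0.
  apply/existsP; rewrite -negb_forall; apply: contra p0 => /forallP h.
  by apply/eqP/rowP => i; rewrite mxE; exact/eqP/h.
apply: le_trans (coord_le_norm _ i); rewrite mxE -intr_norm.
by rewrite -[1]/(1%:~R) ler_int -gtz0_ge1 normr_gt0.
Qed.

(** An integer representative that realizes the height has entries in [[-N, N]]; adding [N] encodes
    them as ordinals. *)
Lemma finite_height (X : R) : 
  finite_set [set P : proj_space R d | rational_point P /\ Hstd P <= X].
Proof.
pose N := Num.truncn X.
pose F (f : {ffun 'I_d.+1 -> 'I_(N + N).+1}) : proj_space R d :=
  proj_pt (map_mx intr (\row_i ((f i : nat)%:Z - N%:Z) : 'rV[int]_d.+1)).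
apply: (@sub_finite_set _ _ [set F f | f in setT]); last first.
  by apply: finite_image; exact: finite_finset.
move=> P [rP HX]; have [p [p0 pP pH]] := HstdP rP.
have pN i : (`|p 0 i| <= N%:Z)%R.
  have : `|p 0 i|%:~R <= X.
    by apply: le_trans HX; rewrite pH intr_norm; apply: le_trans (coord_le_norm _ i); rewrite mxE.
  rewrite -[`|p 0 i|]gez0_abs // -pmulrn => h; rewrite lez_nat /N.
  by rewrite truncn_ge_nat // (le_trans _ h).
exists [ffun i => inord (absz (p 0 i + N%:Z))] => //.
rewrite /F -pP; congr (proj_pt (map_mx intr _)); apply/rowP => i.
rewrite mxE ffunE inordK; first by have := pN i; lia.
by have := pN i; lia.
Qed.

End ProjectiveSpace.

Section SimplexLemma.
Context {R : realType}.

(* The determinant of the integer representatives of [d + 1] of these points is an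
   integer, of absolute value at most [H ^ d.+1 / c ^ d.+1] times the determinant
   of the lifts, hence less than 1. *)
Theorem simplex n d : (n.+1 <= d)%N -> exists L, forall K c : R, 0 <= K -> 0 < c ->
  exists2 C : R, 0 < C & forall (Phi : 'rV[R]_n.+1 -> 'rV[R]_d.+1) v (rho H : R),
  0 < rho <= 1 -> 0 <= H -> smooth_on (ball v rho) Phi ->
  (forall s z, (size s <= L)%N -> ball v rho z -> `|dpartials s Phi z| <= K) ->
  (forall z, ball v rho z -> c <= `|Phi z|) ->
  C * H ^+ d.+1 * rho ^+ N_kd n.+1 d < 1 ->
  exists2 P : 'cV[R]_d.+1, P != 0 & forall z, ball v rho z ->
    rational_point (proj_pt (Phi z)) -> Hstd (proj_pt (Phi z)) <= H ->
    (Phi z *m P) 0 0 = 0.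
Proof.
move=> nd; have [L det_leK] := @det_param_le R n d nd.
exists L => K c K0 c0; have [C C0 det_le] := det_leK K K0.
exists ((C + 1) / c ^+ d.+1); first by rewrite divr_gt0 ?exprn_gt0 // ltr_wpDl.
move=> Phi v rho H hrho H0 Ps PK Pc small.
have Pn0 z : ball v rho z -> Phi z != 0.
  by move=> /Pc h; rewrite -normr_gt0 (lt_le_trans c0).
(* The integer representatives, as multiples [t *: Phi z]: height at most [H] and [c <= |Phi z|]
   give [|t| <= H / c]. *)
pose X := [set x : 'rV[R]_d.+1 | exists z (p : 'rV[int]_d.+1) (t : R),
  [/\ ball v rho z, x = map_mx intr p, x = t *: Phi z & `|t| <= H / c] ].
have Xdet (p : 'I_d.+1 -> 'rV[R]_d.+1) : (forall i, X (p i)) -> \det (\matrix_i p i) = 0.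
  move=> /choice[z] /choice[q] /choice[t] h.
  have E1 : \matrix_i p i = map_mx intr (\matrix_i q i) :> 'M[R]_d.+1.
    apply/matrixP => i j; have [_ pq _ _] := h i.
    by rewrite [LHS]mxE pq !mxE.
  have E2 : \matrix_i p i = diag_mx (\row_i t i) *m \matrix_i Phi (z i).
    apply/matrixP => i j; have [_ _ pt _] := h i.
    by rewrite mul_diag_mx !mxE pt !mxE.
  have : `|\det (\matrix_i p i)| < 1.
    rewrite E2 det_mulmx det_diag normrM normr_prod; apply: le_lt_trans small.
    apply: (@le_trans _ _ ((H / c) ^+ d.+1 * (C * rho ^+ N_kd n.+1 d))).
      apply: ler_pM => //; first by rewrite prodr_ge0.
        rewrite -[leRHS](_ : \prod_(i < d.+1) (H / c) = _); last first.
          by rewrite prodr_const card_ord.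
        by apply: ler_prod => i _; have [_ _ _ ht] := h i; rewrite mxE normr_ge0 ht.
      by apply: (det_le _ v) => // i; have [hz _ _ _] := h i.
    have [r0 r1] := andP hrho.
    rewrite expr_div_n.
    have -> : (C + 1) / c ^+ d.+1 * H ^+ d.+1 * rho ^+ N_kd n.+1 d =
      H ^+ d.+1 / c ^+ d.+1 * ((C + 1) * rho ^+ N_kd n.+1 d) by ring.
    rewrite ler_wpM2l ?divr_ge0 ?exprn_ge0 ?(ltW c0) //.
    by rewrite ler_wpM2r ?exprn_ge0 ?(ltW r0) // lerDl.
  rewrite E1 det_map_mx -intr_norm -[1]/(1%:~R) ltr_int.
  move: (\det _) => D; have [->|D0] := eqVneq D 0; first by [].
  by rewrite ltNge -gtz0_ge1 normr_gt0 D0.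
have [P P0 PX] := hyperplane_of_singular (ltn0Sn d) Xdet.
exists P => // z hz rz Hz.
have [p [p0 pz pH]] := HstdP rz.
have p0' := map_intr_neq0 p0 (R := R).
have [t t0 pt] := (proj_pt_eqP p0' (Pn0 z hz)).1 pz.
have : X (map_mx intr p).
  exists z, p, t; split => //.
  rewrite ler_pdivlMr //; apply: (@le_trans _ _ (`|t| * `|Phi z|)).
    by rewrite ler_wpM2l // Pc.
  by rewrite -normrZ -pt -pH.
by move=> /PX; rewrite pt -scalemxAl mxE => /eqP; rewrite mulf_eq0 (negbTE t0) => /eqP.
Qed.

End SimplexLemma.

(** * Comparison of the Riemannian distance with coordinates *)

Section QuadraticForm.
Context {R : realType}.

Lemma quadE n (v : 'rV[R]_n) (G : 'M[R]_n) :
  (v *m G *m v^T) 0 0 = \sum_j \sum_i v 0 i * G i j * v 0 j.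
Proof.
rewrite mxE; apply: eq_bigr => j _.
by rewrite mxE big_distrl; apply: eq_bigr => i _; rewrite !mxE.
Qed.

Lemma cvg_quad (T : Type) (F : set_system T) n (v : T -> 'rV[R]_n)
    (G : T -> 'M[R]_n) (v0 : 'rV[R]_n) (G0 : 'M[R]_n) : Filter F ->
  v x @[x --> F] --> v0 -> G x @[x --> F] --> G0 ->
  (v x *m G x *m (v x)^T) 0 0 @[x --> F] --> (v0 *m G0 *m v0^T) 0 0.
Proof.
move=> FF vF GF; rewrite quadE; under eq_cvg do rewrite quadE.
apply: cvg_sumr => j; apply: cvg_sumr => i.
by apply: cvgM; [apply: cvgM|]; exact: cvg_coord.
Qed.

Lemma cvg_dot (T : Type) (F : set_system T) n (v w : T -> 'rV[R]_n)
    (v0 w0 : 'rV[R]_n) : Filter F ->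
  v x @[x --> F] --> v0 -> w x @[x --> F] --> w0 ->
  (v x *m (w x)^T) 0 0 @[x --> F] --> (v0 *m w0^T) 0 0.
Proof.
move=> FF vF wF.
have E (v1 w1 : 'rV[R]_n) : (v1 *m w1^T) 0 0 = \sum_i v1 0 i * w1 0 i.
  by rewrite mxE; apply: eq_bigr => i _; rewrite mxE.
rewrite E; under eq_cvg do rewrite E.
by apply: cvg_sumr => i; apply: cvgM; exact: cvg_coord.
Qed.

Lemma dot_norm n (x : 'rV[R]_n) : `|x| ^+ 2 <= (x *m x^T) 0 0.
Proof.
have [->|x0] := eqVneq x 0; first by rewrite normr0 expr0n mul0mx mxE.
have sq0 (i : 'I_n) : 0 <= x 0 i * x^T i 0 by rewrite mxE -expr2 sqr_ge0.
have [i xi] : exists i, `|x| <= `|x 0 i|.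
  apply: contrapT => H; suff : `|x| < `|x| by rewrite ltxx.
  apply: rV_norm_ltP; first by rewrite normr_gt0.
  by move=> i; rewrite ltNge; apply/negP => h; apply: H; exists i.
rewrite mxE (bigD1 i) //= (le_trans (y := x 0 i ^+ 2)) //.
  by rewrite -[leRHS]real_normK ?num_real // lerXn2r ?nnegrE.
by rewrite mxE -expr2 lerDl sumr_ge0.
Qed.

Lemma dot_gt0 n (x : 'rV[R]_n) : x != 0 -> 0 < (x *m x^T) 0 0.
Proof.
move=> x0; apply: lt_le_trans (dot_norm x).
by rewrite exprn_gt0 // normr_gt0.
Qed.

(** The kernel of [g x] is spanned by [x], and orthogonality to [x] keeps [w] out of it. By
    homogeneity unit vectors suffice; the orthogonal pairs of these form a compact set, on which the
    form is continuous and positive. The factor [|x| ^ 2] reflects that [gram] is homogeneous of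
    degree -2. *)
Lemma coercive_gram d (g : riemannian_metric R d) : exists2 c : R, 0 < c &
  forall x w : 'rV[R]_d.+1, x != 0 -> (w *m x^T) 0 0 = 0 ->
  c * `|w| ^+ 2 <= `|x| ^+ 2 * (w *m g x *m w^T) 0 0.
Proof.
pose S := [set y : 'rV[R]_d.+1 | `|y| = 1].
have cS : compact S.
  apply: bounded_closed_compact.
    by exists 1; split => // M M1 y /= ->; exact: ltW.
  rewrite (_ : S = (fun y => `|y|) @^-1` [set 1]) //.
  move/continuous_closedP : (@norm_continuous R 'rV[R]_d.+1); apply.
  exact: closed_eq.
pose B (p : 'rV[R]_d.+1 * 'rV[R]_d.+1) : R := (p.2 *m p.1^T) 0 0.
pose K := (S `*` S) `&` B @^-1` [set 0].
have cK : compact K.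
  apply: compact_closedI; first exact: compact_setX.
  have : continuous B.
    by move=> p; apply: cvg_dot; [exact: cvg_snd|exact: cvg_fst].
  by move=> /continuous_closedP; apply; exact: closed_eq.
pose h (p : 'rV[R]_d.+1 * 'rV[R]_d.+1) : R := (p.2 *m g p.1 *m p.2^T) 0 0.
have Sn0 (y : 'rV[R]_d.+1) : S y -> y != 0.
  by move=> y1; rewrite -normr_gt0 y1.
have hc : {within K, continuous h}.
  apply: continuous_in_subspaceT => p; rewrite inE => -[[p1 p2] _].
  apply: cvg_quad; first exact: cvg_snd.
  apply: (@cvg_comp _ _ _ fst (gram g) _ (nbhs p.1)); first exact: cvg_fst.
  by have [] := gram_smooth g [::] (Sn0 _ p1).
have ortho (x w : 'rV[R]_d.+1) : x != 0 -> w != 0 -> (w *m x^T) 0 0 = 0 ->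
    w \notin <[x]>%VS.
  move=> x0 w0 wx; apply/negP => /vlineP[t wt]; move: wx w0.
  rewrite wt -scalemxAl mxE => /eqP; rewrite mulf_eq0 (gt_eqF (dot_gt0 x0)) orbF.
  by move=> /eqP ->; rewrite scale0r eqxx.
have hK p : K p -> 0 < h p.
  move=> [[p1 p2] p3]; apply: gram_pos; first exact: Sn0.
  by apply: ortho => //; exact: Sn0.
have : closed (h @` K) by apply: compact_closed => //; exact: continuous_compact.
move=> /closed_openC oK.
have : nbhs 0 (~` (h @` K)).
  apply: open_nbhs_nbhs; split => // -[p Kp h0].
  by have := hK p Kp; rewrite h0 ltxx.
move=> /nbhs_ballP[c /= c0 hcK]; exists c => // x w x0 wx.
have [->|w0] := eqVneq w 0.
  by rewrite normr0 expr0n mulr0 !mul0mx mxE mulr0.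
have nx : 0 < `|x| by rewrite normr_gt0.
have nw : 0 < `|w| by rewrite normr_gt0.
pose y := `|x|^-1 *: x; pose u := `|w|^-1 *: w.
have unit1 (z : 'rV[R]_d.+1) : 0 < `|z| -> `| `|z|^-1 *: z | = 1.
  by move=> z0; rewrite normrZ normfV normr_id mulVf // gt_eqF.
have Kp : K (y, u).
  split; first by split; exact: unit1.
  rewrite /= /B /= (_ : u *m y^T = (`|w|^-1 * `|x|^-1) *: (w *m x^T)).
    by rewrite mxE wx mulr0.
  by rewrite /u /y linearZ /= -scalemxAl -scalemxAr scalerA.
have ch : c <= h (y, u).
  rewrite leNgt; apply/negP => hc'; apply: (hcK (h (y, u))); last by exists (y, u).
  by rewrite /ball /= sub0r normrN gtr0_norm // hK.
have hE : h (y, u) = `|w| ^- 2 * (`|x| ^+ 2 * (w *m g x *m w^T) 0 0).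
  have gE : g y = `|x| ^+ 2 *: g x.
    have := gram_homog g (invr_neq0 (lt0r_neq0 nx)) x0.
    by move=> <-; rewrite scalerA -exprMn divff ?gt_eqF // expr1n scale1r.
  rewrite /h /= gE (_ : _ *m _ *m _ =
      (`|w| ^- 2 * `|x| ^+ 2) *: (w *m g x *m w^T)); first by rewrite mxE -mulrA.
  have uT : u^T = `|w|^-1 *: w^T by rewrite /u linearZ.
  have uG : u *m g x = `|w|^-1 *: (w *m g x) by rewrite /u -scalemxAl.
  rewrite -[u *m (_ *: _)]scalemxAr uG uT scalerA -scalemxAl -scalemxAr scalerA; congr (_ *: _).
  by rewrite -exprVn expr2; ring.
have nw2 : 0 < `|w| ^+ 2 by rewrite exprn_gt0.
by rewrite -ler_pdivlMr // mulrC -hE.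
Qed.

End QuadraticForm.

Section CurveLength.
Context {R : realType}.

Lemma le_integral_speed (F f s : R -> R) :
  (forall t : R, 0 <= t <= 1 -> is_derive t 1 F (f t)) ->
  (forall t : R, 0 <= t <= 1 -> {for t, continuous f}) ->
  (forall t : R, 0 <= t <= 1 -> {for t, continuous s}) ->
  (forall t : R, 0 <= t <= 1 -> `|f t| <= s t) ->
  (`|F 1 - F 0|%:E <= \int[lebesgue_measure]_(t in `[0%R, 1%R]) (s t)%:E)%E.
Proof.
move=> Ff fc sc fs.
have in01 (h : R -> R) : (forall t : R, 0 <= t <= 1 -> {for t, continuous h}) ->
    {within `[0, 1], continuous h}.
  by move=> hc; apply: continuous_in_subspaceT => t; rewrite inE /= in_itv /=; exact: hc.
have half (F' f' : R -> R) :
    (forall t : R, 0 <= t <= 1 -> is_derive t 1 F' (f' t)) ->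
    (forall t : R, 0 <= t <= 1 -> {for t, continuous f'}) ->
    (forall t : R, 0 <= t <= 1 -> f' t <= s t) ->
    ((F' 1 - F' 0)%:E <= \int[lebesgue_measure]_(t in `[0%R, 1%R]) (s t)%:E)%E.
  move=> Ff' fc' fs'.
  have Fc t : 0 <= t <= 1 -> {for t, continuous F'}.
    move=> t01; have [Fd _] := Ff' t t01.
    by apply: differentiable_continuous; exact/derivable1_diffP.
  rewrite EFinB -(@continuous_FTC2 R f' F' 0 1 ltr01 (in01 _ fc')); last first.
  - move=> t; rewrite in_itv /= => /andP[t0 t1]; rewrite derive1E.
    by have [|_ ->] := Ff' t; rewrite ?(ltW t0) ?(ltW t1).
  - split.
    + move=> t; rewrite in_itv /= => /andP[t0 t1].
      by have [|] := Ff' t; rewrite ?(ltW t0) ?(ltW t1).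
    + by apply: cvg_at_right_filter; apply: Fc; rewrite lexx ler01.
    + by apply: cvg_at_left_filter; apply: Fc; rewrite lexx ler01.
  apply: le_integral => //.
  - by apply: continuous_compact_integrable; [exact: segment_compact|exact: in01].
  - by apply: continuous_compact_integrable; [exact: segment_compact|exact: in01].
  - by move=> t; rewrite inE /= in_itv /= => t01; rewrite lee_fin; exact: fs'.
have [_|_] := ger0P (F 1 - F 0).
  by apply: (half F f) => // t /fs; apply: le_trans; exact: ler_norm.
rewrite (_ : - (F 1 - F 0) = (- F) 1 - (- F) 0); last by rewrite !fctE; ring.
apply: (half (- F) (- f)) => [t /Ff h|t /fc h|t /fs h].
- exact: is_deriveN.
- exact: continuousN.
- by apply: le_trans h; rewrite -normrN; exact: ler_norm.
Qed.

End CurveLength.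

(** * Lower bound for the Riemannian distance *)

Section Veronese.
Context {R : realType} {d : nat}.
Implicit Types (x y v : 'rV[R]_d.+1) (P Q : proj_space R d).

(* The entries of the orthogonal projection onto the line spanned by [x]: these
   are functions on projective space, which separate its points. *)
Definition veronese x (a b : 'I_d.+1) : R := x 0 a * x 0 b / (x *m x^T) 0 0.

Lemma veroneseZ t x a b : t != 0 -> veronese (t *: x) a b = veronese x a b.
Proof.
move=> t0; rewrite /veronese (_ : _ *m (t *: x)^T = (t * t) *: (x *m x^T)); last first.
  by rewrite linearZ /= -scalemxAl -scalemxAr scalerA.
rewrite [(t *: x) 0 a]mxE [(t *: x) 0 b]mxE [(_ *: (_ *m _)) 0 0]mxE.
have [->|q0] := eqVneq ((x *m x^T) 0 0) 0; first by rewrite mulr0 !invr0 !mulr0.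
by field; rewrite q0 t0.
Qed.

Lemma veronese_proj x a b : x != 0 -> veronese (rep (proj_pt x)) a b = veronese x a b.
Proof.
move=> x0; have [t t0 ->] := (proj_pt_eqP (rep_neq0 (proj_pt x)) x0).1 (proj_ptK _).
exact: veroneseZ.
Qed.

Definition dveronese x v (a b : 'I_d.+1) : R :=
  (v 0 a * x 0 b + x 0 a * v 0 b) / (x *m x^T) 0 0 -
  x 0 a * x 0 b * (2 * (v *m x^T) 0 0) / (x *m x^T) 0 0 ^+ 2.

Lemma dotE x v : (v *m x^T) 0 0 = \sum_l v 0 l * x 0 l.
Proof. by rewrite mxE; apply: eq_bigr => l _; rewrite mxE. Qed.

(** Both sides depend only on the component [w] of [v] orthogonal to [x]: the left one because
    [veronese] is homogeneous of degree 0, the right one because [x] is in the kernel of [g x]. For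
    [w] the bound is [coercive_gram]. *)
Lemma dveronese_le (g : riemannian_metric R d) : exists2 C : R, 0 < C &
  forall x v a b, x != 0 ->
  `|dveronese x v a b| <= C * Num.sqrt ((v *m g x *m v^T) 0 0).
Proof.
have [c c0 coer] := coercive_gram g.
exists (2 / Num.sqrt c); first by rewrite divr_gt0 ?sqrtr_gt0.
move=> x v a b x0; set q := (x *m x^T) 0 0.
have q0 : 0 < q by exact: dot_gt0.
pose s := (v *m x^T) 0 0 / q; pose w := v - s *: x.
have wx : (w *m x^T) 0 0 = 0.
  rewrite mulmxBl mxsubE -scalemxAl [X in _ - X]mxE -/q /s divfK ?gt_eqF //.
  by rewrite subrr.
have xG : x *m g x = 0 by exact: gram_ker.
have Gx : g x *m x^T = 0.
  by rewrite -[g x]trmxK -trmx_mul gram_sym // xG trmx0.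
have vG : (v *m g x *m v^T) 0 0 = (w *m g x *m w^T) 0 0.
  rewrite (_ : v = w + s *: x); last by rewrite subrK.
  rewrite mulmxDl -scalemxAl xG scaler0 addr0 linearD linearZ /= mulmxDr.
  by rewrite -scalemxAr -(mulmxA w (g x) x^T) Gx mulmx0 scaler0 addr0.
have dE : dveronese x v a b = (w 0 a * x 0 b + x 0 a * w 0 b) / q.
  have wE l : v 0 l = w 0 l + s * x 0 l by rewrite !mxE subrK.
  have sq : (v *m x^T) 0 0 = s * q by rewrite /s divfK // gt_eqF.
  by rewrite /dveronese -/q !wE sq; field; rewrite gt_eqF.
have nx : 0 < `|x| by rewrite normr_gt0.
have xq : `|x| ^+ 2 <= q by exact: dot_norm.
have d1 : `|dveronese x v a b| <= 2 * (`|w| / `|x|).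
  rewrite dE normrM normfV (ger0_norm (ltW q0)) ler_pdivrMr //.
  apply: (@le_trans _ _ (2 * `|w| * `|x|)).
    apply: (le_trans (ler_normD _ _)); rewrite !normrM.
    have -> : 2 * `|w| * `|x| = `|w| * `|x| + `|x| * `|w| by ring.
    by apply: lerD; apply: ler_pM => //; exact: coord_le_norm.
  have -> : 2 * `|w| * `|x| = 2 * (`|w| / `|x|) * `|x| ^+ 2.
    by field; rewrite gt_eqF.
  by rewrite ler_wpM2l // mulr_ge0 // divr_ge0.
apply: (le_trans d1); rewrite -mulrA ler_wpM2l //.
rewrite vG [leRHS]mulrC ler_pdivlMr ?sqrtr_gt0 //.
have h : (`|w| / `|x|) ^+ 2 * c <= (w *m g x *m w^T) 0 0.
  rewrite expr_div_n mulrAC ler_pdivrMr ?exprn_gt0 // mulrC [leRHS]mulrC.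
  exact: coer.
rewrite -[leLHS]ger0_norm ?mulr_ge0 ?sqrtr_ge0 ?divr_ge0 //.
rewrite -sqrtr_sqr exprMn sqr_sqrtr ?(ltW c0) //.
exact: ler_wsqrtr.
Qed.

Lemma is_derive_veronese (gamma : R -> 'rV[R]_d.+1) (t : R) a b :
  derivable gamma t 1 -> gamma t != 0 ->
  is_derive t 1 (fun t => veronese (gamma t) a b)
    (dveronese (gamma t) (derive1 gamma t) a b).
Proof.
move=> gd g0.
have gi l : is_derive t 1 (fun u => gamma u 0 l : R) (derive1 gamma t 0 l).
  have h : derivable (fun u => gamma u 0 l : R) t 1 by move/derivable_mxP : gd; exact.
  by apply: DeriveDef => //; rewrite derive1E derive_mx // mxE.
pose q := \sum_(l < d.+1) ((fun u => gamma u 0 l : R) * (fun u => gamma u 0 l : R)).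
have qE u : q u = (gamma u *m (gamma u)^T) 0 0.
  by rewrite /q dotE fct_sumE; apply: eq_bigr.
have qd : is_derive t 1 q (\sum_l (gamma t 0 l *: derive1 gamma t 0 l +
    gamma t 0 l *: derive1 gamma t 0 l : R)).
  by apply: is_derive_sum => l; exact: is_deriveM.
have q0 : q t != 0 by rewrite qE gt_eqF // dot_gt0.
have := is_deriveM (is_deriveM (gi a) (gi b)) (is_deriveV q0 qd).
rewrite (_ : (_ * _ * _ : R -> R) = (fun t => veronese (gamma t) a b)); last first.
  by apply/funext => u; rewrite /veronese -qE.
move=> h; apply: is_derive_eq h _.
rewrite /dveronese -qE /GRing.scale /= dotE.
have -> : \sum_(l < d.+1) (gamma t 0 l * derive1 gamma t 0 l +
    gamma t 0 l * derive1 gamma t 0 l) = 2 * \sum_l derive1 gamma t 0 l * gamma t 0 l.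
  by rewrite mulr_sumr; apply: eq_bigr => l _; ring.
by rewrite !fctE; field; rewrite q0.
Qed.

Lemma continuous_speed (g : riemannian_metric R d) (gamma : R -> 'rV[R]_d.+1) (t : R) :
  derivable gamma t 1 -> {for t, continuous (derive1 gamma)} -> gamma t != 0 ->
  {for t, continuous (fun t => Num.sqrt
    ((derive1 gamma t *m g (gamma t) *m (derive1 gamma t)^T) 0 0))}.
Proof.
move=> gd dc g0.
have gc : {for t, continuous gamma}.
  by apply: differentiable_continuous; move/derivable1_diffP : gd.
apply: (@continuous_comp _ _ _ (fun t => (derive1 gamma t *m g (gamma t) *m (derive1 gamma t)^T) 0 0)); last exact: sqrt_continuous.
apply: (@cvg_quad _ _ (nbhs t)) => //.
apply: (@cvg_comp _ _ _ gamma (gram g) (nbhs t) (nbhs (gamma t))) => //.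
by have [] := gram_smooth g [::] g0.
Qed.

Lemma continuous_dveronese (gamma : R -> 'rV[R]_d.+1) (t : R) a b :
  derivable gamma t 1 -> {for t, continuous (derive1 gamma)} -> gamma t != 0 ->
  {for t, continuous (fun t => dveronese (gamma t) (derive1 gamma t) a b)}.
Proof.
move=> gd dc g0.
have gc : {for t, continuous gamma}.
  by apply: differentiable_continuous; move/derivable1_diffP : gd.
have ci l : {for t, continuous (fun u => gamma u 0 l : R)} by exact: (@cvg_coord _ _ (nbhs t)).
have di l : {for t, continuous (fun u => derive1 gamma u 0 l : R)} by exact: (@cvg_coord _ _ (nbhs t)).
have qc : {for t, continuous (fun u => (gamma u *m (gamma u)^T) 0 0)} by exact: (@cvg_dot _ _ (nbhs t)).
have pc : {for t, continuous (fun u => (derive1 gamma u *m (gamma u)^T) 0 0)} by exact: (@cvg_dot _ _ (nbhs t)).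
have q0 : (gamma t *m (gamma t)^T) 0 0 != 0 by rewrite gt_eqF // dot_gt0.
apply: cvgB.
  apply: cvgM; last exact: cvgV.
  by apply: cvgD; apply: cvgM; [exact: di|exact: ci|exact: ci|exact: di].
apply: cvgM.
  apply: cvgM; first by apply: cvgM; exact: ci.
  by apply: cvgM; [exact: cvg_cst|exact: pc].
apply: cvgV; first by rewrite expf_neq0.
by rewrite expr2; under eq_cvg do rewrite expr2; apply: cvgM; exact: qc.
Qed.

Theorem veronese_le_riem_dist (g : riemannian_metric R d) : exists2 C : R, 0 < C &
  forall P Q a b, (`|veronese (rep P) a b - veronese (rep Q) a b|%:E
    <= C%:E * riem_dist g P Q)%E.
Proof.
have [C C0 dv] := dveronese_le g.
exists C => // P Q a b; rewrite muleC -lee_pdivrMr //.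
apply: le_ereal_inf_tmp => _ [gamma [gd gc g0 gP gQ] <-].
rewrite lee_pdivrMr // muleC.
have g00 : gamma 0 != 0 by apply: g0; rewrite lexx ler01.
have g01 : gamma 1 != 0 by apply: g0; rewrite lexx ler01.
rewrite -gP -gQ !veronese_proj // distrC /curve_length.
have sc t : 0 <= t <= 1 -> {for t, continuous (fun t => Num.sqrt
    ((derive1 gamma t *m g (gamma t) *m (derive1 gamma t)^T) 0 0))}.
  by move=> t01; apply: continuous_speed; [exact: gd|exact: gc|exact: g0].
pose sp (t : R) : R := Num.sqrt
  ((derive1 gamma t *m g (gamma t) *m (derive1 gamma t)^T) 0 0).
have spc : {within `[0, 1], continuous sp}.
  by apply: continuous_in_subspaceT => t; rewrite inE /= in_itv /=; exact: sc.
have ms := measurable_int _ (continuous_compact_integrable (@segment_compact R 0 1) spc).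
rewrite -ge0_integralZl; [|by []|exact: ms|by move=> t _; rewrite lee_fin sqrtr_ge0|by rewrite lee_fin ltW].
under eq_integral do rewrite -EFinM.
apply: (@le_integral_speed R (fun t => veronese (gamma t) a b)
  (fun t => dveronese (gamma t) (derive1 gamma t) a b) (fun t => C * sp t)) => t t01.
- by apply: is_derive_veronese; [exact: gd|exact: g0].
- by apply: continuous_dveronese; [exact: gd|exact: gc|exact: g0].
- by apply: cvgM; [exact: cvg_cst|exact: sc].
- by apply: dv; exact: g0.
Qed.

End Veronese.

(** * Upper bound for the Riemannian distance *)

Section RiemannianUpperBound.
Context {R : realType} {d : nat}.

Lemma mx_entry_le_norm m n (A : 'M[R]_(m, n)) i j : `|A i j| <= `|A|.
Proof.
rewrite [leRHS]/Num.Def.normr/= mx_normrE.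
by apply: (@le_bigmax _ _ _ _ (fun p : 'I_m * 'I_n => `|A p.1 p.2|) (i, j)).
Qed.

Lemma quad_le n (v : 'rV[R]_n) (G : 'M[R]_n) (K : R) : `|G| <= K ->
  (v *m G *m v^T) 0 0 <= n%:R ^+ 2 * K * `|v| ^+ 2.
Proof.
move=> GK; have K0 : 0 <= K by exact: le_trans GK.
apply: le_trans (ler_norm _) _; rewrite quadE.
have E (c : R) : n%:R * c = \sum_(j < n) c by rewrite sumr_const card_ord mulr_natl.
have -> : n%:R ^+ 2 * K * `|v| ^+ 2 = n%:R * (n%:R * (`|v| * K * `|v|)) by ring.
rewrite E; apply: (le_trans (ler_norm_sum _ _ _)); apply: ler_sum => j _.
rewrite E; apply: (le_trans (ler_norm_sum _ _ _)); apply: ler_sum => i _.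
rewrite !normrM; apply: ler_pM; rewrite ?mulr_ge0 ?coord_le_norm //.
apply: ler_pM; rewrite ?coord_le_norm //.
exact: le_trans (mx_entry_le_norm _ _ _) GK.
Qed.

(** The segment from [X] to [Y] is an admissible curve, and [r <= |X0|] keeps it away from 0. In the
    Hausdorff part this bounds the diameters of images under a chart. *)
Lemma riem_dist_segment (g : riemannian_metric R d) (X0 : 'rV[R]_d.+1) : X0 != 0 ->
  exists C r : R, [/\ 0 < C, 0 < r & forall X Y, ball X0 r X -> ball X0 r Y ->
    (riem_dist g (proj_pt X) (proj_pt Y) <= (C * `|X - Y|)%:E)%E].
Proof.
move=> X00; have [K K0] := smooth_near_bounded 0 (gram_smooth g) X00.
move=> /nbhs_ballP[r0 /= r00 rK].
pose r := Num.min r0 `|X0|.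
have rp : 0 < r by rewrite lt_min r00 normr_gt0.
pose C := Num.sqrt (d.+1%:R ^+ 2 * K).
have Cp : 0 < C by rewrite sqrtr_gt0 mulr_gt0 // exprn_gt0.
exists C, r; split => // X Y hX hY.
have bn0 Z : ball X0 r Z -> Z != 0.
  rewrite ball_rVE => h; apply: contraTneq h => ->.
  by rewrite subr0 -leNgt /r ge_min lexx orbT.
have bK Z : ball X0 r Z -> `|g Z| <= K.
  move=> hZ; apply: (rK Z _ [::]) => //.
  by apply: le_ball hZ; rewrite /r ge_min lexx.
pose V : 'rV[R]_d.+1 := Y - X; pose gamma (t : R) : 'rV[R]_d.+1 := X + t *: V.
have gd (t : R) : is_derive t 1 gamma V.
  have := @is_derive_line R d.+1 _ id X V t (@derivable_id _ _ _ _).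
  by rewrite derive_id.
have g' : derive1 gamma = cst V.
  by apply/funext => t; rewrite derive1E; have [_ ->] := gd t.
have gb (t : R) : 0 <= t <= 1 -> ball X0 r (gamma t).
  move=> t01; apply: (@ball_segment _ _ X0 X V r 1 t) => //.
    by rewrite scale1r /V addrC subrK.
  by rewrite (min_idPl ler01) (max_idPr ler01).
have conn : connecting_curve (proj_pt X) (proj_pt Y) gamma.
  split.
  - by move=> t; have [] := gd t.
  - by rewrite g'; move=> t; exact: cvg_cst.
  - by move=> t /gb/bn0.
  - by rewrite /gamma scale0r addr0.
  - by rewrite /gamma scale1r /V addrC subrK.
apply: (@le_trans _ _ (curve_length g gamma)).
  by apply: ereal_inf_lbound; exists gamma.
have -> : (C * `|X - Y|)%:E = (\int[lebesgue_measure]_(t in `[0%R, 1%R]) (cst (C * `|X - Y|)%:E t))%E.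
  by rewrite integral_cst //= lebesgue_measure_itv /= lte_fin ltr01 oppr0 adde0 mule1.
apply: le_integral => //.
- apply: (@continuous_compact_integrable R (fun t => Num.sqrt
    ((derive1 gamma t *m g (gamma t) *m (derive1 gamma t)^T) 0 0))).
    exact: segment_compact.
  apply: continuous_in_subspaceT => t; rewrite inE /= in_itv /= => t01.
  apply: continuous_speed; first by have [] := gd t.
    by rewrite g'; exact: cvg_cst.
  exact: bn0 (gb t t01).
- apply: (@continuous_compact_integrable R (fun t => C * `|X - Y|)).
    exact: segment_compact.
  by apply: continuous_in_subspaceT => t _; exact: cvg_cst.
- move=> t; rewrite inE /= in_itv /= => t01; rewrite lee_fin g'.
  have -> : C * `|X - Y| = Num.sqrt (d.+1%:R ^+ 2 * K * `|V| ^+ 2).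
    by rewrite sqrtrM ?mulr_ge0 ?exprn_ge0 ?(ltW K0) // sqrtr_sqr normr_id /V distrC.
  by apply: ler_wsqrtr; apply: quad_le; exact: bK (gb t t01).
Qed.

End RiemannianUpperBound.

(** * Quantitative injectivity of immersions *)

Section Immersion.
Context {R : realType} {n d : nat}.
Variables (V : set 'rV[R]_n) (Phi : 'rV[R]_n -> 'rV[R]_d.+1) (v0 : 'rV[R]_n).
Hypotheses (oV : open V) (Ps : smooth_on V Phi) (Vv0 : V v0).

Let J : 'M[R]_(n, d.+1) := \matrix_i dpartial i Phi v0.

Lemma row_free_of_free : free (Phi v0 :: [seq dpartial i Phi v0 | i <- enum 'I_n]) ->
  row_free (col_mx (Phi v0) J).
Proof.
set s := _ :: _ => fs; apply: inj_row_free => a aW.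
have /freeP fs' : free (in_tuple s) by [].
have sz : size s = n.+1 by rewrite /= size_map size_enum_ord.
have : forall i : 'I_(size s), a 0 (inord i) = 0.
  apply: (fs' (fun i => a 0 (inord i))).
  pose G m := a 0 (inord m) *: s`_m.
  rewrite -[LHS]/(\sum_(i < size s) G i) -(big_mkord xpredT G) sz big_nat_recl //.
  rewrite big_mkord; apply/rowP => l; rewrite mxE summxE.
  have := congr1 (fun M : 'rV[R]_d.+1 => M 0 l) aW.
  rewrite /= mxE big_split_ord big_ord1 col_mxEu [RHS]mxE => E.
  rewrite [RHS]mxE -[RHS]E; congr (_ + _).
    rewrite mxE; congr (a 0 _ * _); apply/val_inj; by rewrite /= inordK.
  apply: eq_bigr => i _; rewrite col_mxEd mxE; congr (a 0 _ * _).
    by apply/val_inj; rewrite /= inordK // ltnS ltn_ord.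
  by rewrite /s /= (nth_map i) ?size_enum_ord // nth_ord_enum mxE.
move=> h; apply/rowP => j; rewrite mxE.
have js : (j < size s)%N by rewrite sz.
by have := h (Ordinal js); rewrite /= inord_val.
Qed.

Hypothesis Pfree : row_free (col_mx (Phi v0) J).

Lemma coord_pairing m (g : 'rV[R]_m -> 'rV[R]_d.+1) (l : 'I_d.+1) z :
  pairing g (delta_mx l 0) z = g z 0 l.
Proof.
rewrite /pairing mxE (bigD1 l) //= mxE !eqxx mulr1 big1 ?addr0 // => j jl.
by rewrite mxE (negbTE jl) mulr0.
Qed.

Lemma near_affine (eta : R) : 0 < eta -> exists2 r : R, 0 < r &
  forall x z, ball v0 r x -> ball v0 r z ->
    `|Phi x - Phi z - (x - z) *m J| <= eta * `|x - z| /\ `|Phi z - Phi v0| <= eta.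
Proof.
move=> e0.
have e1 : 0 < eta / n.+1%:R by rewrite divr_gt0.
have H : \forall z \near v0, V z /\ `|Phi v0 - Phi z| < eta /\
    forall i : 'I_n, `|dpartial i Phi v0 - dpartial i Phi z| < eta / n.+1%:R.
  near=> z; split; [|split].
  - by near: z; exact: open_nbhs_nbhs.
  - near: z.
    have := (Ps [::] Vv0).1; rewrite /prop_for /continuous_at /=.
    by move/cvgr_dist_lt; exact.
  - near: z; apply: (@filter_forall _ 'I_n _ (nbhs v0)) => i.
    have := (Ps [:: i] Vv0).1; rewrite /prop_for /continuous_at /=.
    by move/cvgr_dist_lt; exact.
move: H => /nbhs_ballP[r /= r0 hr]; exists r => // x z hx hz.
split; last by have [_ [h _]] := hr z hz; rewrite distrC ltW.
apply: rV_norm_leP => [|l]; first by rewrite mulr_ge0 // ltW.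
pose f := pairing Phi (delta_mx l 0).
have fs : smooth_on V f by exact: smooth_pairing.
pose P : 'cV[R]_n := \col_i (dpartial i Phi v0 0 l).
have := @mvt_affine R n f v0 r (eta / n.+1%:R) x z P.
have -> : f x - f z - ((x - z) *m P) 0 0 = (Phi x - Phi z - (x - z) *m J) 0 l.
  rewrite /f !coord_pairing !mxsubE; congr (_ - _).
  by rewrite !mxE; apply: eq_bigr => i _; rewrite !mxE.
move=> H; apply: le_trans (H _ _ hx hz) _.
- by move=> u i /hr[Vu _]; exact: (smooth_derivable [::] i fs Vu).
- move=> u i /hr[Vu [_ h]].
  have -> : dpartial i f u = dpartial i Phi u 0 l.
    have := dpartials_pairing (delta_mx l 0) [:: i] oV Ps Vu.
    by rewrite /= => ->; rewrite coord_pairing.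
  rewrite mxE -mxsubE; apply: (le_trans (coord_le_norm _ _)).
  by rewrite distrC ltW.
- rewrite ler_wpM2r // mulrCA ler_piMr ?(ltW e0) // ler_pdivrMr // mul1r.
  by rewrite ler_nat.
Unshelve. all: by end_near. Qed.

(** A right inverse of the matrix with rows [Phi v0] and the partial derivatives bounds
    [a = (1 - lam, x - z)] by the vector [(1 - lam) *: Phi v0 + (x - z) *m J]. The latter is
    [Phi x - lam *: Phi z] up to an error [2 * eta * |a|], which is absorbed since
    [eta = 1 / (4 * C1)]. The scalar [lam] makes this an estimate about projective points and not
    only about lifts. *)
Theorem immersion : exists C r : R, [/\ 0 < C, 0 < r, ball v0 r `<=` V &
  forall x z (lam : R), ball v0 r x -> ball v0 r z ->
    `|x - z| <= C * `|Phi x - lam *: Phi z| ].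
Proof.
have /row_freeP[B WB] := Pfree.
set W := col_mx _ _ in WB.
pose C1 : R := d.+1%:R * `|B| + 1.
have C10 : 0 < C1 by rewrite ltr_wpDl // mulr_ge0.
have aC (a : 'rV[R]_(1 + n)) : `|a| <= C1 * `|a *m W|.
  apply: rV_norm_leP => [|l]; first by rewrite mulr_ge0 // ltW.
  have -> : a 0 l = (a *m W *m B) 0 l by rewrite -mulmxA WB mulmx1.
  rewrite mxE.
  apply: (le_trans (ler_norm_sum _ _ _)).
  apply: (@le_trans _ _ (\sum_(j < d.+1) `|a *m W| * `|B|)).
    apply: ler_sum => j _; rewrite normrM; apply: ler_pM => //.
      exact: coord_le_norm.
    exact: mx_entry_le_norm.
  rewrite sumr_const card_ord -mulr_natl /C1 mulrDl mul1r.
  have -> : d.+1%:R * (`|a *m W| * `|B|) = d.+1%:R * `|B| * `|a *m W| by ring.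
  by rewrite lerDl.
pose eta := (4 * C1)^-1.
have eta0 : 0 < eta by rewrite invr_gt0 mulr_gt0.
have [r r0 hr] := near_affine eta0.
have /nbhs_ballP[r1 /= r10 r1V] : nbhs v0 V by exact: open_nbhs_nbhs.
exists (2 * C1), (Num.min r r1); split.
- by rewrite mulr_gt0.
- by rewrite lt_min r0.
- by apply: subset_trans r1V; apply: le_ball; rewrite ge_min lexx orbT.
move=> x z lam hx hz.
have hx' : ball v0 r x by apply: le_ball hx; rewrite ge_min lexx.
have hz' : ball v0 r z by apply: le_ball hz; rewrite ge_min lexx.
have [h1 h2] := hr x z hx' hz'.
pose a : 'rV[R]_(1 + n) := row_mx (1 - lam)%:M (x - z).
have aW : a *m W = (1 - lam) *: Phi v0 + (x - z) *m J.
  by rewrite mul_row_col mul_scalar_mx.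
have ax : `|x - z| <= `|a|.
  apply: rV_norm_leP => // l; apply: le_trans (coord_le_norm a (rshift 1 l)).
  by rewrite row_mxEr.
have al : `|1 - lam| <= `|a|.
  apply: le_trans (coord_le_norm a (lshift n 0)).
  by rewrite row_mxEl mxE eqxx mulr1n.
have E : a *m W = (Phi x - lam *: Phi z) -
    (Phi x - Phi z - (x - z) *m J) - (1 - lam) *: (Phi z - Phi v0).
  by rewrite aW; apply/rowP => l; rewrite !mxE; ring.
have H : `|a *m W| <= `|Phi x - lam *: Phi z| + 2 * eta * `|a|.
  rewrite E; apply: (le_trans (ler_normB _ _)).
  have -> : 2 * eta * `|a| = eta * `|a| + `|a| * eta by ring.
  rewrite addrA; apply: lerD.
    apply: (le_trans (ler_normB _ _)); rewrite lerD2l.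
    by apply: (le_trans h1); rewrite ler_wpM2l // ltW.
  by rewrite normrZ; apply: ler_pM.
have := aC a; have aCH := ler_wpM2l (ltW C10) H.
move=> /le_trans/(_ aCH); rewrite mulrDr.
have -> : C1 * (2 * eta * `|a|) = `|a| / 2 by rewrite /eta; field; rewrite gt_eqF.
by lra.
Qed.

End Immersion.

(** * Charts and nondegeneracy *)

Section Landau.
Context {R : realType}.

(** [G j] is the [j]-th derivative of [G 0]. Let [A] be the maximum of [|G 1|], attained at [c]; by
    induction [|G 2| <= K] with [K] in terms of [A]. On an interval of length [h = th * T]
    containing [c] the mean value theorem gives a point where [|G 1| <= 2 * a / h], hence
    [A <= 2 * a / h + K * h], and [th] is so small that [A] contributes at most [A / 2] to
    [K * h]. *)
Lemma landau_kolmogorov n : exists2 C : R, 0 <= C &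
  forall (T a b x0 : R) (G : nat -> R -> R), 0 < T -> 0 <= a -> 0 <= b ->
  (forall j t, (j <= n)%N -> x0 <= t <= x0 + T -> is_derive t 1 (G j) (G j.+1 t)) ->
  (forall t, x0 <= t <= x0 + T -> `|G 0%N t| <= a) ->
  (forall t, x0 <= t <= x0 + T -> `|G n.+1 t| <= b) ->
  forall t, x0 <= t <= x0 + T -> `|G 1%N t| <= C * (a / T + b * T ^+ n).
Proof.
elim: n => [|n [C C0 IH]].
  exists 1 => // T a b x0 G T0 a0 b0 _ _ Gb t ht.
  by rewrite mul1r mulr1 (le_trans (Gb t ht)) // lerDr divr_ge0 // ltW.
pose th : R := (2 * (C + 1))^-1.
have C1 : 0 < C + 1 by rewrite ltr_wpDl.
have th0 : 0 < th by rewrite invr_gt0 mulr_gt0.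
have thC : th * C <= 1 / 2.
  by rewrite /th mulrC ler_pdivrMr ?mulr_gt0 //; lra.
have th1 : th <= 1 by rewrite invf_le1 ?mulr_gt0 //; lra.
exists (4 / th + 1); first by rewrite addr_ge0 // divr_ge0 // ltW.
move=> T a b x0 G T0 a0 b0 Gd Ga Gb.
have [c cT cmax] : exists2 c, c \in `[x0, x0 + T] &
    forall t, t \in `[x0, x0 + T] -> `|G 1%N t| <= `|G 1%N c|.
  apply: (@EVT_max R (fun t => `|G 1%N t|)); first by rewrite lerDl ltW.
  apply: continuous_in_subspaceT => t; rewrite inE /= in_itv /= => ht.
  apply: continuous_comp; last exact: norm_continuous.
  by apply: differentiable_continuous; apply/derivable1_diffP; have [] := Gd 1%N t isT ht.
have {}cT : x0 <= c <= x0 + T by move: cT; rewrite in_itv.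
have {}cmax t : x0 <= t <= x0 + T -> `|G 1%N t| <= `|G 1%N c|.
  by move=> ht; apply: cmax; rewrite in_itv.
pose A := `|G 1%N c|; have A0 : 0 <= A by exact: normr_ge0.
pose h := th * T.
have h0 : 0 < h by rewrite mulr_gt0.
have hT : h <= T by rewrite ler_piMl // ltW.
have G2 t : x0 <= t <= x0 + T -> `|G 2%N t| <= C * (A / T + b * T ^+ n).
  apply: (IH T A b x0 (fun j => G j.+1)) => // j u jn hu; exact: Gd.
set K := C * _ in G2.
have K0 : 0 <= K.
  apply: mulr_ge0 => //; apply: addr_ge0; first by rewrite divr_ge0 ?normr_ge0 ?(ltW T0).
  by rewrite mulr_ge0 // exprn_ge0 // ltW.
pose t1 := Num.min c (x0 + T - h).
have [ct [t1a t1b]] : t1 <= c <= t1 + h /\ x0 <= t1 /\ t1 + h <= x0 + T.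
  move: cT => /andP[c1 c2]; rewrite /t1; case: (leP c (x0 + T - h)) => hc;
    by split; [apply/andP; split|split]; lra.
have sub t : t1 <= t <= t1 + h -> x0 <= t <= x0 + T.
  by move=> /andP[h1 h2]; apply/andP; split; lra.
have t1h : t1 < t1 + h by rewrite ltrDl.
have [xi xih xiE] : exists2 xi, t1 <= xi <= t1 + h &
    G 0%N (t1 + h) - G 0%N t1 = G 1%N xi * h.
  have [||xi xih] := @MVT R (G 0%N) (G 1%N) t1 (t1 + h) t1h.
  - move=> u; rewrite in_itv /= => /andP[u1 u2]; apply: Gd => //.
    by apply: sub; rewrite !ltW.
  - apply: continuous_in_subspaceT => u; rewrite inE /= in_itv /= => hu.
    apply: differentiable_continuous; apply/derivable1_diffP.
    by have [] := Gd 0%N u isT (sub _ hu).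
  move: xih; rewrite in_itv /= => /andP[u1 u2].
  rewrite [t1 + h]addrC addrK addrC => ->; exists xi => //.
  by rewrite !ltW // addrC.
have G1xi : `|G 1%N xi| <= 2 * a / h.
  rewrite ler_pdivlMr // -[X in _ * X](ger0_norm (ltW h0)) -normrM -xiE.
  apply: (le_trans (ler_normB _ _)); rewrite mulr_natl mulr2n.
  by apply: lerD; apply: Ga; apply: sub; rewrite lexx ?(ltW t1h).
have G1c : A <= 2 * a / h + K * h.
  have := @mvt_abs R (G 1%N) (G 2%N) xi c K.
  have mid u : Num.min xi c <= u <= Num.max xi c -> x0 <= u <= x0 + T.
    move: xih ct => /andP[u1 u2] /andP[u3 u4].
    by rewrite ge_min le_max => /andP[/orP[] v1 /orP[] v2]; apply: sub; apply/andP; split; lra.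
  move=> /(_ (fun u hu => Gd 1%N u isT (mid u hu)) (fun u hu => G2 u (mid u hu))) H.
  have cxi : `|c - xi| <= h.
    move: xih ct => /andP[u1 u2] /andP[u3 u4].
    by rewrite ler_norml; apply/andP; split; lra.
  rewrite /A -(subrK (G 1%N xi) (G 1%N c)) addrC.
  apply: (le_trans (ler_normD _ _)); apply: lerD => //.
  by apply: (le_trans H); rewrite ler_wpM2l.
move=> t ht; apply: (le_trans (cmax t ht)); rewrite -/A.
have Kh : K * h = th * C * (A + b * T ^+ n.+1).
  by rewrite /K /h exprS; field; rewrite gt_eqF.
have bT : 0 <= b * T ^+ n.+1 by rewrite mulr_ge0 // exprn_ge0 // ltW.
have : K * h <= 1 / 2 * (A + b * T ^+ n.+1).
  by rewrite Kh ler_wpM2r // addr_ge0.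
have aT : 0 <= a / T by rewrite divr_ge0 // ltW.
have -> : (4 / th + 1) * (a / T + b * T ^+ n.+1) =
    2 * (2 * a / h) + (4 / th * (b * T ^+ n.+1) + (a / T + b * T ^+ n.+1)).
  by rewrite /h; field; rewrite !gt_eqF.
have : 0 <= 4 / th * (b * T ^+ n.+1) by rewrite mulr_ge0 // divr_ge0 // ltW.
lra.
Qed.

Definition vanishes_to_order n (p : nat) (f : 'rV[R]_n -> R^o) v :=
  exists C r0 : R, [/\ 0 <= C, 0 < r0 &
    forall T x, 0 < T < r0 -> ball v T x -> `|f x| <= C * T ^+ p].

Lemma vanishes_value n p (f : 'rV[R]_n -> R^o) v :
  vanishes_to_order p.+1 f v -> f v = 0.
Proof.
move=> [C [r0 [C0 r00 H]]]; apply/eqP; apply: contraT; rewrite -normr_gt0 => e0.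
have C1 : 0 < 2 * (C + 1) by rewrite mulr_gt0 // ltr_wpDl.
pose e := `|f v|; pose T := Num.min (r0 / 2) (Num.min 1 (e / (2 * (C + 1)))).
have T0 : 0 < T by rewrite !lt_min !divr_gt0 // ltr01.
have Tr : T < r0.
  by apply: (@le_lt_trans _ _ (r0 / 2)); [rewrite ge_min lexx|lra].
have T1 : T <= 1 by rewrite !ge_min lexx !orbT.
have Te : T <= e / (2 * (C + 1)) by rewrite !ge_min lexx !orbT.
have := H T v _ (ballxx v T0); rewrite T0 Tr => /(_ isT); rewrite -/e => he.
have : C * T ^+ p.+1 <= C * T.
  by rewrite ler_wpM2l // exprS ler_piMr ?(ltW T0) // exprn_ile1 // ltW.
have : (2 * (C + 1)) * T <= e by rewrite mulrC -ler_pdivlMr.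
have : 0 <= C * T by rewrite mulr_ge0 // ltW.
rewrite mulrDr mulrDl mulr1; rewrite -/e in e0; nra.
Qed.

(** [landau_kolmogorov] on a segment of length [T] in direction [i], which stays in
    [ball v (3 * T)]: there [f] is [O(T ^ (p + 1))] and its derivatives of order [p + 1] are
    bounded, so the first derivative is [O(T ^ p)]. *)
Lemma vanishes_dpartial n p (f : 'rV[R]_n -> R^o) v V i :
  open V -> smooth_on V f -> V v ->
  vanishes_to_order p.+1 f v -> vanishes_to_order p (dpartial i f) v.
Proof.
move=> oV fs Vv [C [r0 [C0 r00 H]]].
have [K K0 fK] := smooth_near_bounded p.+1 fs Vv.
have : \forall x \near v, V x /\ forall s, (size s <= p.+1)%N -> `|dpartials s f x| <= K.
  near=> x; split; near: x => //; exact: open_nbhs_nbhs.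
move=> /nbhs_ballP[r1 /= r10 hr1].
have [CL CL0 L] := landau_kolmogorov p.
exists (CL * (C * 3 ^+ p.+1 + K)), (Num.min r0 r1 / 3); split.
- by rewrite mulr_ge0 // addr_ge0 ?(ltW K0) // mulr_ge0 // exprn_ge0.
- by rewrite divr_gt0 // lt_min r00.
move=> T x /andP[T0 Tr] hx.
have [T30 T3r0 T3r1] : [/\ 0 < 3 * T, 3 * T < r0 & 3 * T < r1].
  move: Tr; rewrite ltr_pdivlMr // lt_min => /andP[h1 h2].
  by split; [rewrite mulr_gt0|rewrite mulrC|rewrite mulrC].
pose G j (t : R) : R := dpartials (nseq j i) f (x + t *: delta_mx 0 i).
have inb t : 0 <= t <= 0 + T -> ball v (3 * T) (x + t *: delta_mx 0 i).
  rewrite add0r => /andP[t0 t1]; have -> : 3 * T = T + 2 * T by ring.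
  apply: ball_triangle hx _; rewrite ball_rVE opprD addrA subrr add0r normrN.
  by apply: (le_lt_trans (norm_delta_le _ _)); rewrite ger0_norm //; lra.
have inV t : 0 <= t <= 0 + T -> V (x + t *: delta_mx 0 i).
  by move=> /inb ht; have [] := hr1 _ (le_ball (ltW T3r1) ht).
have Gd j t : (j <= p)%N -> 0 <= t <= 0 + T -> is_derive t 1 (G j) (G j.+1 t).
  by move=> _ /inV Vt; apply: is_derive_line; exact: smooth_derivable fs Vt.
have G0 t : 0 <= t <= 0 + T -> `|G 0%N t| <= C * (3 * T) ^+ p.+1.
  by move=> /inb; apply: H; rewrite T30.
have GK t : 0 <= t <= 0 + T -> `|G p.+1 t| <= K.
  move=> /inb ht; have [_] := hr1 _ (le_ball (ltW T3r1) ht); apply.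
  by rewrite size_nseq.
have a0 : 0 <= C * (3 * T) ^+ p.+1 by rewrite mulr_ge0 // exprn_ge0 // ltW.
have T00 : 0 <= (0 : R) <= 0 + T by rewrite add0r lexx ltW.
have := L T _ K 0 G T0 a0 (ltW K0) Gd G0 GK 0 T00.
rewrite {1}/G /= scale0r addr0 => /le_trans; apply.
rewrite le_eqVlt; apply/orP; left; apply/eqP.
by rewrite exprMn [T ^+ p.+1]exprS; field; rewrite gt_eqF.
Unshelve. all: by end_near.
Qed.

Lemma dpartials_cat n (W : normedModType R) (s t : seq 'I_n) (f : 'rV[R]_n -> W) :
  dpartials s (dpartials t f) = dpartials (s ++ t) f.
Proof. by rewrite /dpartials foldr_cat. Qed.

Lemma vanishes_dpartials n p (f : 'rV[R]_n -> R^o) v V s :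
  open V -> smooth_on V f -> V v -> vanishes_to_order p f v -> (size s < p)%N ->
  dpartials s f v = 0.
Proof.
move=> oV fs Vv fp sp.
suff H : vanishes_to_order (p - size s) (dpartials s f) v.
  apply: (@vanishes_value n (p - size s).-1); rewrite prednK //.
  by rewrite subn_gt0.
elim: s sp => [|i s IH] /= sp; first by rewrite subn0.
apply: (@vanishes_dpartial n _ (dpartials s f) v V i) => //.
  by move=> t x Vx; rewrite dpartials_cat; exact: fs.
have -> : (p - (size s).+1).+1 = (p - size s)%N by lia.
by apply: IH; lia.
Qed.

End Landau.

(** * Points of the manifold near a point of a chart *)

Section LocalInverse.
Context {R : realType} {n d : nat}.

Lemma mulmx_veronese (x y : 'rV[R]_d.+1) :
  x *m (\matrix_(a, b) veronese y a b) = ((x *m y^T) 0 0 / (y *m y^T) 0 0) *: y.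
Proof.
apply/rowP => b; rewrite [LHS]mxE [RHS]mxE dotE mulr_suml mulr_suml.
by apply: eq_bigr => a _; rewrite mxE /veronese; ring.
Qed.

Lemma mulmx_veronese_id (x : 'rV[R]_d.+1) : x != 0 ->
  x *m (\matrix_(a, b) veronese x a b) = x.
Proof. by move=> x0; rewrite mulmx_veronese divff ?scale1r // gt_eqF // dot_gt0. Qed.

Lemma mulmx_veronese_le (x y z : 'rV[R]_d.+1) (t : R) :
  (forall a b, `|veronese y a b - veronese z a b| <= t) ->
  `|x *m (\matrix_(a, b) veronese y a b) - x *m (\matrix_(a, b) veronese z a b)|
    <= d.+1%:R * (`|x| * t).
Proof.
move=> h; have t0 : 0 <= t by exact: le_trans (h 0 0).
apply: rV_norm_leP => [|b]; first by rewrite !mulr_ge0.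
rewrite -mulmxBr; apply: mulmx_entry_le => [i j|i j].
  by rewrite ord1 coord_le_norm.
by rewrite !mxE.
Qed.

Lemma near_veronese (Phi : 'rV[R]_n -> 'rV[R]_d.+1) v0 (e : R) :
  {for v0, continuous Phi} -> Phi v0 != 0 -> 0 < e ->
  \forall x \near v0, forall a b, `|veronese (Phi v0) a b - veronese (Phi x) a b| < e.
Proof.
move=> Pc P0 e0.
apply: (@filter_forall _ 'I_d.+1 _ (nbhs v0)) => a.
apply: (@filter_forall _ 'I_d.+1 _ (nbhs v0)) => b.
have : veronese (Phi x) a b @[x --> v0] --> veronese (Phi v0) a b.
  have ci l : {for v0, continuous (fun u => Phi u 0 l : R)} by exact: (@cvg_coord _ _ (nbhs v0)).
  have qc : {for v0, continuous (fun u => (Phi u *m (Phi u)^T) 0 0)}.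
    exact: (@cvg_dot _ _ (nbhs v0)).
  have q0 : (Phi v0 *m (Phi v0)^T) 0 0 != 0 by rewrite gt_eqF // dot_gt0.
  exact: (cvgM (cvgM (ci a) (ci b)) (cvgV q0 qc)).
by move/cvgr_dist_lt; exact.
Qed.

Definition open_chart (M : set (proj_space R d)) (V : set 'rV[R]_n)
    (Phi : 'rV[R]_n -> 'rV[R]_d.+1) v0 :=
  [/\ open V, smooth_on V Phi, V v0 & forall v, V v -> Phi v != 0] /\
  [/\ free (Phi v0 :: [seq dpartial i Phi v0 | i <- enum 'I_n]) &
      forall W : set 'rV[R]_n, open W -> W `<=` V ->
        exists2 O : set (proj_space R d), Defs.proj_open O &
          [set proj_pt (Phi w) | w in W] = O `&` M].

Lemma chart_continuous M V Phi v0 v : open_chart M V Phi v0 -> V v ->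
  {for v, continuous Phi}.
Proof. by move=> [[_ Ps _ _] _] Vv; exact: (Ps [::] v Vv).1. Qed.

(** Projecting [Phi v0] orthogonally onto the line [Q] gives a lift of [Q] close to [Phi v0]. Hence
    [Q] lies in the open set that cuts the image of a small ball out of [M], which provides [z];
    then [immersion] bounds [|z - x|]. *)
Lemma local_inverse M V Phi v0 (r1 : R) : open_chart M V Phi v0 -> 0 < r1 ->
  exists C delta r0 : R, [/\ 0 < C, 0 < delta, 0 < r0, ball v0 r0 `<=` V &
  forall x Q t, ball v0 r0 x -> M Q -> t < delta ->
    (forall a b, `|veronese (rep Q) a b - veronese (Phi x) a b| <= t) ->
    exists z, [/\ ball v0 r1 z, V z, Q = proj_pt (Phi z) & `|z - x| <= C * t]].
Proof.
move=> ch r10; have [[oV Ps Vv0 P0] [fr HO]] := ch.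
have [C1 [r2 [C10 r20 r2V imm]]] := immersion oV Ps Vv0 (row_free_of_free fr).
pose r := Num.min r1 r2.
have rp : 0 < r by rewrite lt_min r10.
have rr1 : ball v0 r `<=` ball v0 r1 by apply: le_ball; rewrite ge_min lexx.
have rr2 : ball v0 r `<=` ball v0 r2 by apply: le_ball; rewrite ge_min lexx orbT.
have [Op oO OM] := HO (ball v0 r) (ball_open _ _) (subset_trans rr2 r2V).
have Pv0 := P0 v0 Vv0.
have Ov0 : Op (proj_pt (Phi v0)).
  have : (Op `&` M) (proj_pt (Phi v0)) by rewrite -OM; exists v0 => //; exact: ballxx.
  by case.
have : nbhs (Phi v0) [set x : 'rV[R]_d.+1 | x != 0 /\ Op (proj_pt x)].
  by apply: open_nbhs_nbhs; split.
move=> /nbhs_ballP[e /= e0 eO].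
have nP : 0 < `|Phi v0| by rewrite normr_gt0.
(* The entries of the projections onto [Phi v0] and [Q] differ by less than [2 * delta], which moves
   the projection of [Phi v0] by less than [e]. *)
pose delta := e / (2 * (d.+1%:R * (`|Phi v0| + 1))).
have D0 : 0 < d.+1%:R * (`|Phi v0| + 1) by rewrite mulr_gt0 // addr_gt0.
have delta0 : 0 < delta by rewrite divr_gt0 // mulr_gt0.
have Pc := chart_continuous ch Vv0.
have : \forall x \near v0, ball v0 r x /\ `|Phi v0 - Phi x| < 1 /\
    forall a b, `|veronese (Phi v0) a b - veronese (Phi x) a b| < delta.
  near=> x; split; first by near: x; exact: nbhsx_ballx.
  split; near: x; last exact: near_veronese.
  by move/cvgr_dist_lt : Pc; exact.
move=> /nbhs_ballP[r0 /= r00 hr0].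
exists (C1 * (d.+1%:R * (`|Phi v0| + 1))), delta, (Num.min r0 r); split => //.
- by rewrite mulr_gt0.
- by rewrite lt_min r00.
- by apply: subset_trans r2V; apply: subset_trans rr2; apply: le_ball; rewrite ge_min lexx orbT.
move=> x Q t hx MQ td hQ.
have [hxr [Px hv]] : ball v0 r x /\ `|Phi v0 - Phi x| < 1 /\
    forall a b, `|veronese (Phi v0) a b - veronese (Phi x) a b| < delta.
  by apply: hr0; apply: le_ball hx; rewrite ge_min lexx.
pose q := Phi v0 *m (\matrix_(a, b) veronese (rep Q) a b).
have hq : ball (Phi v0) e q.
  rewrite ball_rVE -[X in X - _](mulmx_veronese_id Pv0).
  have h2 a b : `|veronese (Phi v0) a b - veronese (rep Q) a b| <= delta + t.
    rewrite -(subrKA (veronese (Phi x) a b)).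
    by rewrite (le_trans (ler_normD _ _)) // lerD ?(ltW (hv a b)) // distrC.
  apply: (le_lt_trans (mulmx_veronese_le _ h2)).
  apply: (@lt_le_trans _ _ (d.+1%:R * (`|Phi v0| + 1) * (2 * delta))).
    rewrite -mulrA ltr_pM2l //.
    apply: (@lt_le_trans _ _ (`|Phi v0| * (2 * delta))).
      by rewrite ltr_pM2l //; lra.
    by rewrite ler_wpM2r ?lerDl // mulr_ge0 // ltW.
  rewrite /delta; move: (d.+1%:R * _) D0 => D D0.
  by rewrite le_eqVlt; apply/orP; left; apply/eqP; field; rewrite gt_eqF.
have [q0 Oq] := eO q hq.
have Qq : proj_pt q = Q.
  rewrite -[RHS]proj_ptK; apply/proj_pt_eqP => //; first exact: rep_neq0.
  move: q0; rewrite /q mulmx_veronese scaler_eq0 negb_or => /andP[s0 _].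
  by eexists; [exact: s0|].
have : (Op `&` M) Q by split => //; rewrite -Qq.
rewrite -OM => -[z hz zQ]; exists z.
have Vz : V z by apply: r2V; exact: rr2.
split => //; first exact: rr1.
have Pz0 := P0 z Vz; have Vx : V x by apply: r2V; exact: rr2.
have Px0 := P0 x Vx.
(* [lam *: Phi z] is the orthogonal projection of [Phi x] onto the line of [Phi z]. *)
pose lam := (Phi x *m (Phi z)^T) 0 0 / (Phi z *m (Phi z)^T) 0 0.
rewrite distrC; apply: (le_trans (imm x z lam (rr2 _ hxr) (rr2 _ hz))).
rewrite -[leRHS]mulrA ler_pM2l //.
rewrite -[X in X - _](mulmx_veronese_id Px0) -mulmx_veronese.
have h3 a b : `|veronese (Phi x) a b - veronese (Phi z) a b| <= t.
  by rewrite distrC -(veronese_proj _ _ Pz0) zQ.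
apply: (le_trans (mulmx_veronese_le _ h3)); rewrite -mulrA ler_pM2l //.
have t0 : 0 <= t by exact: le_trans (h3 0 0).
rewrite ler_wpM2r //.
have : `|Phi x| - `|Phi v0| <= `|Phi x - Phi v0| by exact: lerB_dist.
by rewrite distrC => h; move: Px => /ltW; lra.
Unshelve. all: by end_near.
Qed.

End LocalInverse.

(** * Nondegeneracy in different charts *)

Section Transfer.
Context {R : realType} {n d : nat}.

Lemma open_chart_of_local_param (M : set (proj_space R d)) (U : set 'rV[R]_n) Psi u0 :
  local_param M U Psi -> U u0 -> exists V Phi, [/\ open_chart M V Phi u0,
    V `<=` U & forall v, V v -> Psi v = proj_pt (Phi v)].
Proof.
move=> [oU HU PM Pinj PO] Uu0.
have [V [Phi [[oV Vu VU Ps] [P0 PE fr]]]] := HU u0 Uu0.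
exists V, Phi; split => //; split=> //; split=> // W oW WV.
have [Op oO OM] := PO W oW (subset_trans WV VU).
exists Op => //; rewrite -OM; apply/seteqP; split => [_ [w Ww <-]|_ [w Ww <-]];
  by exists w => //; rewrite PE //; exact: WV.
Qed.

(** The spanning condition in dual form, over words in place of multi-indices. *)
Definition nondegenerate_at D (Phi : 'rV[R]_n -> 'rV[R]_d.+1) v0 :=
  forall P : 'cV[R]_d.+1,
    (forall s, (size s <= D)%N -> pairing (dpartials s Phi) P v0 = 0) -> P = 0.

(* A linear form killing all derivatives of order at most [D] of one lift vanishes to order
   [D + 1] along it, in terms of the size of values only; this passes to any other
   lift, and gives back the vanishing of the derivatives. *)
Theorem nondegenerate_open_chart D M V' (Phi' : 'rV[R]_n -> 'rV[R]_d.+1) u0 :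
  open_chart M V' Phi' u0 -> D_nondegenerate n D M (proj_pt (Phi' u0)) ->
  nondegenerate_at D Phi' u0.
Proof.
move=> ch [V [Phi [v [[oV Ps P0 lp] [Vv Pv span]]]]] P Pvan.
have [[oV' Ps' Vu0 P0'] [fr' HO']] := ch.
have [C1 [r2 [C10 r20 r2V imm]]] := immersion oV' Ps' Vu0 (row_free_of_free fr').
have fs := smooth_pairing P oV Ps.
suff H : vanishes_to_order D.+1 (pairing Phi P) v.
  have van s : (size s <= D)%N -> pairing (dpartials s Phi) P v = 0.
    by move=> sD; rewrite -(dpartials_pairing P s oV Ps Vv) (vanishes_dpartials oV fs Vv H).
  have fullP (x : 'rV[R]_d.+1) : (x *m P) 0 0 = 0.
    have sub : (fullv <= lker (linfun (mulmxr P : 'rV[R]_d.+1 -> 'M[R]_1)))%VS.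
      rewrite -span; apply/span_subvP => y /mapP[al]; rewrite mem_filter => /andP[alD _] ->.
      rewrite memv_ker lfunE /=; apply/eqP/matrixP => i j; rewrite !ord1 [RHS]mxE.
      apply: van; rewrite size_flatten /shape -map_comp sumnE big_map big_enum /=.
      by under eq_bigr do rewrite size_nseq.
    have : x \in lker (linfun (mulmxr P : 'rV[R]_d.+1 -> 'M[R]_1)).
      by apply: (subvP sub); exact: memvf.
    by rewrite memv_ker lfunE /= => /eqP ->; rewrite mxE.
  apply/colP => i; rewrite mxE -[RHS](fullP (delta_mx 0 i)).
  by rewrite delta_mulmx.
have nP' : 0 < `|Phi' u0| by rewrite normr_gt0 P0'.
have Pc' := chart_continuous ch Vu0.
have [K' K'0 fK'] := smooth_near_bounded D.+1 (smooth_pairing P oV' Ps') Vu0.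
have : \forall u \near u0, [/\ V' u, `|Phi' u0 - Phi' u| < `|Phi' u0| / 2 &
    forall s, (size s <= D.+1)%N -> `|dpartials s (pairing Phi' P) u| <= K'].
  near=> u; split; near: u; [exact: open_nbhs_nbhs| |exact: fK'].
  by move/cvgr_dist_lt : Pc'; apply; rewrite divr_gt0.
move=> /nbhs_ballP[r3 /= r30 hr3].
pose r := Num.min r2 r3.
have rp : 0 < r by rewrite lt_min r20.
have rr2 : ball u0 r `<=` ball u0 r2 by apply: le_ball; rewrite ge_min lexx.
have rr3 : ball u0 r `<=` ball u0 r3 by apply: le_ball; rewrite ge_min lexx orbT.
have [Op oO OM] := HO' (ball u0 r) (ball_open _ _) (subset_trans rr2 r2V).
have Ou0 : Op (proj_pt (Phi v)).
  have : (Op `&` M) (proj_pt (Phi v)) by rewrite -OM Pv; exists u0 => //; exact: ballxx.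
  by case.
have [_ _ PM _ _] := lp.
have [K K0 PK] := smooth_near_bounded 1 Ps Vv.
have Pcv : {for v, continuous Phi} by exact: (Ps [::] v Vv).1.
have : \forall w \near v, [/\ V w, Op (proj_pt (Phi w)) &
    forall s, (size s <= 1)%N -> `|dpartials s Phi w| <= K].
  near=> w; split; near: w; [exact: open_nbhs_nbhs| |exact: PK].
  have : nbhs (Phi v) [set x : 'rV[R]_d.+1 | x != 0 /\ Op (proj_pt x)].
    by apply: open_nbhs_nbhs; split => //; split => //; exact: P0.
  by move=> /Pcv; apply: (@filterS _ (nbhs v)) => w [].
move=> /nbhs_ballP[r4 /= r40 hr4].
have [l0 l00 Pl0] : exists2 t : R, t != 0 & Phi v = t *: Phi' u0.
  by apply/proj_pt_eqP; rewrite ?P0 ?P0'.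
have nl0 : 0 < `|l0| by rewrite normr_gt0.
(* A Lipschitz constant at [v] for the change of charts that takes [w] to [u]; the additional 1
   gives a strict inequality. *)
pose C2 := C1 / `|l0| * (n%:R * K) + 1.
have C20 : 0 < C2 by rewrite ltr_wpDl // !mulr_ge0 ?invr_ge0 // ltW.
(* [u] is the parameter of the same projective point in the other chart. As the ratio [lam] of the
   lifts stays bounded, a bound for [P . Phi'] near [u0] is one for [P . Phi] near [v]. *)
have key w T : 0 < T -> T <= r4 -> ball v T w -> exists u (lam : R),
    [/\ ball u0 r u, ball u0 (C2 * T) u, Phi w = lam *: Phi' u &
        `|lam| <= 2 * K / `|Phi' u0| ].
  move=> T0 Tr hw; have [Vw Ow Kw] := hr4 w (le_ball Tr hw).
  have : (Op `&` M) (proj_pt (Phi w)) by split => //; apply: PM; exists w.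
  rewrite -OM => -[u hu uw].
  have [Vu Pu _] := hr3 u (rr3 _ hu).
  have [lam lam0 wl] : exists2 t : R, t != 0 & Phi w = t *: Phi' u.
    by apply/proj_pt_eqP; rewrite ?P0 ?P0'.
  exists u, lam; split => //.
    have lipw : `|Phi v - Phi w| <= n%:R * K * `|v - w|.
      apply: rV_norm_leP => [|l]; first by rewrite !mulr_ge0 // ltW.
      rewrite mxsubE -!coord_pairing.
      have fl := smooth_pairing (delta_mx l 0) oV Ps.
      apply: (@mvt_ball _ _ _ v v w r4) => //; first exact: ballxx.
      - by apply: le_ball hw.
      - by move=> z i /hr4[Vz _ _]; exact: (smooth_derivable [::] i fl Vz).
      - move=> z i /hr4[Vz _ Kz].
        rewrite -[dpartial _ _ _]/(dpartials [:: i] _ z) (dpartials_pairing _ _ oV Ps Vz).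
        rewrite coord_pairing; apply: (le_trans (coord_le_norm _ _)).
        exact: Kz.
    have u00 : ball u0 r2 u0 by exact: ballxx.
    have := imm u0 u (lam / l0) u00 (rr2 _ hu).
    have -> : Phi' u0 - (lam / l0) *: Phi' u = l0^-1 *: (Phi v - Phi w).
      by rewrite Pl0 wl scalerBr !scalerA mulVf // scale1r mulrC.
    rewrite normrZ normfV => h; rewrite ball_rVE.
    apply: (@le_lt_trans _ _ (C1 / `|l0| * (n%:R * K) * `|v - w|)).
      apply: (le_trans h).
      have -> : C1 / `|l0| * (n%:R * K) * `|v - w| = C1 * (`|l0|^-1 * (n%:R * K * `|v - w|)).
        by ring.
      by rewrite ler_wpM2l ?(ltW C10) // ler_wpM2l // invr_ge0.
    move: hw; rewrite ball_rVE => /ltW vw.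
    apply: (@le_lt_trans _ _ (C1 / `|l0| * (n%:R * K) * T)).
      by rewrite ler_wpM2l // !mulr_ge0 ?invr_ge0 // ltW.
    by rewrite ltr_pM2r // ltrDl.
  have Pu2 : `|Phi' u0| / 2 <= `|Phi' u|.
    have : `|Phi' u0| - `|Phi' u| <= `|Phi' u0 - Phi' u| by exact: lerB_dist.
    by move: Pu => /ltW; lra.
  have wK : `|Phi w| <= K by exact: (Kw [::]).
  rewrite ler_pdivlMr //; move: wK; rewrite wl normrZ.
  have : `|lam| * (`|Phi' u0| / 2) <= `|lam| * `|Phi' u| by rewrite ler_wpM2l.
  by lra.
pose L := 2 * K / `|Phi' u0|.
have L0 : 0 <= L by rewrite divr_ge0 ?mulr_ge0 ?(ltW K0) // ltW.
exists (L * (K' * D.+2%:R ^+ n * C2 ^+ D.+1)), (Num.min r4 (r / C2)); split.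
- apply: mulr_ge0 => //; rewrite mulr_ge0 ?exprn_ge0 ?(ltW C20) //.
  by rewrite mulr_ge0 ?exprn_ge0 // ltW.
- by rewrite lt_min r40 divr_gt0.
move=> T w /andP[T0]; rewrite lt_min => /andP[/ltW Tr4]; rewrite ltr_pdivlMr // => Tr hw.
have [u [lam [hu huT wl lamL]]] := key w T T0 Tr4 hw.
rewrite /pairing wl -scalemxAl mxE normrM -mulrA; apply: ler_pM => //.
have C2T : 0 < C2 * T by rewrite mulr_gt0.
have sub : ball u0 (C2 * T) `<=` ball u0 r3.
  by apply: subset_trans rr3; apply: le_ball; rewrite mulrC ltW.
have := @sorted_vanishing R n (pairing Phi' P) u0 (C2 * T) K' D.+1 C2T (ltW K'0).
have sm : smooth_on (ball u0 (C2 * T)) (pairing Phi' P).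
  by apply: smooth_onS (smooth_pairing P oV' Ps') => z /sub/hr3[].
move=> /(_ sm) H; rewrite -mulrA -exprMn; apply: H => //.
- by move=> s _ sD; rewrite (dpartials_pairing P s oV' Ps' Vu0) Pvan.
- by move=> s z sD /sub/hr3[_ _]; apply; rewrite sD.
Unshelve. all: by end_near.
Qed.

End Transfer.

(** * Limsup sets *)

Section Words.
Context {R : realType}.

Definition words k D : seq (seq 'I_k) :=
  flatten [seq [seq val t | t <- enum {: j.-tuple 'I_k}] | j <- iota 0 D.+1].

Lemma mem_words k D s : (s \in words k D) = (size s <= D)%N.
Proof.
apply/flattenP/idP => [[_ /mapP[j + ->] /mapP[t _ ->]]|sD].
  by rewrite mem_iota add0n ltnS size_tuple.
exists [seq val t | t <- enum {: (size s).-tuple 'I_k}].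
  by apply/mapP; exists (size s); rewrite // mem_iota add0n ltnS.
by apply/mapP; exists (in_tuple s) => //; rewrite mem_enum.
Qed.

Lemma ex_maximal_word k D (F : seq 'I_k -> R) :
  exists2 s, (size s <= D)%N & forall t, (size t <= D)%N -> F t <= F s.
Proof.
have w0 : (0 < size (words k D))%N.
  by have := mem_words D ([::] : seq 'I_k); case: (words k D).
have [i imax] := ex_maximum (Ordinal w0) (fun i => F (nth [::] (words k D) i)).
exists (nth [::] (words k D) i); first by rewrite -mem_words mem_nth.
move=> t; rewrite -mem_words => tD; have it := tD; rewrite -index_mem in it.
by rewrite -[t in leLHS](nth_index [::] tD); exact: (imax (Ordinal it)).
Qed.

End Words.

Section UniformNondegeneracy.
Context {R : realType} {n d : nat}.

(** Let [W x] have the derivatives of order at most [D] as rows. By nondegeneracy [W v0] has a left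
    inverse, which bounds [|P|] by the largest entry of [W v0 *m P] for all [P] at once; by
    continuity half of this lower bound survives near [v0]. *)
Lemma uniform_nondegenerate D V (Phi : 'rV[R]_n -> 'rV[R]_d.+1) v0 :
  smooth_on V Phi -> V v0 -> nondegenerate_at D Phi v0 ->
  exists2 c : R, 0 < c & \forall x \near v0, forall P : 'cV[R]_d.+1,
    exists2 s, (size s <= D)%N & c * `|P^T| <= `|pairing (dpartials s Phi) P x|.
Proof.
move=> Ps Vv0 nd; set ws := words n D.
pose W x : 'M[R]_(size ws, d.+1) := \matrix_i dpartials (nth [::] ws i) Phi x.
have WE x (P : 'cV[R]_d.+1) i : (W x *m P) i 0 = pairing (dpartials (nth [::] ws i) Phi) P x.
  by rewrite /pairing !mxE; apply: eq_bigr => j _; rewrite mxE.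
have rf : row_free (W v0)^T.
  apply: inj_row_free => a aW; apply: trmx_inj; rewrite trmx0; apply: nd => s sD.
  have sw : s \in ws by rewrite mem_words.
  have iw := sw; rewrite -index_mem in iw.
  rewrite -[s](nth_index [::] sw) -(WE v0 _ (Ordinal iw)).
  by rewrite -[W v0]trmxK -trmx_mul aW trmx0 mxE.
have [B /(congr1 trmx) BW] := row_freeP rf.
rewrite trmx_mul trmxK trmx1 in BW.
pose m : R := (size ws)%:R.
have m0 : 0 <= m by [].
pose b := `|B|.
have b0 : 0 <= b by exact: normr_ge0.
pose c := (2 * (m * b + 1))^-1.
have c0 : 0 < c by rewrite invr_gt0 mulr_gt0 // ltr_wpDl // mulr_ge0.
pose eta := c / d.+1%:R.
have eta0 : 0 < eta by rewrite divr_gt0.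
exists (c / 2); first by rewrite divr_gt0.
have : \forall x \near v0, forall i : 'I_(size ws),
    `|dpartials (nth [::] ws i) Phi v0 - dpartials (nth [::] ws i) Phi x| < eta / 2.
  apply: (@filter_forall _ 'I_(size ws) _ (nbhs v0)) => i.
  have := (Ps (nth [::] ws i) v0 Vv0).1; rewrite /prop_for /continuous_at.
  by move/cvgr_dist_lt; apply; rewrite divr_gt0.
apply: (@filterS _ (nbhs v0)) => x hx P.
have [P0|P0] := eqVneq P 0.
  by exists [::] => //; rewrite P0 trmx0 normr0 mulr0.
apply: contrapT => H.
have nP : 0 < `|P^T|.
  by rewrite normr_gt0; apply: contra P0 => /eqP h; apply/eqP/trmx_inj; rewrite h trmx0.
have Wx i : `|(W v0 *m P) i 0| <= c * `|P^T|.
  have h1 : `|(W x *m P) i 0| < c / 2 * `|P^T|.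
    rewrite WE ltNge; apply/negP => h; apply: H; exists (nth [::] ws i) => //.
    by rewrite -mem_words mem_nth.
  have h2 : `|((W v0 - W x) *m P) i 0| <= d.+1%:R * (eta / 2 * `|P^T|).
    rewrite mxE (le_trans (ler_norm_sum _ _ _)) // mulr_natl.
    have -> : eta / 2 * `|P^T| *+ d.+1 = \sum_(j < d.+1) eta / 2 * `|P^T|.
      by rewrite sumr_const card_ord.
    apply: ler_sum => j _; rewrite normrM; apply: ler_pM => //.
      have := coord_le_norm (dpartials (nth [::] ws i) Phi v0 -
        dpartials (nth [::] ws i) Phi x) j.
      by rewrite !mxE => /le_trans; apply; exact/ltW/hx.
    by have := coord_le_norm P^T j; rewrite mxE.
  have -> : W v0 *m P = W x *m P + (W v0 - W x) *m P by rewrite mulmxBl addrC subrK.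
  rewrite mxE (le_trans (ler_normD _ _)) //.
  have -> : c * `|P^T| = c / 2 * `|P^T| + d.+1%:R * (eta / 2 * `|P^T|).
    by rewrite /eta; field.
  by rewrite lerD // ltW.
have : `|P^T| <= m * b * (c * `|P^T|).
  apply: rV_norm_leP => [|j]; first by rewrite !mulr_ge0 // ltW.
  have -> : P^T 0 j = (B^T *m (W v0 *m P)) j 0 by rewrite mulmxA BW mul1mx mxE.
  rewrite mxE.
  apply: (le_trans (ler_norm_sum _ _ _)).
  have -> : m * b * (c * `|P^T|) = \sum_(i < size ws) b * (c * `|P^T|).
    by rewrite sumr_const card_ord -[RHS]mulr_natl mulrA.
  apply: ler_sum => i _; rewrite normrM; apply: ler_pM => //.
  by rewrite mxE; exact: mx_entry_le_norm.
have -> : m * b * (c * `|P^T|) = (m * b * c) * `|P^T| by ring.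
rewrite leNgt => /negP; apply; rewrite gtr_pMl //.
by rewrite /c ltr_pdivrMr ?mulr_gt0 // ?ltr_wpDl ?mulr_ge0 //; have := mulr_ge0 m0 b0; lra.
Qed.

End UniformNondegeneracy.

(** * The contribution of a single ball *)

Section BallEstimate.
Context {R : realType}.

(** Put [f = P . Phi] and let [A] be its largest scaled derivative of order at most [D + p] at [y].
    Then [A >= (4 * rho) ^ D * c * |P|], whereas the scaled derivatives of order [D + p + 1] are at
    most a multiple of [(4 * rho) ^ (D + p + 1) * |P|], hence [O(e * A)]. After division by [A * B]
    the jets are at most 1 and one of them at the centre is [1 / B], so [decay_smooth] applies.
    Points of [X] are within [e * rho] of a zero of [f], so the normalized values there are
    [O(e)]. *)
Lemma ball_estimate n d D p (m : {outer_measure set 'rV[R]_n -> \bar R}) S tau (K c : R) :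
  (0 < n)%N -> gauge m S tau -> 0 < K -> 0 < c ->
  exists C gam eta : R, [/\ 0 < C, 0 < gam, 0 < eta &
  forall (Phi : 'rV[R]_n -> 'rV[R]_d.+1) y (rho e : R) (P : 'cV[R]_d.+1) X,
  S y -> 0 < rho <= 1 / 4 -> smooth_on (ball y (4 * rho)) Phi ->
  (forall s z, (size s <= (D + p).+1)%N -> ball y (4 * rho) z -> `|dpartials s Phi z| <= K) ->
  P != 0 ->
  (exists2 s, (size s <= D)%N & c * `|P^T| <= `|pairing (dpartials s Phi) P y|) ->
  0 < e <= eta -> (4 * rho) ^+ p.+1 <= e ->
  (forall x, X x -> [/\ S x, ball y (2 * rho) x & exists z, [/\ ball y (2 * rho) z,
     pairing Phi P z = 0 & `|z - x| <= e * rho] ]) ->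
  (m X <= (C * e `^ gam)%:E * tau y (2 * rho)%R)%E].
Proof.
move=> n0 G K0 c0.
pose B : R := (1 + n%:R) ^+ (D + p).+1.
have B1 : 1 <= B by rewrite exprn_ege1 // lerDl.
have B0 : 0 < B by rewrite (lt_le_trans ltr01).
have Bi0 : 0 < B^-1 by rewrite invr_gt0.
have [C [gam [C0 gam0 H]]] := decay_smooth (D + p) n0 G Bi0.
pose K2 := d.+1%:R * K / c.
have K20 : 0 < K2 by rewrite divr_gt0 // mulr_gt0.
(* [E * e] bounds both the normalized derivatives of top order and the normalized values on [X]. *)
pose E := K2 + n%:R + 1.
have E0 : 0 < E by rewrite ltr_wpDl // addr_ge0 // ltW.
exists (C * E `^ gam), gam, E^-1; split => //.
- by rewrite mulr_gt0 // powR_gt0.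
- by rewrite invr_gt0.
move=> Phi y rho e P X Sy /andP[r0 r1] Ps PK P0 [s0 s0D hs0] /andP[e0 eE] re HX.
pose f := pairing Phi P.
have r4 : 0 < 4 * rho by rewrite mulr_gt0.
have r41 : 4 * rho <= 1 by lra.
have oB : open (ball y (4 * rho)) by exact: ball_open.
have fs : smooth_on (ball y (4 * rho)) f by exact: smooth_pairing.
have nP : 0 < `|P^T|.
  by rewrite normr_gt0; apply: contra P0 => /eqP h; apply/eqP/trmx_inj; rewrite h trmx0.
have [s1 s1D s1max] := ex_maximal_word (D + p)
  (fun s => (4 * rho) ^+ size s * `|dpartials s f y|).
pose A := (4 * rho) ^+ size s1 * `|dpartials s1 f y|; rewrite -/A in s1max.
have AE : A = (4 * rho) ^+ size s1 * `|dpartials s1 f y| by [].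
clearbody A.
have yy : ball y (4 * rho) y by exact: ballxx.
have AP : (4 * rho) ^+ D * (c * `|P^T|) <= A.
  apply: le_trans (s1max s0 _); last by rewrite (leq_trans s0D) // leq_addr.
  rewrite (dpartials_pairing P s0 oB Ps yy); apply: ler_pM => //.
  - by rewrite exprn_ge0 // ltW.
  - by rewrite mulr_ge0 // ltW.
  - by apply: ler_wiXn2l => //; exact: ltW.
have A0 : 0 < A by apply: lt_le_trans AP; rewrite !mulr_gt0 // exprn_gt0.
have top s z : size s = (D + p).+1 -> ball y (4 * rho) z ->
    (4 * rho) ^+ size s * `|dpartials s f z| <= K2 * e * A.
  move=> sD hz; rewrite (dpartials_pairing P s oB Ps hz).
  have h1 : `|pairing (dpartials s Phi) P z| <= d.+1%:R * (K * `|P^T|).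
    apply: mulmx_entry_le => [i j|i j].
      by rewrite ord1 (le_trans (coord_le_norm _ _)) // PK // sD.
    by rewrite ord1; have := coord_le_norm P^T i; rewrite mxE.
  apply: (le_trans (ler_wpM2l _ h1)); first by rewrite exprn_ge0 // ltW.
  rewrite sD -addnS exprD.
  have -> : (4 * rho) ^+ D * (4 * rho) ^+ p.+1 * (d.+1%:R * (K * `|P^T|)) =
     K2 * (4 * rho) ^+ p.+1 * ((4 * rho) ^+ D * (c * `|P^T|)).
    by rewrite /K2; field; rewrite gt_eqF.
  apply: ler_pM => //.
  - by rewrite mulr_ge0 ?exprn_ge0 ?(ltW K20) // ltW.
  - by rewrite !mulr_ge0 ?exprn_ge0 ?(ltW c0) // ltW.
  - by rewrite ler_wpM2l // ltW.
have Ee1 : E * e <= 1 by rewrite -ler_pdivlMl // mulr1.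
have K2e : K2 * e <= E * e.
  by rewrite ler_wpM2r ?(ltW e0) // /E -addrA lerDl addr_ge0.
have jets s z : (size s <= (D + p).+1)%N -> ball y (4 * rho) z ->
    1 * (4 * rho) ^+ size s * `|dpartials s f z| <= A * (1 + n%:R) ^+ ((D + p).+1 - size s).
  move=> sD hz; apply: (@jet_bound R n f y (4 * rho) 1 A 0 (D + p)) => //.
  - exact: ltW.
  - by move=> s' s'D; rewrite mul1r; exact: s1max.
  - move=> s' z' s'D hz'; rewrite mul1r; apply: (le_trans (top s' z' s'D hz')).
    by rewrite ler_piMl ?(ltW A0) // (le_trans K2e).
pose w := (A * B)^-1.
have AB0 : 0 < A * B by rewrite mulr_gt0.
have w0 : 0 < w by rewrite invr_gt0.
have r22 : 2 * (2 * rho) = 4 * rho by ring.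
have wjets s z : (size s <= (D + p).+1)%N -> ball y (4 * rho) z ->
    w * (4 * rho) ^+ size s * `|dpartials s f z| <= 1.
  move=> sD hz; rewrite /w -mulrA mulrC ler_pdivrMr // mul1r.
  have := jets s z sD hz; rewrite mul1r => /le_trans; apply.
  rewrite ler_wpM2l ?(ltW A0) // /B ler_weXn2l ?lerDl //; exact: leq_subr.
have ep01 : 0 < E * e <= 1 by rewrite mulr_gt0.
have hr : 0 < 2 * rho <= 1 / 2 by apply/andP; split; lra.
have {}H := H f y (2 * rho) w (E * e) Sy hr w0 ep01.
have jb : jet_bounded f y (2 * rho) w (E * e) (D + p).
  rewrite /jet_bounded r22; split => // s z sD hz.
  rewrite /w -mulrA mulrC ler_pdivrMr //; apply: (le_trans (top s z sD hz)).
  rewrite mulrA; apply: (@le_trans _ _ (E * e * A)).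
    by apply: ler_wpM2r => //; exact: ltW.
  by rewrite ler_peMr // !mulr_ge0 // ltW.
have {}H := H jb.
have lj : large_jet B^-1 (D + p) f y (2 * rho) w.
  exists s1 => //; rewrite r22 -mulrA -AE /w invfM mulrAC mulVf ?mul1r // gt_eqF //.
have {}H := H lj.
apply: (@le_trans _ _ ((C * (E * e) `^ gam)%:E * tau y (2 * rho)%R)%E); last first.
  by rewrite powRM ?(ltW E0) ?(ltW e0) // mulrA.
apply: le_trans H; apply: le_outer_measure => x /HX[Sx hx [z [hz fz xz]]].
split; first by split.
rewrite /= -[f x]subr0 -fz.
have r24 : 2 * rho <= 4 * rho by rewrite ler_pM2r // ler_nat.
have M : `|f x - f z| <= n%:R * (w * (4 * rho))^-1 * `|x - z|.
  apply: (mvt_ball (le_ball r24 hx) (le_ball r24 hz)) => [u i hu|u i hu].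
    exact: (smooth_derivable [::] i fs hu).
  rewrite -[leRHS]mul1r ler_pdivlMr ?mulr_gt0 // mulrC.
  by have := wjets [:: i] u isT hu; rewrite expr1.
apply: (@le_trans _ _ (w * (n%:R * (w * (4 * rho))^-1 * (e * rho)))).
  rewrite ler_pM2l //; apply: (le_trans M); rewrite distrC ler_wpM2l //.
  by rewrite mulr_ge0 // invr_ge0 mulr_ge0 // ltW.
have -> : w * (n%:R * (w * (4 * rho))^-1 * (e * rho)) = n%:R * e / 4.
  by field; rewrite !gt_eqF.
have : 0 <= n%:R * e by rewrite mulr_ge0 // ltW.
have : 0 <= K2 * e by rewrite mulr_ge0 // ltW.
rewrite /E !mulrDl mul1r; lra.
Qed.

End BallEstimate.

Section BorelCantelli.
Context {R : realType}.

Lemma geometric_small (x A B : R) : 0 < x < 1 -> 0 < B ->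
  exists J, forall j, (J <= j)%N -> A * x ^+ j < B.
Proof.
move=> /andP[x0 x1] B0.
have := @cvg_geometric R A x; rewrite ger0_norm ?(ltW x0) // => /(_ x1).
move=> /cvgr0_norm_lt /(_ B B0) [J _ HJ]; exists J => j Jj.
by apply: le_lt_trans (HJ j Jj); exact: ler_norm.
Qed.

Lemma borel_cantelli (T : Type) (m : {outer_measure set T -> \bar R})
    (E : nat -> set T) (A x : R) J : 0 <= A -> 0 < x < 1 ->
  (forall j, (J <= j)%N -> (m (E j) <= (A * x ^+ j)%:E)%E) ->
  m (\bigcap_N \bigcup_(j in [set j | (N <= j)%N]) E j) = 0%E.
Proof.
move=> A0 hx EA; have [x0 x1] := andP hx.
have sub1 : 0 < 1 - x by rewrite subr_gt0.
apply/eqP; rewrite eq_le outer_measure_ge0 andbT; apply/lee_addgt0Pr => e e0.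
have [J' HJ'] := geometric_small (A / (1 - x)) hx e0.
pose N := maxn J J'.
have JN : (J <= N)%N by exact: leq_maxl.
rewrite add0e; apply: (@le_trans _ _ (m (\bigcup_i E (N + i)%N))).
  apply: le_outer_measure => z /(_ N I) [j /= Nj Ej].
  by exists (j - N)%N => //; rewrite subnKC.
apply: (le_trans (outer_measure_sigma_subadditive m _)).
apply: lime_le; first by apply: is_cvg_nneseries => i _ _; exact: outer_measure_ge0.
near=> k; apply: (@le_trans _ _ (\sum_(0 <= i < k) (A * x ^+ (N + i))%:E)%E).
  by apply: lee_sum => i _; apply: EA; rewrite (leq_trans JN) // leq_addr.
rewrite sumEFin lee_fin.
have -> : \sum_(0 <= i < k) A * x ^+ (N + i) = A / (1 - x) * x ^+ N * (1 - x ^+ k).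
  elim: (k) => [|k' IH]; first by rewrite big_geq // subrr mulr0.
  rewrite big_nat_recr //= IH exprD exprS; field.
  by rewrite gt_eqF.
apply: (@le_trans _ _ (A / (1 - x) * x ^+ N)).
  rewrite ler_piMr ?mulr_ge0 ?invr_ge0 ?exprn_ge0 ?(ltW x0) ?(ltW sub1) //.
  by rewrite lerBlDr lerDl exprn_ge0 // ltW.
by apply/ltW/HJ'; exact: leq_maxr.
Unshelve. all: by end_near.
Qed.

Lemma powR_expr (x a : R) j : 0 <= x -> (x ^+ j) `^ a = (x `^ a) ^+ j.
Proof. by move=> x0; rewrite -powR_mulrn // powRAC powR_mulrn // powR_ge0. Qed.

Lemma powR2_lt1 (a : R) : a < 0 -> 0 < 2 `^ a < 1.
Proof.
move=> a0; rewrite powR_gt0 //= -[a]opprK powRN invf_lt1 ?powR_gt0 //.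
have a1 : 0 < - a by rewrite oppr_gt0.
have e1 : (1 : R) `^ (- a) = 1 by rewrite powR1.
by rewrite -{1}e1; apply: gt0_ltr_powR => //; rewrite ?nnegrE // ltr1n.
Qed.

End BorelCantelli.

(** * Nullity of limsup sets near a nondegenerate point *)

Section Core.
Context {R : realType} {n d : nat}.

(** Distance is expressed through the entries of [veronese], and the strict inequality makes the set
    open, so that [limsup_near] is Borel. *)
Definition rational_near (M : set (proj_space R d)) (C c : R) (j : nat) :
  set (proj_space R d) := [set P | exists r, [/\ rational_point r, M r,
    2 ^+ j <= Hstd r < 2 ^+ j.+1 &
    forall a b, `|veronese (rep r) a b - veronese (rep P) a b| < C * (2 `^ (- c)) ^+ j] ].

Definition limsup_near (M : set (proj_space R d)) (C c : R) : set (proj_space R d) :=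
  \bigcap_N \bigcup_(j in [set j | (N <= j)%N]) rational_near M C c j.

Lemma c_kd_gt0 k d' : (1 <= k)%N -> 0 < c_kd R k d'.
Proof.
move=> k0; rewrite divr_gt0 // ltr0n /N_kd !addn_gt0; by case: k k0.
Qed.

Lemma powR_c_kd k d' : (1 <= k)%N ->
  (2 `^ (- c_kd R k d')) ^+ N_kd k d' = 2 ^- d'.+1 :> R.
Proof.
move=> k0; rewrite -powR_mulrn ?powR_ge0 // -powRrM.
have N0 : (N_kd k d')%:R != 0 :> R.
  by rewrite pnatr_eq0 -lt0n /N_kd !addn_gt0; case: k k0.
by rewrite /c_kd mulNr divfK // powRN powR_mulrn.
Qed.

(* At height about [2 ^ j] we work on balls of radius [ka * al ^ j] with
   [al = 2 ^ - c_kd]: this is the scale at which [al ^ N_kd = 2 ^ - d.+1] balances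
   the two factors in the simplex lemma, and the excess of [c] over [c_kd] is what
   makes the slabs thin relative to the balls, by the factor [be ^ j]. *)
Theorem limsup_near_null (m : {outer_measure set 'rV[R]_n.+1 -> \bar R}) S tau
    M V Phi v0 D (c C : R) : (n.+1 <= d)%N -> gauge m S tau ->
  open_chart M V Phi v0 -> nondegenerate_at D Phi v0 -> S v0 ->
  c_kd R n.+1 d < c -> 0 < C ->
  exists2 r : R, 0 < r &
    m (S `&` ball v0 r `&` [set x | limsup_near M C c (proj_pt (Phi x))]) = 0%E.
Proof.
move=> nd G ch ndeg Sv0 cc C0; have [[oV Ps Vv0 Pn0] [fr HO]] := ch.
set N := N_kd n.+1 d; set c0 := c_kd R n.+1 d in cc.
have c00 : 0 < c0 by exact: c_kd_gt0.
pose al : R := 2 `^ (- c0); pose be : R := 2 `^ (- (c - c0)).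
have hal : 0 < al < 1 by apply: powR2_lt1; rewrite oppr_lt0.
have hbe : 0 < be < 1 by apply: powR2_lt1; rewrite oppr_lt0 subr_gt0.
have [al0 al1] := andP hal; have [be0 be1] := andP hbe.
have albe : 2 `^ (- c) = al * be.
  by rewrite /al /be -powRD ?pnatr_eq0 ?implybT //; congr (_ `^ _); ring.
have alN : al ^+ N = 2 ^- d.+1 by exact: powR_c_kd.
(* With [al ^ p <= be] the Taylor remainder at scale [rho], of relative size [rho ^ (p + 1)], is
   [O(be ^ j)]. *)
pose p := (Num.truncn ((c - c0) / c0)).+1.
have alp : al ^+ p <= be.
  rewrite -powR_mulrn ?(ltW al0) // -powRrM; apply: ler_powR; first by rewrite ler1n.
  rewrite mulNr lerN2 mulrC -ler_pdivrMr //.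
  by rewrite ltW // truncnS_gt.
have [L simpL] := @simplex R n d nd.
pose Lm := maxn L (D + p).+1.
have [K K0 PK] := smooth_near_bounded Lm Ps Vv0.
have nP : 0 < `|Phi v0| by rewrite normr_gt0 Pn0.
pose cP := `|Phi v0| / 2.
have cP0 : 0 < cP by rewrite divr_gt0.
have [C2 C20 simp] := simpL K cP (ltW K0) cP0.
have [c1 c10 und] := uniform_nondegenerate Ps Vv0 ndeg.
have Pc := chart_continuous ch Vv0.
have : \forall x \near v0, V x /\ cP <= `|Phi x| /\
    (forall s, (size s <= Lm)%N -> `|dpartials s Phi x| <= K) /\
    forall P : 'cV[R]_d.+1,
    exists2 s, (size s <= D)%N & c1 * `|P^T| <= `|pairing (dpartials s Phi) P x|.
  near=> x; split; first by near: x; exact: open_nbhs_nbhs.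
  split; last by split; near: x.
  have : `|Phi v0 - Phi x| < cP by near: x; move/cvgr_dist_lt : Pc; exact.
  have : `|Phi v0| - `|Phi x| <= `|Phi v0 - Phi x| by exact: lerB_dist.
  by rewrite /cP; lra.
move=> /nbhs_ballP[R1 /= R10 HR1].
have [C3 [delta [r1 [C30 delta0 r10 r1V inv]]]] := local_inverse ch R10.
have [r2 r20 fin] := gauge_fin G Sv0.
have [Cp Cp0 pack] := gauge_packing G.
have [Cb [gam [eta [Cb0 gam0 eta0 be_]]]] :=
  @ball_estimate R n.+1 d D p m S tau K c1 (ltn0Sn n) G K0 c10.
pose r0 := Num.min (Num.min (R1 / 2) r1) (Num.min r2 (1 / 2)).
have r00 : 0 < r0 by rewrite !lt_min r10 r20 !divr_gt0.
have r0R : r0 <= R1 / 2 by rewrite !ge_min lexx.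
have r0r1 : r0 <= r1 by rewrite !ge_min lexx !orbT.
have r0r2 : r0 <= r2 by rewrite !ge_min lexx !orbT.
have r0h : r0 <= 1 / 2 by rewrite !ge_min lexx !orbT.
(* The simplex lemma is applied with height [2 ^ (j + 1)] and radius [2 * rho]. Since [2 * ka <= 1],
   its smallness condition follows from [2 * ka * (C2 * 2 ^ (d + 1)) < 1]. *)
pose ka : R := (2 * (1 + C2 * 2 ^+ d.+1))^-1.
have Q0 : 0 < 1 + C2 * 2 ^+ d.+1 by rewrite addr_gt0 // mulr_gt0 // exprn_gt0.
have ka0 : 0 < ka by rewrite invr_gt0 mulr_gt0.
(* The first term bounds the distance from [x] to the parameter of the rational point in units of
   [rho], the second the Taylor remainder; both come with a factor [be ^ j]. *)
pose E1 := C3 * C / ka + (4 * ka) ^+ p.+1.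
have E10 : 0 < E1.
  apply: addr_gt0; first by apply: divr_gt0 => //; exact: mulr_gt0.
  by rewrite exprn_gt0 // mulr_gt0.
(* Beyond the thresholds [J1] to [J4], respectively, the level is at most [eta], the balls fit into
   the chart, [local_inverse] applies, and [z] is within [rho] of [x]. *)
have [J1 HJ1] := geometric_small E1 hbe eta0.
have [J2 HJ2] : exists J, forall j, (J <= j)%N -> ka * al ^+ j < Num.min (1 / 4) (Num.min (R1 / 8) r0).
  apply: geometric_small => //; rewrite lt_min divr_gt0 //= lt_min r00 andbT.
  by rewrite divr_gt0.
have hab : 0 < (2 : R) `^ (- c) < 1.
  by apply: powR2_lt1; rewrite oppr_lt0; exact: lt_trans c00 cc.
have [J3 HJ3] := geometric_small C hab delta0.
have [J4 HJ4] := geometric_small (C3 * C) hbe ka0.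
exists r0 => //.
pose E j := S `&` ball v0 r0 `&` [set x | rational_near M C c j (proj_pt (Phi x))].
have tfin : tau v0 r0 \is a fin_num.
  by rewrite ge0_fin_numE ?(gauge_ge0 G) // fin // r00.
pose A := Cb * E1 `^ gam * Cp * fine (tau v0 r0).
have A0 : 0 <= A.
  by rewrite !mulr_ge0 ?powR_ge0 ?(ltW Cb0) ?(ltW Cp0) // fine_ge0 // (gauge_ge0 G).
have th : 0 < be `^ gam < 1.
  rewrite powR_gt0 //= /be -powRrM.
  have /andP[] : 0 < (2 : R) `^ (- (c - c0) * gam) < 1; last by [].
  by apply: powR2_lt1; rewrite mulNr oppr_lt0 mulr_gt0 // subr_gt0.
apply: (@outer_nullS R _ m _ (\bigcap_N \bigcup_(j in [set j | (N <= j)%N]) E j)).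
  by move=> x [hx lx] K' _; have [j Kj hj] := lx K' I; exists j.
apply: (@borel_cantelli R _ m E A (be `^ gam) (maxn (maxn J1 J2) (maxn J3 J4))) => // j.
rewrite !geq_max => /andP[/andP[/HJ1 j1 /HJ2 j2] /andP[/HJ3 j3 /HJ4 j4]].
pose rho := ka * al ^+ j.
have alj : 0 < al ^+ j by rewrite exprn_gt0.
have bej : 0 < be ^+ j by rewrite exprn_gt0.
have rho0 : 0 < rho by rewrite mulr_gt0.
move: j2; rewrite -/rho lt_min => /andP[rho4]; rewrite lt_min => /andP[rhoR rhor0].
pose e := E1 * be ^+ j.
have e0 : 0 < e by rewrite mulr_gt0.
have Ev : E j `<=` ball v0 r0 by move=> x [[]].
have [ys [ysE sep ysc]] := max_separated rho0 Ev.
apply: (@le_trans _ _ (\sum_(y <- ys) (Cb * e `^ gam)%:E * tau y (2 * rho)%R)%E); last first.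
  rewrite -ge0_sume_distrr; last by move=> y _; exact: (gauge_ge0 G).
  have hb : (\sum_(y <- ys) tau y (2 * rho)%R <= Cp%:E * tau v0 r0)%E.
    have yv y : y \in ys -> S y /\ ball v0 r0 y by move=> /ysE[[Sy hy] _].
    exact: (pack v0 rho r0 ys Sv0 rho0 (ltW rhor0) r0h yv sep).
  apply: (@le_trans _ _ ((Cb * e `^ gam)%:E * (Cp%:E * tau v0 r0))%E).
    by apply: lee_wpmul2l => //; rewrite lee_fin mulr_ge0 ?powR_ge0 // ltW.
  rewrite -(fineK tfin) -!EFinM lee_fin /A /e powRM ?(ltW E10) ?(ltW bej) //.
  by rewrite powR_expr ?(ltW be0) // le_eqVlt; apply/orP; left; apply/eqP; ring.
apply: (@le_trans _ _ (\sum_(y <- ys) m (E j `&` ball y rho))%E).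
  by apply: outer_measure_seq => x Ex; have [y yys hy] := ysc x Ex; exists y.
rewrite big_seq [leRHS]big_seq; apply: lee_sum => y /ysE[[Sy hy] _].
have yR : ball y (4 * rho) `<=` ball v0 R1.
  move=> z hz; have -> : R1 = R1 / 2 + R1 / 2 by field.
  by apply: ball_triangle (le_ball r0R hy) _; apply: le_ball hz; lra.
have sm4 : smooth_on (ball y (4 * rho)) Phi.
  by apply: smooth_onS Ps => z /yR/HR1[].
have y2 : ball y (2 * rho) `<=` ball y (4 * rho).
  by apply: le_ball; rewrite ler_pM2r // ler_nat.
have [P P0 HP] : exists2 P : 'cV[R]_d.+1, P != 0 & forall z, ball y (2 * rho) z ->
    rational_point (proj_pt (Phi z)) -> Hstd (proj_pt (Phi z)) <= 2 ^+ j.+1 ->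
    (Phi z *m P) 0 0 = 0.
  apply: (simp Phi y (2 * rho) (2 ^+ j.+1)).
  - by rewrite mulr_gt0 //=; lra.
  - by rewrite exprn_ge0.
  - exact: smooth_onS sm4.
  - move=> s z sL /y2/yR/HR1[_ [_ [h _]]]; apply: h.
    by rewrite (leq_trans sL) // leq_maxl.
  - by move=> z /y2/yR/HR1[_ [h _]].
  have -> : C2 * (2 ^+ j.+1) ^+ d.+1 * (2 * rho) ^+ N = (2 * ka) ^+ N * (C2 * 2 ^+ d.+1).
    have pw : (2 ^+ j) ^+ d.+1 * (al ^+ j) ^+ N = 1 :> R.
      by rewrite !(exprAC _ j) -exprMn alN divff ?expr1n // expf_neq0.
    have regroup (u v : R) : C2 * (2 * u) ^+ d.+1 * (2 * (ka * v)) ^+ N =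
        (2 * ka) ^+ N * (C2 * 2 ^+ d.+1) * (u ^+ d.+1 * v ^+ N).
      rewrite (exprMn _ 2 u) (mulrA 2) (exprMn _ _ v); ring.
    by rewrite (exprS 2 j) /rho regroup pw mulr1.
  have k2 : 2 * ka = (1 + C2 * 2 ^+ d.+1)^-1 by rewrite /ka; field; rewrite gt_eqF.
  have N0 : (0 < N)%N by rewrite /N /N_kd !addn_gt0.
  have C2p : 0 <= C2 * 2 ^+ d.+1 by rewrite mulr_ge0 ?exprn_ge0 // ltW.
  apply: (@le_lt_trans _ _ ((2 * ka) * (C2 * 2 ^+ d.+1))).
    rewrite ler_wpM2r // -[leRHS]expr1; apply: ler_wiXn2l => //.
      by rewrite mulr_ge0 // ltW.
    by rewrite k2 invf_le1 // lerDl.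
  by rewrite k2 mulrC ltr_pdivrMr // mul1r ltrDr.
apply: (be_ Phi y rho e P) => //.
- by rewrite rho0 ltW.
- move=> s z sD /yR/HR1[_ [_ [h _]]]; apply: h.
  by rewrite (leq_trans sD) // leq_maxr.
- by have [_ [_ [_]]] := HR1 y (yR y (ballxx _ (mulr_gt0 (ltr0n _ 4) rho0))); apply.
- by rewrite e0 ltW.
- have -> : (4 * rho) ^+ p.+1 = (4 * ka) ^+ p.+1 * (al ^+ j) ^+ p.+1.
    by rewrite /rho mulrA exprMn.
  rewrite /e /E1 [leRHS]mulrDl.
  apply: (@le_trans _ _ ((4 * ka) ^+ p.+1 * be ^+ j)); last first.
    rewrite lerDr; apply: mulr_ge0; last exact: ltW.
    by apply: divr_ge0; [exact/ltW/mulr_gt0 | exact: ltW].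
  rewrite ler_wpM2l ?exprn_ge0 ?mulr_ge0 ?(ltW ka0) //.
  rewrite exprS (exprAC _ j) ; apply: (@le_trans _ _ (1 * be ^+ j)); last by rewrite mul1r.
  apply: ler_pM.
  + exact: ltW.
  + by rewrite !exprn_ge0 // ltW.
  + by rewrite exprn_ile1 // ltW.
  + by rewrite lerXn2r ?nnegrE ?exprn_ge0 ?(ltW al0) ?(ltW be0).
- move=> x [[[Sx hx] [r [rr Mr /andP[Hr1 Hr2] hr]]] hxy].
  have Vx : V x by apply: r1V; apply: le_ball hx.
  have hr' a b : `|veronese (rep r) a b - veronese (Phi x) a b| <= C * (2 `^ (- c)) ^+ j.
    by rewrite -[in leLHS](veronese_proj _ _ (Pn0 x Vx)); exact/ltW/hr.
  have [z [hz Vz rz zx]] := inv x r _ (le_ball r0r1 hx) Mr j3 hr'.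
  have zx2 : `|z - x| <= C3 * C * be ^+ j * al ^+ j.
    apply: (le_trans zx); rewrite albe exprMn le_eqVlt; apply/orP; left; apply/eqP; ring.
  have zxrho : `|z - x| <= rho.
    by apply: (le_trans zx2); rewrite /rho ler_wpM2r // ltW.
  (* [z] is within [rho] of [x], and [x] within [rho] of [y]; this is why the hyperplane is taken
     for the ball of radius [2 * rho]. *)
  have hz2 : ball y (2 * rho) z.
    rewrite mulr_natl mulr2n; move: hxy; rewrite !ball_rVE => hxy.
    rewrite -(subrKA x) (le_lt_trans (ler_normD _ _)) // ltr_leD // distrC //.
  split => //; first by apply: le_ball hxy; lra.
  exists z; split => //.
    by rewrite /pairing HP // -?rz // ltW.
  apply: (le_trans zx2).
  rewrite /e /rho /E1 mulrDl mulrDl.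
  have -> : C3 * C / ka * be ^+ j * (ka * al ^+ j) = C3 * C * be ^+ j * al ^+ j.
    by field; rewrite gt_eqF.
  rewrite lerDl; apply: mulr_ge0; apply: mulr_ge0; last exact: ltW.
  - by apply: exprn_ge0; exact/ltW/mulr_gt0.
  - exact: ltW.
  - exact: ltW.
Unshelve. all: by end_near.
Qed.

End Core.

(** * Very well approximable points *)

Section VeryWellApproximable.
Context {R : realType} {d : nat}.
Implicit Types (M : set (proj_space R d)) (P : proj_space R d).

Lemma rational_near_open M (C c : R) j : Defs.proj_open (rational_near M C c j).
Proof.
rewrite /Defs.proj_open openE => x [x0 [r [rr Mr hr near_r]]].
have cx : {for x, continuous (id : 'rV[R]_d.+1 -> 'rV[R]_d.+1)} by exact: cvg_id.
have H a b : \forall y \near x, `|veronese (rep r) a b - veronese y a b| < C * (2 `^ (- c)) ^+ j.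
  have := near_r a b; rewrite veronese_proj // -subr_gt0 => e0.
  have := near_veronese cx x0 e0; apply: filterS => y /(_ a b) h.
  have := ler_distD (veronese x a b) (veronese (rep r) a b) (veronese y a b).
  by move: h; lra.
have {}H : \forall y \near x, forall a b,
    `|veronese (rep r) a b - veronese y a b| < C * (2 `^ (- c)) ^+ j.
  apply: (@filter_forall _ 'I_d.+1 _ (nbhs x)) => a.
  by apply: (@filter_forall _ 'I_d.+1 _ (nbhs x)) => b; exact: H.
have y0 : \forall y \near x, y != 0.
  exact: (@cvgr_neq0 _ _ _ (nbhs x) _ id x cx x0).
near=> y; have yn : y != 0 by near: y.
split => //; exists r; split => // a b; rewrite veronese_proj //.
by move: a b; near: y; exact: H.
Unshelve. all: by end_near.
Qed.

Lemma limsup_near_measurable M (C c : R) :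
  measurable (limsup_near M C c : set (borelP R d)).
Proof.
apply: bigcap_measurable => // N _; apply: bigcup_measurable => j _.
by apply: sub_sigma_algebra; exact: rational_near_open.
Qed.

Lemma dyadic_range (x : R) : 1 <= x -> exists j, 2 ^+ j <= x < 2 ^+ j.+1.
Proof.
move=> x1; have x0 : 0 <= x by lra.
have /andP[t1 t2] := truncn_itv x0.
have t0 : (0 < Num.truncn x)%N by rewrite trunc_gt0.
exists (trunc_log 2 (Num.truncn x)); apply/andP; split.
  by apply: le_trans t1; rewrite -natrX ler_nat trunc_logP.
by apply: lt_le_trans t2 _; rewrite -natrX ler_nat trunc_log_ltn.
Qed.

(** The exponents [c(k,d) + 1 / (j + 1)] make the union countable. There are finitely many rational
    points of bounded height, so infinitely many approximants force arbitrarily large dyadic ranges.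
    Passing from [C] to [C + 1] makes the inequality strict. *)
Lemma VWA_limsup_near k (g : riemannian_metric R d) M (C : R) : (1 <= k)%N -> 0 < C ->
  (forall P Q a b, (`|veronese (rep P) a b - veronese (rep Q) a b|%:E
    <= C%:E * riem_dist g P Q)%E) ->
  VWA k g M `<=` \bigcup_j limsup_near M (C + 1) (c_kd R k d + j.+1%:R^-1).
Proof.
move=> k1 C0 lip P [c /= cc [MP inf]].
have cc0 : 0 < c - c_kd R k d by rewrite subr_gt0.
pose i := Num.truncn (c - c_kd R k d)^-1.
have hi : i.+1%:R^-1 <= c - c_kd R k d.
  rewrite -[leRHS]invrK lef_pV2 ?posrE ?invr_gt0 //.
  by rewrite ltW // truncnS_gt.
exists i => //; set c' := c_kd R k d + _.
have c'0 : 0 < c' by rewrite addr_gt0 ?c_kd_gt0 // invr_gt0.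
have c'c : c' <= c by rewrite /c' -lerBrDl.
move=> N _.
have [r [[rr Mr rP] hN]] : exists r, [/\ rational_point r, M r &
    (riem_dist g r P <= (psi_ c (Hstd r))%:E)%E] /\ 2 ^+ N <= Hstd r.
  apply: contrapT => none; apply: inf.
  apply: sub_finite_set (@finite_height R d (2 ^+ N)) => r [rr Mr rP].
  split => //; rewrite leNgt; apply/negP => /ltW h; apply: none.
  by exists r.
have H1 := Hstd_ge1 rr.
have [j /andP[j1 j2]] := dyadic_range H1.
exists j => /=.
  rewrite -ltnS -(ltr_eXn2l (x := 2 : R)) ?ltr1n //; exact: le_lt_trans j2.
exists r; split => //; first by rewrite j1.
move=> a b; rewrite -lte_fin; apply: le_lt_trans (lip r P a b) _.
apply: (@le_lt_trans _ _ (C%:E * (psi_ c (Hstd r))%:E)%E).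
  by apply: lee_wpmul2l => //; rewrite lee_fin ltW.
rewrite -EFinM lte_fin.
have q0 : 0 < (2 : R) `^ (- c') ^+ j by rewrite exprn_gt0 // powR_gt0.
apply: (@le_lt_trans _ _ (C * (2 `^ (- c')) ^+ j)); last by rewrite ltr_pM2r // ltrDl.
rewrite ler_wpM2l ?(ltW C0) // /psi_ -powR_expr //.
apply: (@le_trans _ _ (Hstd r `^ (- c'))).
  by rewrite ler_powR // lerN2.
rewrite !powRN lef_pV2 ?posrE ?powR_gt0 ?(lt_le_trans ltr01 H1) ?exprn_gt0 //.
apply: ge0_ler_powR => //; rewrite ?nnegrE ?exprn_ge0 ?(ltW c'0) //.
exact: le_trans ler01 H1.
Qed.

End VeryWellApproximable.

(** * The assertion for push-forwards of absolutely friendly measures *)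

Section PushForward.
Context {R : realType} {n d : nat}.
Variables (U : set 'rV[R]_n.+1) (Psi : 'rV[R]_n.+1 -> proj_space R d).
Variable M : set (proj_space R d).
Hypothesis hPsi : local_param M U Psi.

Lemma local_param_preimage_open (O : set (proj_space R d)) :
  Defs.proj_open O -> open (U `&` Psi @^-1` O).
Proof.
move=> oO; rewrite openE => u [Uu Ou].
have [V [Phi [ch VU PsiE]]] := open_chart_of_local_param hPsi Uu.
have [[oV _ Vu Pn0] _] := ch.
have cu := chart_continuous ch Vu.
have nO : nbhs (Phi u) [set x : 'rV[R]_d.+1 | x != 0 /\ O (proj_pt x)].
  by apply: open_nbhs_nbhs; split => //; split; [exact: Pn0|rewrite -PsiE].
have h : \forall x \near u, Phi x != 0 /\ O (proj_pt (Phi x)) := cu _ nO.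
near=> x.
have Vx : V x by near: x; exact: open_nbhs_nbhs.
split; first exact: VU.
by rewrite /= PsiE //; suff [] : Phi x != 0 /\ O (proj_pt (Phi x)) by []; near: x.
Unshelve. all: by end_near.
Qed.

Lemma local_param_preimage_measurable (A : set (borelP R d)) :
  measurable A -> measurable (U `&` Psi @^-1` A : set (borelRn R n.+1)).
Proof.
have [oU _ _ _ _] := hPsi.
have mU : measurable (U : set (borelRn R n.+1)) by exact: open_borelRn.
pose G : set (set (proj_space R d)) :=
  [set B | measurable (U `&` Psi @^-1` B : set (borelRn R n.+1))].
suff H : <<s @Defs.proj_open R d >> `<=` G by exact: H.
apply: smallest_sub => [|O oO].
  split.
  - by rewrite /G /= preimage_set0 setI0.
  - move=> B; rewrite /G /= setTD preimage_setC => mB.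
    rewrite -setDE (_ : U `\` _ = U `\` (U `&` Psi @^-1` B)); first exact: measurableD.
    by rewrite setDIr setDv set0U.
  - move=> F mF; rewrite /G /= preimage_bigcup setI_bigcupr.
    by apply: bigcup_measurable => i _; exact: mF.
by apply: open_borelRn; exact: local_param_preimage_open.
Qed.

(** The Borel limsup sets witness negligibility. Their preimages are covered by the complement of
    the support, the null preimage of [B0], which contains the degenerate points of [M], and the set
    [X], which is null near each of its points. *)
Theorem pushforward_VWA_null (g : riemannian_metric R d) D
    (mu : {measure set (borelRn R n.+1) -> \bar R}) : (n.+1 <= d)%N ->
  measure_on U mu -> absolutely_friendly U mu ->
  (pushforward_on U Psi mu).-negligible (M `\` D_nondegenerate n.+1 D M) ->
  (pushforward_on U Psi mu).-negligible (VWA n.+1 g M).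
Proof.
move=> nd muU fr [B0 [mB0 B00 MB0]].
have [oU _ PM _ _] := hPsi.
have [C C0 lip] := veronese_le_riem_dist g.
pose cc j : R := c_kd R n.+1 d + j.+1%:R^-1.
exists (\bigcup_j limsup_near M (C + 1) (cc j)); split; last 1 first.
- exact: VWA_limsup_near.
- by apply: bigcup_measurable => j _; exact: limsup_near_measurable.
have mlim := @limsup_near_measurable R d M (C + 1).
rewrite /pushforward_on -outer_ofE; last first.
  by apply: local_param_preimage_measurable; apply: bigcup_measurable => j _.
rewrite preimage_bigcup setI_bigcupr; apply: outer_null_bigcup => j.
pose S := msupp U mu.
pose X := [set x | [/\ S x, U x, ~ B0 (Psi x) & limsup_near M (C + 1) (cc j) (Psi x)]].
have G := measure_gauge muU fr.
have X0 : outer_of mu X = 0%E.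
  apply: outer_null_of_local => u [Su Uu nB lu].
  have [V [Phi [ch VU PsiE]]] := open_chart_of_local_param hPsi Uu.
  have [[oV _ Vu _] _] := ch.
  have Du : D_nondegenerate n.+1 D M (proj_pt (Phi u)).
    apply: contrapT => nD; apply: nB; apply: MB0; split; first by apply: PM; exists u.
    by rewrite PsiE.
  have cj : c_kd R n.+1 d < cc j by rewrite ltrDl invr_gt0.
  have C10 : 0 < C + 1 by rewrite addr_gt0.
  have [r r0 nr] := limsup_near_null nd G ch (nondegenerate_open_chart ch Du) Su cj C10.
  have /nbhs_ballP[r' /= r'0 r'V] : nbhs u V by exact: open_nbhs_nbhs.
  exists (Num.min r r'); first by rewrite lt_min r0 r'0.
  apply: outer_nullS nr => x [[Sx _ _ lx] hx].
  have Vx : V x by apply/r'V/(le_ball _ hx); rewrite ge_min lexx orbT.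
  split; last by rewrite /= -PsiE.
  by split => //; apply: le_ball hx; rewrite ge_min lexx.
have B00' : outer_of mu (U `&` Psi @^-1` B0) = 0%E.
  by rewrite outer_ofE //; exact: local_param_preimage_measurable.
apply: outer_nullS (outer_nullU (outer_msuppC oU muU) (outer_nullU B00' X0)) => x [Ux lx].
have [Sx|nSx] := pselect (S x); last by left.
by right; have [Bx|nBx] := pselect (B0 (Psi x)); [left|right].
Qed.

End PushForward.

(** * Hausdorff null sets and contents in a chart *)

Section HausdorffNull.
Context {R : realType} {T : pointedType}.
Variable rho : T -> T -> \bar R.
Local Open Scope ereal_scope.
Implicit Types (A B : set T) (delta : R).

Lemma diameter_ge0 A : 0 <= diameter rho A.
Proof. by rewrite /diameter le_max lexx. Qed.

Lemma diameter_le A (c : R) : (0 <= c)%R ->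
  (forall x y, A x -> A y -> rho x y <= c%:E) -> diameter rho A <= c%:E.
Proof.
move=> c0 H; rewrite /diameter ge_max lee_fin c0 /=.
by apply: ge_ereal_sup => _ [x Ax [y Ay <-]]; exact: H.
Qed.

Lemma diameter_set0 : diameter rho set0 = 0.
Proof.
by apply/eqP; rewrite eq_le diameter_ge0 andbT; apply: diameter_le.
Qed.

(** An infinite cost for diameters above [delta] turns the restriction on covers into a cost of
    arbitrary covers, so that [hausdorff_pre] is an instance of [cover_outer]. *)
Definition diam_cost s delta A : \bar R :=
  if diameter rho A <= delta%:E then diameter rho A ^+ s else +oo.

Lemma diam_cost0 n delta : (0 < delta)%R -> diam_cost n.+1 delta set0 = 0.
Proof.
by move=> d0; rewrite /diam_cost diameter_set0 lee_fin (ltW d0) expeS mul0e.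
Qed.

Lemma diam_cost_ge0 s delta A : 0 <= diam_cost s delta A.
Proof. by rewrite /diam_cost; case: ifP => // _; apply: expe_ge0; exact: diameter_ge0. Qed.

Lemma hausdorff_pre_cover n delta (d0 : (0 < delta)%R) A :
  hausdorff_pre rho n.+1 delta A =
  cover_outer (diam_cost0 n d0) (diam_cost_ge0 n.+1 delta) A.
Proof.
apply/eqP; rewrite eq_le; apply/andP; split; last first.
  apply: le_ereal_inf_tmp => _ [E [AE dE] <-].
  apply: le_trans (cover_outer_bigcup _ _ AE) _.
  apply: lee_nneseries => [i _ _|i _]; first exact: diam_cost_ge0.
  by rewrite /diam_cost dE.
apply: le_ereal_inf_tmp => _ [E [_ AE] <-].
have [dE|/existsNP[i /negP di]] := pselect (forall i, diameter rho (E i) <= delta%:E).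
  apply: ereal_inf_lbound; exists E => //; apply: eq_eseriesr => i _.
  by rewrite /diam_cost dE.
rewrite (@nneseriesD1 _ _ i) //; last by move=> k _; exact: diam_cost_ge0.
rewrite {1}/diam_cost (negbTE di) addye ?leey // -ltNye.
by apply: (@lt_le_trans _ _ 0) => //; apply: nneseries_ge0 => k _ _; exact: diam_cost_ge0.
Qed.

Lemma hausdorff_null n A : (forall delta, (0 < delta)%R -> hausdorff_pre rho n.+1 delta A = 0) <->
  hausdorff rho n.+1 A = 0.
Proof.
have pre0 delta : (0 < delta)%R -> 0 <= hausdorff_pre rho n.+1 delta A.
  by move=> d0; rewrite (hausdorff_pre_cover n d0) outer_measure_ge0.
split => H; last first.
  move=> delta d0; apply/eqP; rewrite eq_le pre0 // andbT -H.
  by apply: ereal_sup_ubound; exists delta.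
apply/eqP; rewrite eq_le; apply/andP; split.
  by apply: ge_ereal_sup => _ [delta d0 <-]; rewrite H.
apply: le_ereal_sup_tmp; exists (hausdorff_pre rho n.+1 1 A); last exact: pre0 ltr01.
  by exists 1%R; [exact: ltr01|].
Qed.

Lemma hausdorff_nullS n A B :
  A `<=` B -> hausdorff rho n.+1 B = 0 -> hausdorff rho n.+1 A = 0.
Proof.
move=> AB /hausdorff_null B0; apply/hausdorff_null => delta d0.
by have := B0 delta d0; rewrite !(hausdorff_pre_cover n d0); exact: outer_nullS.
Qed.

Lemma hausdorff_null_bigcup n (F : nat -> set T) :
  (forall i, hausdorff rho n.+1 (F i) = 0) -> hausdorff rho n.+1 (\bigcup_i F i) = 0.
Proof.
move=> F0; apply/hausdorff_null => delta d0; rewrite (hausdorff_pre_cover n d0).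
apply: outer_null_bigcup => i; rewrite -hausdorff_pre_cover.
by have /hausdorff_null := F0 i; apply.
Qed.

Lemma hausdorff_nullU n A B : hausdorff rho n.+1 A = 0 ->
  hausdorff rho n.+1 B = 0 -> hausdorff rho n.+1 (A `|` B) = 0.
Proof.
move=> A0 B0; apply: (@hausdorff_nullS n _ (\bigcup_i (if i is 0%N then A else B))).
  by move=> x [Ax|Bx]; [exists 0%N|exists 1%N].
by apply: hausdorff_null_bigcup; case.
Qed.

Section Content.
Variables (n : nat) (X : pointedType) (f : X -> T) (B : set X).

Definition image_cost (E : set X) : \bar R := diameter rho (f @` (E `&` B)) ^+ n.+1.

Lemma image_cost0 : image_cost set0 = 0.
Proof. by rewrite /image_cost set0I image_set0 diameter_set0 expeS mul0e. Qed.

Lemma image_cost_ge0 E : 0 <= image_cost E.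
Proof. by apply: expe_ge0; exact: diameter_ge0. Qed.

(** The covers in the content obey no bound on diameters, but one of total cost less than
    [delta ^ (n + 1)] consists of sets whose images have diameter at most [delta]. *)
Lemma hausdorff_null_content (A : set X) : cover_outer image_cost0 image_cost_ge0 A = 0 ->
  hausdorff rho n.+1 (f @` (A `&` B)) = 0.
Proof.
move=> A0; apply/hausdorff_null => delta d0.
apply/eqP; rewrite eq_le; apply/andP; split; last first.
  by rewrite (hausdorff_pre_cover n d0) outer_measure_ge0.
apply/lee_addgt0Pr => e e0; rewrite add0e.
have de : (0 < Num.min e (delta ^+ n.+1))%R by rewrite lt_min e0 exprn_gt0.
have : cover_outer image_cost0 image_cost_ge0 A < (Num.min e (delta ^+ n.+1))%:E.
  by rewrite A0 lte_fin.
move=> /cover_outer_lt[E AE sE].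
apply: (@le_trans _ _ (\sum_(0 <= i <oo) image_cost (E i))); last first.
  by apply/ltW/(lt_le_trans sE); rewrite lee_fin ge_min lexx.
apply: ereal_inf_lbound; exists (fun i => f @` (E i `&` B)) => //; split.
  by move=> _ [x [Ax Bx] <-]; have [i _ Ei] := AE x Ax; exists i => //; exists x.
move=> i; rewrite leNgt; apply/negP => di.
have : image_cost (E i) < (delta ^+ n.+1)%:E.
  apply: (@le_lt_trans _ _ (\sum_(0 <= i <oo) image_cost (E i))).
    rewrite (@nneseriesD1 _ _ i) //; last by move=> k _; exact: image_cost_ge0.
    by rewrite leeDl // nneseries_ge0 // => k _ _; exact: image_cost_ge0.
  by apply: (lt_le_trans sE); rewrite lee_fin ge_min lexx orbT.
rewrite ltNge => /negP; apply.
rewrite /image_cost; move: di (diameter_ge0 (f @` (E i `&` B))).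
case: (diameter _ _) => [r| |] //.
  by rewrite !lte_fin => dr r0; rewrite -EFin_expe lee_fin lerXn2r ?nnegrE // ltW // (lt_trans d0).
move=> _ _; suff -> : +oo ^+ n.+1 = +oo :> \bar R by rewrite leey.
by elim: n => [|m IH]; rewrite expeS ?mule1 // IH mulyy.
Qed.

End Content.
End HausdorffNull.

Section HausdorffPart.
Context {R : realType} {n d : nat}.

Lemma smooth_lipschitz V (Phi : 'rV[R]_n -> 'rV[R]_d.+1) v0 :
  open V -> smooth_on V Phi -> V v0 -> exists K r : R, [/\ 0 < K, 0 < r,
  ball v0 r `<=` V & forall x z, ball v0 r x -> ball v0 r z ->
    `|Phi x - Phi z| <= K * `|x - z| ].
Proof.
move=> oV Ps Vv0.
have [K K0 PK] := smooth_near_bounded 1 Ps Vv0.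
have : \forall x \near v0, V x /\
    forall s, (size s <= 1)%N -> `|dpartials s Phi x| <= K.
  by near=> x; split; near: x; [exact: open_nbhs_nbhs|exact: PK].
move=> /nbhs_ballP[r /= r0 hr].
(* [n.+1] in place of [n] keeps the constant positive when [n = 0]. *)
exists (n.+1%:R * K), r; split => //; first by rewrite mulr_gt0.
  by move=> x /hr[].
move=> x z hx hz; apply: rV_norm_leP => [|l]; first by rewrite !mulr_ge0 // ltW.
pose f := pairing Phi (delta_mx l 0).
have fs : smooth_on V f by exact: smooth_pairing.
rewrite mxsubE -!coord_pairing; apply: (@le_trans _ _ (n%:R * K * `|x - z|)).
  apply: (@mvt_ball R n f v0 x z r K) => //.
    by move=> u i /hr[Vu _]; exact: (smooth_derivable [::] i fs Vu).
  move=> u i /hr[Vu h].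
  have -> : dpartial i f u = dpartial i Phi u 0 l.
    have := dpartials_pairing (delta_mx l 0) [:: i] oV Ps Vu.
    by rewrite /= => ->; rewrite coord_pairing.
  by apply: le_trans (coord_le_norm _ _) _; exact: (h [:: i]).
by rewrite !ler_wpM2r ?(ltW K0) // ler_nat.
Unshelve. all: by end_near. Qed.

End HausdorffPart.

(** * The assertion for the Hausdorff measure on the manifold *)

Section LambdaPart.
Context {R : realType} {n d : nat}.
Variables (g : riemannian_metric R d) (M : set (proj_space R d)) (D : nat).
Hypothesis nd : (n.+1 <= d)%N.

Let null (A : set (proj_space R d)) := hausdorff (riem_dist g) n.+1 A = 0%E.

(** Near [v0] the chart is Lipschitz from the max norm to [riem_dist], so the image of a ball of
    radius [t] has diameter [O(t)] and [content_gauge] applies. The factor 2 is the passage from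
    radius to diameter. *)
Lemma chart_gauge V (Phi : 'rV[R]_n.+1 -> 'rV[R]_d.+1) v0 :
  open V -> smooth_on V Phi -> V v0 -> Phi v0 != 0 ->
  exists2 r : R, 0 < r & gauge (cover_outer
    (image_cost0 (riem_dist g) n (fun v => proj_pt (Phi v)) (ball v0 r))
    (image_cost_ge0 (riem_dist g) n (fun v => proj_pt (Phi v)) (ball v0 r)))
    setT (fun _ r => (`|r| ^+ n.+1)%:E).
Proof.
move=> oV Ps Vv0 P0.
have [C [s [C0 s0 hC]]] := riem_dist_segment g P0.
have [K [r1 [K0 r10 r1V hK]]] := smooth_lipschitz oV Ps Vv0.
pose r := Num.min r1 (s / K).
have r0 : 0 < r by rewrite lt_min r10 divr_gt0.
have rr1 : r <= r1 by rewrite ge_min lexx.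
have inS x : ball v0 r x -> ball (Phi v0) s (Phi x).
  move=> hx; have hx1 := le_ball rr1 hx; rewrite ball_rVE.
  apply: le_lt_trans (hK v0 x (ballxx _ r10) hx1) _.
  rewrite mulrC -ltr_pdivlMr //; move: hx; rewrite ball_rVE => /lt_le_trans; apply.
  by rewrite ge_min lexx orbT.
exists r => //; apply: (@content_gauge R n _ _ _ ((2 * (C * K)) ^+ n.+1)).
  by rewrite exprn_gt0 // !mulr_gt0.
move=> E z t t0 Et; rewrite /image_cost -exprMn EFin_expe.
have t2 : 0 <= 2 * (C * K) * t by rewrite !mulr_ge0 // ltW.
set X := [set _ | _ in _].
have h : (diameter (riem_dist g) X <= (2 * (C * K) * t)%:E)%E.
  apply: diameter_le => // _ _ [x [Ex Bx] <-] [y [Ey By] <-].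
  apply: le_trans (hC _ _ (inS x Bx) (inS y By)) _; rewrite lee_fin.
  rewrite (mulrC 2) -!mulrA ler_wpM2l ?(ltW C0) //.
  apply: (le_trans (hK x y (le_ball rr1 Bx) (le_ball rr1 By))).
  rewrite ler_wpM2l ?(ltW K0) //.
  have := Et x Ex; have := Et y Ey; rewrite !ball_rVE.
  have := ler_distD z x y; rewrite (distrC x z).
  lra.
move: h (diameter_ge0 (riem_dist g) X); case: (diameter _ _) => [q| |] // + q0.
by rewrite -!EFin_expe !lee_fin in q0 * => h; rewrite lerXn2r ?nnegrE.
Qed.

(** [limsup_near_null] is applied to the content of a chart, with [setT] as support. The null set of
    parameters is carried to [M] by [hausdorff_null_content], and relative openness of the chart
    image provides [O]. *)
Lemma limsup_near_hausdorff_null P (c C : R) : c_kd R n.+1 d < c -> 0 < C ->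
  M P -> D_nondegenerate n.+1 D M P ->
  exists2 O, Defs.proj_open O /\ O P & null (O `&` M `&` limsup_near M C c).
Proof.
move=> cc C0 MP DP; have [V' [Phi' [v [[oV' _ _ lp] [Vv PE _]]]]] := DP.
have [V [Phi [ch VV' PhiE]]] := open_chart_of_local_param lp Vv.
have [[oV Ps Vv0 Pn0] [_ HO]] := ch.
have PE' : proj_pt (Phi v) = P by rewrite -PhiE.
have Dv : D_nondegenerate n.+1 D M (proj_pt (Phi v)) by rewrite PE'.
have [r1 r10 G] := chart_gauge oV Ps Vv0 (Pn0 v Vv0).
have [r2 r20 nr] :=
  limsup_near_null nd G ch (nondegenerate_open_chart ch Dv) I cc C0.
have nW : nbhs v (V `&` ball v r1 `&` ball v r2).
  apply: filterI; first apply: filterI.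
  - exact: open_nbhs_nbhs.
  - exact: nbhsx_ballx.
  - exact: nbhsx_ballx.
have oW : open (V `&` ball v r1 `&` ball v r2).
  by apply: openI; [apply: openI => //|]; exact: ball_open.
have WV : V `&` ball v r1 `&` ball v r2 `<=` V by move=> x [[]].
have [Op oO OE] := HO _ oW WV.
have OP : (Op `&` M) P by rewrite -OE; exists v => //; exact: nbhs_singleton nW.
exists Op; first by split => //; case: OP.
apply: hausdorff_nullS (hausdorff_null_content nr) => Q [+ lQ].
rewrite -OE => -[x [[Vx hx1] hx2] xQ]; exists x => //.
by split => //; split => //=; rewrite xQ.
Qed.

Theorem lambda_VWA_null :
  lambda_meas g n.+1 M (M `\` D_nondegenerate n.+1 D M) = 0%E ->
  lambda_meas g n.+1 M (VWA n.+1 g M) = 0%E.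
Proof.
rewrite /lambda_meas => deg0.
have [C C0 lip] := veronese_le_riem_dist g.
pose cc j : R := c_kd R n.+1 d + j.+1%:R^-1.
pose Y j := limsup_near M (C + 1) (cc j) `&` (M `&` D_nondegenerate n.+1 D M).
suff Y0 j : null (Y j).
  apply: hausdorff_nullS (hausdorff_nullU deg0 (hausdorff_null_bigcup Y0)).
  move=> P [/(VWA_limsup_near (ltn0Sn n) C0 lip) [j _ lP] MP].
  by have [nP|nP] := pselect (D_nondegenerate n.+1 D M P); [right; exists j|left].
have cj : c_kd R n.+1 d < cc j by rewrite ltrDl invr_gt0.
have C10 : 0 < C + 1 by rewrite addr_gt0.
(* The countable covering argument is for sets of row vectors, so it is applied to the cone of
   nonzero lifts of [Y j]. *)
pose X := [set x : 'rV[R]_d.+1 | x != 0 /\ Y j (proj_pt x)].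
rewrite /null; apply: (hausdorff_nullS (B := @proj_pt R d @` X)).
  by move=> P YP; exists (rep P); rewrite ?proj_ptK //; split; rewrite ?rep_neq0 ?proj_ptK.
apply: (@null_of_local R d.+1 (fun A => null (@proj_pt R d @` A))).
- by move=> A B AB; apply: hausdorff_nullS; exact: image_subset.
- by move=> F F0; rewrite image_bigcup; exact: hausdorff_null_bigcup.
- rewrite image_set0; apply: hausdorff_nullS deg0; exact: sub0set.
move=> x [x0 [lx [Mx Dx]]].
have [Op [oO Ox] nO] := limsup_near_hausdorff_null cj C10 Mx Dx.
have : nbhs x [set y : 'rV[R]_d.+1 | y != 0 /\ Op (proj_pt y)].
  by apply: open_nbhs_nbhs.
move=> /nbhs_ballP[r /= r0 hr]; exists r => //.
by apply: hausdorff_nullS nO => _ [y [[_ [ly [My _]]] /hr[_ Oy]] <-].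
Qed.

End LambdaPart.

Theorem theorem5p4 (R : realType) (k d : nat) (hk : (1 <= k <= d)%N)
    (g : riemannian_metric R d) (M : set (proj_space R d))
    (hM : submanifold k M) (D : nat) :
  (forall (U : set 'rV[R]_k) (Psi : 'rV[R]_k -> proj_space R d)
      (mu : {measure set (borelRn R k) -> \bar R}),
    local_param M U Psi -> measure_on U mu -> absolutely_friendly U mu ->
    (pushforward_on U Psi mu).-negligible
      (M `\` D_nondegenerate k D M) ->
    (pushforward_on U Psi mu).-negligible (VWA k g M)) /\
  (lambda_meas g k M (M `\` D_nondegenerate k D M) = 0%E ->
   lambda_meas g k M (VWA k g M) = 0%E).
Proof.
case: k hk hM => [//|n] /andP[_ nd] _; split; last exact: lambda_VWA_null.
by move=> U Psi mu lp muU fr; exact: pushforward_VWA_null.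
Qed.
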